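(* Let $p\in\{5,7\}$. There exist nonzero constants $c_5\in\mathbb{Z}/5\mathbb{Z}$ and $c_7\in\mathbb{Z}/7\mathbb{Z}$ such that for all $r,s\in\mathbb{P}^1(\mathbb{Q})$, $$\alpha_p\overline{\varphi}^+_\Delta(\{r\}-\{s\})\equiv c_p\big(\phi_p(\{r\})-\phi_p(\{s\})\big)\pmod p,$$ where $\phi_p:\mathbb{P}^1(\mathbb{Q})\to\mathbb{Z}/p\mathbb{Z}$ is the $\Gamma_1(p)$-invariant function given by: for $p=5$, $\phi_5(r)=2$ if $r\in\Gamma_1(5)\{\infty\}$, $\phi_5(r)=3$ if $r\in\Gamma_1(5)\{2/5\}$, and $\phi_5(r)=0$ otherwise; for $p=7$, $\phi_7(r)=2$ if $r\in\Gamma_1(7)\{\infty\}$, $\phi_7(r)=1$ if $r\in \Gamma_1(7)\{2/7\}$, $\phi_7(r)=4$ if $r\in\Gamma_1(7)\{3/7\}$, and $\phi_7(r)=0$ otherwise.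
   Context: $\Delta=\sum_{n\ge1}\tau(n)q^n=q\prod_{n\ge1}(1-q^n)^{24}$. For a commutative ring $R$, $V_k(R)$ is the $R$-module of homogeneous degree-$k$ polynomials in $X,Y$, with right $\mathrm{GL}_2$-action $(P|_\gamma)(X,Y)=P(dX-cY,-bX+aY)$ for $\gamma=\begin{pmatrix}a&b\\c&d\end{pmatrix}$; $\mathrm{Div}^0$ is the group of degree-zero divisors on $\mathbb{P}^1(\mathbb{Q})$. $\varphi^+_\Delta\in\mathrm{Hom}_{\mathrm{SL}_2(\mathbb{Z})}(\mathrm{Div}^0,V_{10}(\mathbb{C}))$ is the sign-$+1$ (plus) part of the modular symbol $\{r\}-\{s\}\mapsto 2\pi i\int_s^r\Delta(z)(zX+Y)^{10}\,dz$ (integral along the geodesic in the upper half-plane), divided by its cohomological period at $p$ in the sense of Pollack–Weston, so that $\varphi^+_\Delta$ takes values in $V_{10}(\mathbb{Z}_{(p)})$ and not all its values lie in $pV_{10}(\mathbb{Z}_{(p)})$. $\overline{\varphi}^+_\Delta$ is its reduction modulo $p$, and $\alpha_p\overline{\varphi}^+_\Delta(D)=\overline{\varphi}^+_\Delta(D)(0,1)\in\mathbb{Z}/p\mathbb{Z}$ (evaluation at $(X,Y)=(0,1)$). The functions $\phi_5,\phi_7$ are the reductions modulo $p$ of the weight-$0$ boundary symbols attached to the Eisenstein series $E_{2,\omega_5^2,\mathbbm 1}$ and $E_{2,\omega_7^4,\mathbbm 1}$ respectively ($\omega_p$ the Teichmüller character), evaluated at the constant polynomial $1$. *)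

(* Defs.v *)
From HB Require Import structures.
From mathcomp Require Import all_boot all_order all_algebra.
From mathcomp Require Import all_classical all_reals all_analysis.
From mathcomp Require Import Rstruct Rstruct_topology.
From mathcomp Require Import complex.
Set Implicit Arguments. Unset Strict Implicit. Unset Printing Implicit Defensive.
Import Order.TTheory GRing.Theory Num.Theory.
Import numFieldNormedType.Exports.
Local Open Scope classical_set_scope.
Local Open Scope ring_scope.
Local Open Scope complex_scope.

Notation RR := Rdefinitions.R.
Notation CC := (complex Rdefinitions.R).

Definition P1Q := option rat.
Definition P1oo : P1Q := None.

Definition mobius (a b c d : int) (x : P1Q) : P1Q :=
  match x with
  | None => if c == 0 then None else Some (a%:~R / c%:~R)
  | Some x => let den := c%:~R * x + d%:~R in
      if den == 0 then None else Some ((a%:~R * x + b%:~R) / den)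
  end.

Definition in_Gamma1 (N : nat) (a b c d : int) : bool :=
  [&& a * d - b * c == 1, (a == 1 %[mod N])%Z, (d == 1 %[mod N])%Z
    & (N%:Z %| c)%Z].

Definition Gamma1_orbit (N : nat) (x y : P1Q) : Prop :=
  exists a b c d : int, in_Gamma1 N a b c d /\ y = mobius a b c d x.

Definition pt (n d : nat) : P1Q := Some (n%:R / d%:R).

Definition phi (p : nat) (x : P1Q) : 'F_p :=
  if p == 5%N then
    (if `[< Gamma1_orbit 5 P1oo x >] then 2%:R
     else if `[< Gamma1_orbit 5 (pt 2 5) x >] then 3%:R else 0)
  else if p == 7%N then
    (if `[< Gamma1_orbit 7 P1oo x >] then 2%:R
     else if `[< Gamma1_orbit 7 (pt 2 7) x >] then 1%:R
     else if `[< Gamma1_orbit 7 (pt 3 7) x >] then 4%:R else 0)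
  else 0.

Definition CRe (z : CC) : RR := complex.Re z.
Definition CIm (z : CC) : RR := complex.Im z.

Definition qexp (z : CC) : CC :=
  (expR (- (2 * pi * CIm z)) * cos (2 * pi * CRe z)) +i*
  (expR (- (2 * pi * CIm z)) * sin (2 * pi * CRe z)).

Definition Delta_partial (z : CC) (N : nat) : CC :=
  qexp z * \prod_(1 <= n < N.+1) (1 - qexp z ^+ n) ^+ 24.

Definition Delta (z : CC) : CC :=
  (limn (fun N => CRe (Delta_partial z N))) +i*
  (limn (fun N => CIm (Delta_partial z N))).

Definition Cintegral (D : set RR) (h : RR -> CC) : CC :=
  (\int[lebesgue_measure]_(t in D) CRe (h t)) +i*
  (\int[lebesgue_measure]_(t in D) CIm (h t)).

Definition Ci : CC := 0 +i* 1.

(* Integral of f dz along the hyperbolic geodesic from s to r in the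
   upper half-plane.  For s, r in Q it is the half circle with endpoints s, r,
   parametrised by th in ]0, pi[ from s (th = 0) to r (th = pi); for one
   endpoint oo it is the vertical half-line. *)
Definition geod_integral (f : CC -> CC) (s r : P1Q) : CC :=
  match s, r with
  | Some s, Some r =>
    let m : RR := (ratr r + ratr s) / 2 in
    let rho : RR := (ratr s - ratr r) / 2 in
    Cintegral [set th | 0 < th < pi]
      (fun th => f ((m + rho * cos th) +i* (`|rho| * sin th)) *
                 ((- (rho * sin th)) +i* (`|rho| * cos th)))
  | Some s, None => Cintegral [set t | 0 < t] (fun t => f (ratr s +i* t) * Ci)
  | None, Some r => - Cintegral [set t | 0 < t] (fun t => f (ratr r +i* t) * Ci)
  | None, None => 0
  end.

(* V_10(C) is represented by coefficient vectors: the coefficient of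
   X^j Y^(10-j), j : 'I_11.  The modular symbol
   {r}-{s} |-> 2 pi i int_s^r Delta(z) (zX+Y)^10 dz has j-th coefficient: *)
Definition modsym_coef (j : 'I_11) (r s : P1Q) : CC :=
  ('C(10, j))%:R * ((0 +i* (2 * pi)) * geod_integral (fun z => Delta z * z ^+ j) s r).

(* iota = diag(-1,1): acts on P^1(Q) by x |-> -x, and on V_10 by
   (P|iota)(X,Y) = P(X,-Y), i.e. multiplies the X^j Y^(10-j) coefficient by
   (-1)^(10-j) = (-1)^j.  The plus part is (phi + phi|iota)/2 with
   (phi|iota)(D) = phi(iota D)|iota. *)
Definition P1neg (x : P1Q) : P1Q := omap (fun y => - y) x.

Definition modsym_plus_coef (j : 'I_11) (r s : P1Q) : CC :=
  (modsym_coef j r s + (-1) ^+ j * modsym_coef j (P1neg r) (P1neg s)) / 2.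

Definition is_Zploc (p : nat) (x : CC) (q : rat) : Prop :=
  x = ratr q /\ ~~ (p%:Z %| denq q)%Z.

(* Om is a cohomological period at p (Pollack--Weston): phi^+ / Om takes
   values in V_10(Z_(p)) and not all of them lie in p V_10(Z_(p)).
   (Div^0 is generated by the {r}-{s}, so it suffices to look at those.) *)
Definition is_cohom_period (p : nat) (Om : CC) : Prop :=
  Om != 0 /\
  (forall (j : 'I_11) (r s : P1Q), exists q : rat,
      is_Zploc p (modsym_plus_coef j r s / Om) q) /\
  (exists (j : 'I_11) (r s : P1Q), exists q : rat,
      is_Zploc p (modsym_plus_coef j r s / Om) q /\ ~~ (p%:Z %| numq q)%Z).

Definition redp (p : nat) (q : rat) : 'F_p := (numq q)%:~R / (denq q)%:~R.

(* Main.v *)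
(* The coefficients of the period symbol of [Delta] are limits, at rational cusps,
   of the primitives of [Delta(z) z^j] that vanish at infinity.  Modularity of
   [Delta], derived from the transformation law of the Eisenstein series [E2] (itself
   obtained by summing the partial fractions of the cotangent over the lattice in two
   orders), turns translation and inversion of the cusp into linear rules on these limits.
   The rules, together with the value -24 of the Hecke operator [T_2] on [Delta]
   (which follows from the Jacobi triple product), determine the even period
   polynomial up to a nonzero scalar:
     36 (Y^10 - X^10) - 691 (X^2 Y^8 - 3 X^4 Y^6 + 3 X^6 Y^4 - X^8 Y^2).
   Hence every value of the plus symbol is an integral multiple of this scalar.
   Modulo 5 and 7 the polynomial, seen as a function on [F_p^2], is the difference of
   two values of an explicit Eisenstein boundary symbol obeying the same two rules, and
   every cusp is reached from infinity by translations and inversions. *)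

(* The two linear rules alone leave a two-dimensional space of even period polynomials, spanned by
   [Y^10 - X^10] and the form carrying the factor 691; the eigenvalue of [T_2] is what fixes the
   ratio -691/36. Complex analysis is reduced to real analysis: the mean value theorem along
   segments and dominated convergence. A function with zero derivative on the half-plane is
   constant, and this one principle gives the modularity of [Delta] as well as every rule for its
   primitives. Geodesic integrals are compared with these primitives through an improper fundamental
   theorem of calculus. The congruence rests on [p - 1] dividing 12, so that [z^10 = z^-2] for
   nonzero [z] in F_p, and on the values [36 + 4 * 691 = 2800] and [3 * 691 - 36 = 2037], divisible
   by 5 and by 7. The boundary symbol has value [-36 a^2] at the point [(0, 1)] for a cusp [a / b]
   with [p] dividing [b], while the table [phi_p] is [2 a^2]: hence the constant -18. Two admissible
   periods differ by a [p]-adic unit, so [c_p] varies with the period but never vanishes. *)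
Require Import Defs.
From HB Require Import structures.
From mathcomp Require Import all_boot all_order all_algebra all_field.
From mathcomp Require Import all_classical all_reals all_analysis measurable_realfun.
From mathcomp Require Import complex zify ring lra.
Set Implicit Arguments. Unset Strict Implicit. Unset Printing Implicit Defensive.
Import Order.TTheory GRing.Theory Num.Theory.
Import numFieldNormedType.Exports.
Local Open Scope classical_set_scope.
Local Open Scope ring_scope.
Local Open Scope complex_scope.

(** * Modulus, limits and series of complex numbers; dominated convergence *)

Section ComplexModulus.
Variable R : realType.
Notation C := (complex R).
Implicit Types (z w : C) (u v : nat -> C).

Definition cabs z : R := Num.sqrt (complex.Re z ^+ 2 + complex.Im z ^+ 2).

Lemma normcE z : `|z| = (cabs z)%:C.
Proof. exact: normc_def. Qed.

Lemma cabs_ge0 z : 0 <= cabs z. Proof. exact: sqrtr_ge0. Qed.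

Lemma cabs2 z : cabs z ^+ 2 = complex.Re z ^+ 2 + complex.Im z ^+ 2.
Proof. by rewrite /cabs sqr_sqrtr // addr_ge0 ?sqr_ge0. Qed.

Lemma cabsM z w : cabs (z * w) = cabs z * cabs w.
Proof. by apply: (@complexI R); rewrite rmorphM /= -!normcE normrM. Qed.

Lemma cabsN z : cabs (- z) = cabs z.
Proof. by apply: (@complexI R); rewrite -!normcE normrN. Qed.

Lemma cabsD z w : cabs (z + w) <= cabs z + cabs w.
Proof. by rewrite -lecR rmorphD /= -!normcE ler_normD. Qed.

Lemma cabs0 : cabs 0 = 0.
Proof. by apply: (@complexI R); rewrite -!normcE normr0. Qed.

Lemma cabs1 : cabs 1 = 1.
Proof. by apply: (@complexI R); rewrite -!normcE normr1. Qed.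

Lemma cabsX z n : cabs (z ^+ n) = cabs z ^+ n.
Proof. by apply: (@complexI R); rewrite rmorphXn /= -!normcE normrX. Qed.

Lemma cabsV z : cabs z^-1 = (cabs z)^-1.
Proof. by apply: (@complexI R); rewrite fmorphV /= -!normcE normfV. Qed.

Lemma cabs_real (x : R) : cabs x%:C = `|x|.
Proof. by rewrite /cabs /= expr0n addr0 sqrtr_sqr. Qed.

Lemma cabs_nat n : cabs n%:R = n%:R.
Proof.
have -> : (n%:R : C) = (n%:R)%:C by rewrite rmorph_nat.
by rewrite cabs_real ger0_norm.
Qed.

Lemma cabs_eq0 z : (cabs z == 0) = (z == 0).
Proof. by rewrite -(inj_eq (@complexI R)) -normcE normr_eq0. Qed.

Lemma cabs_gt0 z : (0 < cabs z) = (z != 0).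
Proof. by rewrite lt_neqAle cabs_ge0 andbT eq_sym cabs_eq0. Qed.

Lemma cabsB z w : cabs (z - w) = cabs (w - z).
Proof. by rewrite -cabsN opprB. Qed.

Lemma cabs_Re z : `|complex.Re z| <= cabs z.
Proof. by rewrite -sqrtr_sqr ler_wsqrtr // lerDl sqr_ge0. Qed.

Lemma cabs_Im z : `|complex.Im z| <= cabs z.
Proof. by rewrite -sqrtr_sqr ler_wsqrtr // lerDr sqr_ge0. Qed.

Lemma cabs_le_ReIm z : cabs z <= `|complex.Re z| + `|complex.Im z|.
Proof.
rewrite -ler_sqr ?nnegrE ?cabs_ge0 ?addr_ge0 // cabs2 sqrrD -!normrX.
by rewrite !(ger0_norm (sqr_ge0 _)) lerD2r lerDl mulrn_wge0 // mulr_ge0.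
Qed.

Lemma cabsB_ge z w : cabs z - cabs w <= cabs (z - w).
Proof. by rewrite lerBlDr -{1}(subrK w z) cabsD. Qed.

Lemma cabsD_ge z w : cabs z - cabs w <= cabs (z + w).
Proof. by rewrite -{2}(opprK w) -(cabsN w) cabsB_ge. Qed.

Lemma cabs_sum (I : Type) (r : seq I) (P : pred I) (F : I -> C) :
  cabs (\sum_(i <- r | P i) F i) <= \sum_(i <- r | P i) cabs (F i).
Proof.
elim/big_rec2: _ => [|i y x _ le]; first by rewrite cabs0.
by rewrite (le_trans (cabsD _ _)) // lerD2l.
Qed.

Lemma ReD z w : complex.Re (z + w) = complex.Re z + complex.Re w.
Proof. by case: z; case: w. Qed.
Lemma ImD z w : complex.Im (z + w) = complex.Im z + complex.Im w.
Proof. by case: z; case: w. Qed.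
Lemma ReN z : complex.Re (- z) = - complex.Re z. Proof. by case: z. Qed.
Lemma ImN z : complex.Im (- z) = - complex.Im z. Proof. by case: z. Qed.
Lemma ReM z w : complex.Re (z * w) =
  complex.Re z * complex.Re w - complex.Im z * complex.Im w.
Proof. by case: z; case: w. Qed.
Lemma ImM z w : complex.Im (z * w) =
  complex.Re z * complex.Im w + complex.Im z * complex.Re w.
Proof. by case: z; case: w. Qed.
Lemma ImV z : complex.Im z^-1 = - complex.Im z / cabs z ^+ 2.
Proof. by rewrite cabs2; case: z => a b /=; rewrite mulNr. Qed.
Lemma complexP z w :
  complex.Re z = complex.Re w -> complex.Im z = complex.Im w -> z = w.
Proof. by case: z; case: w => a b c d /= -> ->. Qed.

(** Measuring the distance by the real modulus turns every complex limit into a real one. *)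
Definition ccvg u (l : C) := (fun n => cabs (u n - l)) @ \oo --> (0 : R).

Lemma ccvgP u l :
  ccvg u l <-> forall e : R, 0 < e -> exists N, forall n, (N <= n)%N ->
                                                     cabs (u n - l) < e.
Proof.
split=> [/cvgrPdist_lt h e e0 | h].
  have [N _ hN] := h e e0; exists N => n Nn; have := hN n Nn.
  by rewrite /= sub0r normrN ger0_norm ?cabs_ge0.
apply/cvgrPdist_lt => e e0; have [N hN] := h e e0.
exists N => // n Nn; rewrite /= sub0r normrN ger0_norm ?cabs_ge0 //.
exact: hN.
Qed.

Lemma ccvg_squeeze u l (b : nat -> R) (N0 : nat) :
  (forall n, (N0 <= n)%N -> cabs (u n - l) <= b n) -> b @ \oo --> (0 : R) -> ccvg u l.
Proof.
move=> h hb; apply: (@squeeze_cvgr _ _ _ _ (fun=> 0) b) => //; last exact: cvg_cst.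
by exists N0 => // n /h /= ->; rewrite cabs_ge0.
Qed.

Lemma ccvg_cst (l : C) : ccvg (fun=> l) l.
Proof. by rewrite /ccvg subrr cabs0; exact: cvg_cst. Qed.

Lemma ccvg_eq u v l (N0 : nat) :
  (forall n, (N0 <= n)%N -> u n = v n) -> ccvg u l -> ccvg v l.
Proof.
move=> h hu; apply: (@ccvg_squeeze _ _ (fun n => cabs (u n - l)) N0) => // n /h ->.
by [].
Qed.

Lemma ccvgD u v k l : ccvg u k -> ccvg v l -> ccvg (fun n => u n + v n) (k + l).
Proof.
move=> hu hv.
apply: (@ccvg_squeeze _ _ (fun n => cabs (u n - k) + cabs (v n - l)) 0%N) => [n _|].
  by rewrite opprD addrACA cabsD.
by rewrite -[X in _ --> X](addr0 0); exact: cvgD.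
Qed.

Lemma ccvgN u k : ccvg u k -> ccvg (fun n => - u n) (- k).
Proof.
move=> hu; apply: (@ccvg_squeeze _ _ (fun n => cabs (u n - k)) 0%N) => [n _|//].
by rewrite -opprD cabsN.
Qed.

Lemma ccvgB u v k l : ccvg u k -> ccvg v l -> ccvg (fun n => u n - v n) (k - l).
Proof. by move=> hu hv; apply: ccvgD => //; apply: ccvgN. Qed.

Lemma ccvgM u v k l : ccvg u k -> ccvg v l -> ccvg (fun n => u n * v n) (k * l).
Proof.
move=> hu hv.
apply: (@ccvg_squeeze _ _ (fun n => cabs (u n - k) * cabs (v n - l) +
   (cabs k * cabs (v n - l) + cabs (u n - k) * cabs l)) 0%N) => [n _|].
  have -> : u n * v n - k * l =
    (u n - k) * (v n - l) + (k * (v n - l) + (u n - k) * l) by ring.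
  rewrite -!cabsM (le_trans (cabsD _ _)) // lerD2l cabsD //.
have -> : (0 : R) = 0 * 0 + (cabs k * 0 + 0 * cabs l) by ring.
apply: cvgD; first exact: cvgM.
by apply: cvgD; apply: cvgM => //; exact: cvg_cst.
Qed.

Lemma ccvgZ (a : C) u l : ccvg u l -> ccvg (fun n => a * u n) (a * l).
Proof. by move=> h; apply: ccvgM => //; exact: ccvg_cst. Qed.

Lemma ccvgX u l k : ccvg u l -> ccvg (fun n => u n ^+ k) (l ^+ k).
Proof.
move=> h; elim: k => [|k IH].
  by under eq_fun do rewrite expr0; rewrite expr0; exact: ccvg_cst.
by under eq_fun do rewrite exprS; rewrite exprS; exact: ccvgM.
Qed.

Lemma ccvg_lt u l (e : R) : ccvg u l -> 0 < e -> exists N, forall n, (N <= n)%N ->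
   cabs (u n - l) < e.
Proof. by move=> /ccvgP; apply. Qed.

Lemma ccvg_unique u k l : ccvg u k -> ccvg u l -> k = l.
Proof.
move=> hk hl; apply/eqP; rewrite -subr_eq0 -cabs_eq0; apply/negPn/negP => h.
have h0 : 0 < cabs (k - l) / 2 by rewrite divr_gt0 // lt_neqAle eq_sym h cabs_ge0.
have [N1 h1] := ccvg_lt hk h0; have [N2 h2] := ccvg_lt hl h0.
have := h1 _ (leq_maxl N1 N2); have := h2 _ (leq_maxr N1 N2).
set x := u _ => a b; have := cabsD (k - x) (x - l).
rewrite addrA subrK (cabsB k x) => c.
by have := le_lt_trans c (ltrD b a); rewrite -splitr ltxx.
Qed.

Lemma ccvgV u l : l != 0 -> ccvg u l -> ccvg (fun n => (u n)^-1) l^-1.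
Proof.
move=> l0 hu; have al : 0 < cabs l by rewrite cabs_gt0.
have [N hN] := ccvg_lt hu (divr_gt0 al (ltr0Sn R 1)).
apply: (@ccvg_squeeze _ _ (fun n => (2 / cabs l ^+ 2) * cabs (u n - l)) N) => [n Nn|].
  have lo : cabs l / 2 < cabs (u n).
    have := hN n Nn; have := cabsB_ge l (l - u n).
    by rewrite opprB addrCA subrr addr0 (cabsB l); lra.
  have un0 : u n != 0 by rewrite -cabs_gt0; apply: lt_trans lo; rewrite divr_gt0.
  have -> : (u n)^-1 - l^-1 = (l - u n) / (u n * l) by field; rewrite un0 l0.
  rewrite cabsM cabsV cabsM (cabsB l) mulrC ler_wpM2r ?cabs_ge0 //.
  have -> : 2 / cabs l ^+ 2 = (cabs l / 2 * cabs l)^-1.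
    by field; rewrite gt_eqF.
  by rewrite lef_pV2 ?posrE ?mulr_gt0 ?divr_gt0 ?cabs_gt0 // ler_wpM2r // ltW.
rewrite -[X in _ --> X](mulr0 (2 / cabs l ^+ 2)).
by apply: cvgM => //; exact: cvg_cst.
Qed.

Lemma ccvg_abs_le u l (B : R) (N0 : nat) : ccvg u l ->
  (forall n, (N0 <= n)%N -> cabs (u n) <= B) -> cabs l <= B.
Proof.
move=> hu hB; rewrite leNgt; apply/negP => h.
have [N hN] : exists N, forall n, (N <= n)%N -> cabs (u n - l) < cabs l - B.
  by apply: (ccvg_lt hu); rewrite subr_gt0.
have a := hN _ (leq_maxl N N0); have b := hB _ (leq_maxr N N0).
have := cabsB_ge l (l - u (maxn N N0)).
by rewrite opprB addrCA subrr addr0 (cabsB l); lra.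
Qed.

Lemma ccvg_sub u l (m : nat -> nat) :
  (forall K, exists N, forall n, (N <= n)%N -> (K <= m n)%N) ->
  ccvg u l -> ccvg (fun n => u (m n)) l.
Proof.
move=> hm /ccvgP hu; apply/ccvgP => e e0; have [K hK] := hu e e0.
by have [N hN] := hm K; exists N => n /hN; exact: hK.
Qed.

Lemma ccvgS u l : ccvg u l <-> ccvg (fun n => u n.+1) l.
Proof.
split=> h; first by apply: (ccvg_sub _ h) => K; exists K => n /leqW.
move/ccvgP: h => h; apply/ccvgP => e /h [N hN]; exists N.+1 => -[//|n].
by rewrite ltnS; exact: hN.
Qed.

Lemma ccvg_ReIm u l : ccvg u l ->
  (fun n => complex.Re (u n)) @ \oo --> complex.Re l /\
  (fun n => complex.Im (u n)) @ \oo --> complex.Im l.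
Proof.
move=> /ccvgP h; split; apply/cvgrPdist_lt => e /h [N hN]; exists N => // n /hN;
  apply: le_lt_trans; rewrite cabsB.
  by rewrite -ReN -ReD cabs_Re.
by rewrite -ImN -ImD cabs_Im.
Qed.

Lemma ReIm_ccvg u (a b : R) : (fun n => complex.Re (u n)) @ \oo --> a ->
  (fun n => complex.Im (u n)) @ \oo --> b -> ccvg u (a +i* b).
Proof.
move=> ha hb; apply: (@ccvg_squeeze _ _ (fun n => `|complex.Re (u n) - a| + `|complex.Im (u n) - b|) 0%N) => [n _|].
  by apply: le_trans (cabs_le_ReIm _) _; rewrite ReD ImD ReN ImN.
rewrite -[X in _ --> X](addr0 0); apply: cvgD.
  by rewrite -(@normr0 _ R); apply: cvg_norm; rewrite -[X in _ --> X](subrr a);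
     apply: cvgB => //; exact: cvg_cst.
by rewrite -(@normr0 _ R); apply: cvg_norm; rewrite -[X in _ --> X](subrr b);
     apply: cvgB => //; exact: cvg_cst.
Qed.

(** The limit is taken on real and imaginary parts exactly as in the definition of [Delta], so that
    [climP] applies to it directly. *)
Definition clim u : C :=
  (limn (fun n => complex.Re (u n))) +i* (limn (fun n => complex.Im (u n))).

Lemma climP u l : ccvg u l -> clim u = l.
Proof.
move=> /ccvg_ReIm [/cvg_lim hr /cvg_lim hi].
by rewrite /clim hr ?hi //; case: l {hr hi}.
Qed.

Lemma cvg_real_seq (b : nat -> R) (l : R) :
  (forall e, 0 < e -> exists N, forall n, (N <= n)%N -> `|b n - l| < e) ->
  b @ \oo --> l.
Proof.
move=> h; apply/cvgrPdist_lt => e /h [N hN].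
by exists N => // n /hN; rewrite distrC.
Qed.

(** Summability of a majorant, kept as a bound on partial sums because this is what the estimates
    produce. *)
Definition bser (b : nat -> R) :=
  (forall i, 0 <= b i) /\ exists B, forall n, \sum_(i < n) b i <= B.

Lemma bser_tail b : bser b -> forall e : R, 0 < e -> exists K, forall n,
  (K <= n)%N -> \sum_(K <= i < n) b i < e.
Proof.
move=> [b0 [B hB]] e e0.
have mono : {homo (fun n => \sum_(i < n) b i) : n m / (n <= m)%N >-> n <= m}.
  move=> n m nm; rewrite -!(big_mkord predT) (big_cat_nat _ nm) //= lerDl.
  exact: sumr_ge0.
have cv := nondecreasing_is_cvgn mono.
have {}cv : cvgn (fun n => \sum_(i < n) b i).
  by apply: cv; exists B => _ [n _ <-].
set l := limn (fun n => \sum_(i < n) b i) in cv.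
have ub n : \sum_(i < n) b i <= l by apply: nondecreasing_cvgn_le.
move/cvgrPdist_lt: (cv : _ --> l) => /(_ e e0) [K _ hK]; exists K => n Kn.
have := hK K (leqnn K); rewrite /= ger0_norm ?subr_ge0 ?ub // => lt.
apply: le_lt_trans lt; rewrite lerBrDl.
by apply: le_trans (ub n); rewrite -!(big_mkord predT) [leRHS](big_cat_nat _ Kn).
Qed.

Lemma bser_le (a b : nat -> R) : (forall i, 0 <= a i <= b i) -> bser b -> bser a.
Proof.
move=> h [_ [B hB]]; split=> [i|]; first by case/andP: (h i).
by exists B => n; apply: le_trans (hB n); apply: ler_sum => i _; case/andP: (h i).
Qed.

Lemma bserZ (c : R) b : 0 <= c -> bser b -> bser (fun i => c * b i).
Proof.
move=> c0 [b0 [B hB]]; split=> [i|]; first exact: mulr_ge0.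
by exists (c * B) => n; rewrite -mulr_sumr ler_wpM2l.
Qed.

Lemma bser_cvg0 b : bser b -> b @ \oo --> (0 : R).
Proof.
move=> hb; apply: cvg_real_seq => e e0; have [K hK] := bser_tail hb e0.
exists K => n Kn; rewrite subr0 ger0_norm; last exact: hb.1.
have := hK n.+1 (leqW Kn); apply: le_lt_trans.
by rewrite big_nat_recr //= lerDr sumr_ge0 // => i _; exact: hb.1.
Qed.

Definition csum u (l : C) := ccvg (fun n => \sum_(i < n) u i) l.

Lemma csum_unique u k l : csum u k -> csum u l -> k = l.
Proof. exact: ccvg_unique. Qed.

Lemma bser_real_cvg (a : nat -> R) :
  bser (fun i => `|a i|) -> cvgn (fun n => \sum_(i < n) a i).
Proof.
move=> [_ [B hB]]; have <- : series a = (fun n => \sum_(i < n) a i).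
  by apply/funext => n; rewrite seriesEord.
apply: normed_cvg.
rewrite (_ : [normed series a] = fun n => \sum_(i < n) `|a i|); last first.
  by apply/funext => n; exact: big_mkord.
apply: nondecreasing_is_cvgn; last by exists B => _ [n _ <-].
move=> n m nm; rewrite -!(big_mkord predT (fun i => `|a i|)) (big_cat_nat _ nm) //= lerDl.
by apply: sumr_ge0 => i _; exact: normr_ge0.
Qed.

Lemma csum_ex u : bser (fun i => cabs (u i)) -> exists l, csum u l.
Proof.
move=> hb.
have key (f : C -> R) : (forall z, `|f z| <= cabs z) ->
    cvgn (fun n => \sum_(i < n) f (u i)).
  move=> fle; apply: (@bser_real_cvg (fun i => f (u i))); apply: (bser_le _ hb) => i; by rewrite normr_ge0 fle.
have fs (f : C -> R) (f0 : f 0 = 0) (fD : forall z w, f (z + w) = f z + f w) n :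
    f (\sum_(i < n) u i) = \sum_(i < n) f (u i) by exact: (big_morph f fD f0).
exists ((limn (fun n => \sum_(i < n) complex.Re (u i))) +i*
        (limn (fun n => \sum_(i < n) complex.Im (u i)))).
apply: ReIm_ccvg.
  under eq_fun do rewrite (fs (@complex.Re R) erefl ReD).
  by apply: key; exact: cabs_Re.
under eq_fun do rewrite (fs (@complex.Im R) erefl ImD).
by apply: key; exact: cabs_Im.
Qed.

(** A total function; its value is meaningful only once convergence is known, through [csumvP] or
    [csumvE]. *)
Definition csumv u : C := clim (fun n => \sum_(i < n) u i).

Lemma csumvE u l : csum u l -> csumv u = l. Proof. exact: climP. Qed.

Lemma csumvP u : bser (fun i => cabs (u i)) -> csum u (csumv u).
Proof. by move=> /csum_ex [l hl]; rewrite (csumvE hl). Qed.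

Lemma csumD u v k l : csum u k -> csum v l -> csum (fun i => u i + v i) (k + l).
Proof. by move=> hu hv; rewrite /csum; under eq_fun do rewrite big_split /=; exact: ccvgD. Qed.

Lemma csumZ (a : C) u l : csum u l -> csum (fun i => a * u i) (a * l).
Proof. by move=> hu; rewrite /csum; under eq_fun do rewrite -mulr_sumr; exact: ccvgZ. Qed.

Lemma csumN u l : csum u l -> csum (fun i => - u i) (- l).
Proof. by move=> hu; rewrite /csum; under eq_fun do rewrite sumrN; exact: ccvgN. Qed.

Lemma csumB u v k l : csum u k -> csum v l -> csum (fun i => u i - v i) (k - l).
Proof. by move=> hu hv; apply: csumD => //; apply: csumN. Qed.

Lemma csum_eq u v l : u =1 v -> csum u l -> csum v l.
Proof. by move=> h; rewrite (funext h). Qed.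

Lemma csum_cabs_le u l (b : nat -> R) B : csum u l ->
  (forall i, cabs (u i) <= b i) -> (forall n, \sum_(i < n) b i <= B) -> cabs l <= B.
Proof.
move=> h hb hB; apply: (ccvg_abs_le (N0 := 0%N) h) => n _.
by apply: le_trans (hB n); apply: le_trans (cabs_sum _ _ _) _; apply: ler_sum.
Qed.

Lemma bser_cabs_le (b : nat -> R) u : bser b -> (forall i, cabs (u i) <= b i) ->
  bser (fun i => cabs (u i)).
Proof. by move=> hb h; apply: (bser_le _ hb) => i; rewrite cabs_ge0 h. Qed.

(* Tannery's theorem, i.e. dominated convergence for series; the number of terms
   [m n] may depend on [n]. *)
Lemma tannery (b : nat -> R) (w : nat -> nat -> C) v (m : nat -> nat) (N0 : nat) :
  bser b -> (forall n k, (N0 <= n)%N -> (k < m n)%N -> cabs (w n k) <= b k) ->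
  (forall k, ccvg (w^~ k) (v k)) ->
  (forall K, exists N, forall n, (N <= n)%N -> (K <= m n)%N) ->
  (forall k, cabs (v k) <= b k) /\ ccvg (fun n => \sum_(k < m n) w n k) (csumv v).
Proof.
move=> hb dom cv hm.
have vb k : cabs (v k) <= b k.
  have [N hN] := hm k.+1; apply: (ccvg_abs_le (N0 := maxn N N0) (cv k)) => n.
  by rewrite geq_max => /andP[/hN h1 h2]; exact: dom.
split=> //; apply/ccvgP => e e0.
have e3 : 0 < e / 4 by rewrite divr_gt0.
have [K hK] := bser_tail hb e3.
have [N1 hN1] := ccvg_lt (csumvP (bser_cabs_le hb vb)) e3.
have : ccvg (fun n => \sum_(k < K) w n k) (\sum_(k < K) v k).
  elim: K {hK} => [|K IH].
    by under eq_fun do rewrite big_ord0; rewrite big_ord0; exact: ccvg_cst.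
  by under eq_fun do rewrite big_ord_recr; rewrite big_ord_recr; exact: ccvgD.
move=> /ccvg_lt /(_ e3) [N2 hN2]; have [N3 hN3] := hm K.
exists (maxn N0 (maxn N2 N3)) => n; rewrite !geq_max => /and3P[n0 n2 n3].
have Kmn := hN3 n n3.
have tail (f : nat -> C) M : (K <= M)%N -> (forall k, (k < M)%N -> cabs (f k) <= b k) ->
    cabs (\sum_(k < M) f k - \sum_(k < K) f k) < e / 4.
  move=> KM hf; rewrite -!(big_mkord predT) (big_cat_nat _ KM) //= addrAC subrr add0r.
  apply: le_lt_trans (hK M KM); apply: le_trans (cabs_sum _ _ _) _.
  by rewrite !big_nat; apply: ler_sum => i /andP[_ /hf].
have a1 := tail (w n) (m n) Kmn (fun k => @dom n k n0).
have a2 := hN2 n n2.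
have a3 := tail v (maxn K N1) (leq_maxl _ _) (fun k _ => vb k).
have a4 := hN1 (maxn K N1) (leq_maxr _ _).
move: a1 a2 a3 a4.
set x1 := \sum_(k < m n) _; set x2 := \sum_(k < K) _; set x3 := \sum_(k < K) _.
set x4 := \sum_(k < maxn K N1) _; set x5 := csumv v => a1 a2 a3 a4.
have -> : x1 - x5 = (x1 - x2) + ((x2 - x3) + ((x4 - x5) - (x4 - x3))) by ring.
have := cabsD (x1 - x2) ((x2 - x3) + ((x4 - x5) - (x4 - x3))).
have := cabsD (x2 - x3) ((x4 - x5) - (x4 - x3)).
have := cabsD (x4 - x5) (- (x4 - x3)); rewrite cabsN; lra.
Qed.

(** Each infinite row is cut at an index [m n >= n] where the error is below [1 / (n + 1)]; this
    reduces the claim to finite rows. *)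
Lemma tannery_series (b : nat -> R) (w : nat -> nat -> C) v (S : nat -> C) :
  bser b -> (forall n k, cabs (w n k) <= b k) ->
  (forall k, ccvg (w^~ k) (v k)) -> (forall n, csum (w n) (S n)) -> ccvg S (csumv v).
Proof.
move=> hb dom cv hS; have b0 := hb.1.
have hc n : exists M, (n <= M)%N /\ cabs (\sum_(k < M) w n k - S n) < n.+1%:R^-1.
  have n0 : 0 < n.+1%:R^-1 :> R by rewrite invr_gt0.
  have [M hM] := ccvg_lt (hS n) n0.
  by exists (maxn n M); rewrite leq_maxl hM ?leq_maxr.
have /choice [m hm] := hc.
have [|_ h] := @tannery b w v m 0%N hb (fun n k _ _ => dom n k) cv.
  by move=> K; exists K => n Kn; apply: leq_trans Kn (hm n).1.
have -> : S = (fun n => \sum_(k < m n) w n k - (\sum_(k < m n) w n k - S n)).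
  by apply/funext => n; rewrite opprB addrCA subrr addr0.
rewrite -[csumv v]subr0; apply: ccvgB => //.
apply: (@ccvg_squeeze _ _ (fun n => n.+1%:R^-1) 0%N); last exact: cvg_harmonic.
by move=> n _; rewrite subr0 ltW // (hm n).2.
Qed.

(** The partial sum of the column sums is a series over rows of truncated rows, to which dominated
    convergence applies. A product majorant makes both orders of summation absolutely controlled. *)
Lemma csum_swap (a b : nat -> R) (w : nat -> nat -> C) (r s : nat -> C) l :
  bser a -> bser b -> (forall m n, cabs (w m n) <= a m * b n) ->
  (forall m, csum (w m) (r m)) -> (forall n, csum (w^~ n) (s n)) ->
  csum r l -> csum s l.
Proof.
move=> ha hb dom hr hs hl; have [Bb hB] := hb.2.
have -> : l = csumv r by rewrite (csumvE hl).
apply: (@tannery_series (fun m => Bb * a m) (fun N m => \sum_(n < N) w m n)).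
- apply: bserZ => //; apply: le_trans (hB 0%N); by rewrite big_ord0.
- move=> N m; apply: le_trans (cabs_sum _ _ _) _.
  apply: (@le_trans _ _ (\sum_(n < N) a m * b n)); first exact: ler_sum.
  by rewrite -mulr_sumr mulrC ler_wpM2r // ha.1.
- by move=> m; exact: hr.
- move=> N; elim: N => [|N IH].
    rewrite big_ord0; rewrite /csum; under eq_fun do under eq_bigr do rewrite big_ord0.
    under eq_fun do rewrite big1_eq; exact: ccvg_cst.
  rewrite big_ord_recr /=; apply: csum_eq (csumD IH (hs N)) => m.
  by rewrite big_ord_recr.
Qed.
End ComplexModulus.

(** * The function [q = exp(2 pi i z)] and its first-order expansion *)

Section ComplexExponential.
Variable R : realType.
Notation C := (complex R).
Implicit Types (z w : C).

Lemma abs_sin_le (x : R) : `|sin x| <= `|x|.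
Proof.
wlog x0 : x / 0 <= x.
  move=> h; case: (leP 0 x) => [/h//|x0]; have := h (- x).
  by rewrite sinN !normrN; apply; lra.
have [c _ ] := MVT_segment x0 (fun t _ => is_derive_sin t)
   (continuous_subspaceT (@continuous_sin R)).
rewrite sin0 !subr0 => ->; rewrite normrM ler_piMl ?normr_ge0 //.
by rewrite ler_norml cos_geN1 cos_le1.
Qed.

Lemma abs_cosB1_le (x : R) : `|cos x - 1| <= x ^+ 2.
Proof.
wlog x0 : x / 0 <= x.
  move=> h; case: (leP 0 x) => [/h//|x0]; have := h (- x).
  by rewrite cosN sqrrN; apply; lra.
have [c] := MVT_segment x0 (fun t _ => is_derive_cos t)
   (continuous_subspaceT (@continuous_cos R)).
rewrite in_itv /= => /andP[c0 cx]; rewrite cos0 subr0 => ->.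
rewrite normrM expr2 (ger0_norm x0) ler_wpM2r // normrN.
by apply: le_trans (abs_sin_le c) _; rewrite ger0_norm.
Qed.

Lemma abs_cosB1_le1 (x : R) : `|cos x - 1| <= `|x|.
Proof.
wlog x0 : x / 0 <= x.
  move=> h; case: (leP 0 x) => [/h//|x0]; have := h (- x).
  by rewrite cosN normrN; apply; lra.
have [c _] := MVT_segment x0 (fun t _ => is_derive_cos t)
   (continuous_subspaceT (@continuous_cos R)).
rewrite cos0 subr0 => ->.
by rewrite normrM normrN ler_piMl // sin_max.
Qed.

Lemma abs_sinB_le (x : R) : `|sin x - x| <= x ^+ 2.
Proof.
wlog x0 : x / 0 <= x.
  move=> h; case: (leP 0 x) => [/h//|x0]; have := h (- x).
  by rewrite sinN -opprD !normrN sqrrN; apply; lra.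
have [c] := MVT_segment x0 (fun t _ => is_derive_sin t)
   (continuous_subspaceT (@continuous_sin R)).
rewrite in_itv /= => /andP[c0 cx]; rewrite sin0 !subr0 => ->.
have -> : cos c * x - x = (cos c - 1) * x by ring.
rewrite normrM expr2 (ger0_norm x0) ler_wpM2r //.
by apply: le_trans (abs_cosB1_le1 c) _; rewrite ger0_norm.
Qed.

(** This is [1 - x <= expR (- x)] multiplied by [expR x]. *)
Lemma expRB1_le (x : R) : expR x - 1 <= x * expR x.
Proof.
have h := expR_ge1Dx (- x); have := ler_wpM2r (ltW (expR_gt0 x)) h.
by rewrite expRN mulVf ?gt_eqF ?expR_gt0 // mulrDl mul1r; lra.
Qed.

Lemma abs_expRB1_le (x : R) : `|expR x - 1| <= `|x| * expR `|x|.
Proof.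
have h2 := expRB1_le x; have h1 := expR_ge1Dx x; have e0 := expR_gt0 x.
case: (lerP 0 x) => x0.
  by rewrite (ger0_norm x0) ger0_norm; lra.
have e1 : expR x < 1 by rewrite expR_lt1.
have : 1 <= expR (- x) by rewrite -[1]expR0 ler_expR; lra.
by rewrite (ltr0_norm x0) ltr0_norm; [nra | lra].
Qed.

Lemma abs_expRB1Bx_le (x : R) : `|expR x - 1 - x| <= x ^+ 2 * expR `|x|.
Proof.
have h1 := expR_ge1Dx x; have h2 := expRB1_le x; have e0 := expR_gt0 x.
rewrite ger0_norm; last by lra.
apply: (@le_trans _ _ (x * (expR x - 1))); first by lra.
apply: le_trans (ler_norm _) _; rewrite normrM -[x ^+ 2]ger0_norm ?sqr_ge0 // normrX.
by rewrite expr2 -mulrA ler_wpM2l // abs_expRB1_le.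
Qed.

(** The number [2 pi i]. *)
Definition ctau : C := 0 +i* (2 * pi).

(** The exponential of [2 pi i z], with the same body as [qexp] in the statement. *)
Definition qe z : C :=
  (expR (- (2 * pi * complex.Im z)) * cos (2 * pi * complex.Re z)) +i*
  (expR (- (2 * pi * complex.Im z)) * sin (2 * pi * complex.Re z)).

Lemma qeD z w : qe (z + w) = qe z * qe w.
Proof.
apply: complexP; rewrite /= ReD ImD !mulrDr opprD expRD ?cosD ?sinD; ring.
Qed.

Lemma cabs_qe z : cabs (qe z) = expR (- (2 * pi * complex.Im z)).
Proof.
by rewrite /cabs /= !exprMn -mulrDr cos2Dsin2 mulr1 sqrtr_sqr ger0_norm // expR_ge0.
Qed.

Lemma qe_neq0 z : qe z != 0.
Proof. by rewrite -cabs_gt0 cabs_qe expR_gt0. Qed.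

Lemma qe0 : qe 0 = 1.
Proof. by rewrite /qe /= !mulr0 oppr0 expR0 cos0 sin0 mulr1 mulr0. Qed.

Lemma qeN z : qe (- z) = (qe z)^-1.
Proof. by apply: (mulfI (qe_neq0 z)); rewrite -qeD subrr qe0 mulfV ?qe_neq0. Qed.

Lemma qeMn n z : qe (n%:R * z) = qe z ^+ n.
Proof.
elim: n => [|n IH]; first by rewrite mul0r qe0 expr0.
by rewrite -addn1 natrD mulrDl mul1r qeD IH exprD expr1.
Qed.

Lemma qe_half : qe (2^-1) = -1.
Proof.
have -> : (2^-1 : C) = (2^-1 : R)%:C by rewrite fmorphV rmorph_nat.
apply: complexP => /=; rewrite mulr0 oppr0 expR0 mul1r mulrC mulrA mulVf ?mul1r ?cospi ?sinpi ?oppr0 //.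
Qed.

Lemma qe1 : qe 1 = 1.
Proof.
have e : (1 : C) = 2^-1 + 2^-1 by field.
by rewrite [X in qe X]e qeD qe_half mulrNN mulr1.
Qed.

Lemma qeD1 z : qe (z + 1) = qe z.
Proof. by rewrite qeD qe1 mulr1. Qed.

Lemma qe_nat n : qe n%:R = 1.
Proof. by rewrite -[n%:R]mulr1 qeMn qe1 expr1n. Qed.

Lemma qeDn z n : qe (z + n%:R) = qe z.
Proof. by rewrite qeD qe_nat mulr1. Qed.

Lemma qeBn z n : qe (z - n%:R) = qe z.
Proof. by rewrite -(qeDn (z - n%:R) n) subrK. Qed.

Lemma cabs_ctau : cabs ctau = 2 * pi.
Proof.
by rewrite /cabs /= expr0n add0r sqrtr_sqr ger0_norm // mulr_ge0 // ltW ?pi_gt0.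
Qed.

(** The real and imaginary parts of the remainder are combinations of the real remainders of [expR],
    [cos] and [sin], each quadratic in [h]. The explicit constant is what later allows termwise
    differentiation of series. *)
Lemma qe_taylor1 h : cabs (qe h - 1 - ctau * h) <=
  4 * (2 * pi * cabs h) ^+ 2 * expR (2 * pi * cabs h).
Proof.
case: h => x y; set r := cabs (x +i* y).
pose a := - (2 * pi * y); pose b := 2 * pi * x; set s := 2 * pi * r.
have p0 : 0 <= 2 * pi :> R by rewrite mulr_ge0 // ltW ?pi_gt0.
have as_ : `|a| <= s.
  by rewrite normrN normrM (ger0_norm p0); apply: ler_wpM2l => //; exact: (cabs_Im (x +i* y)).
have bs : `|b| <= s.
  by rewrite normrM (ger0_norm p0); apply: ler_wpM2l => //; exact: (cabs_Re (x +i* y)).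
have s2 : s ^+ 2 = a ^+ 2 + b ^+ 2.
  by rewrite /s exprMn cabs2 /a /b sqrrN !exprMn /= -mulrDr addrC.
apply: le_trans (cabs_le_ReIm _) _.
rewrite !ReD !ImD !ReN !ImN ReM ImM /=.
have -> : expR (- (2 * pi * y)) * cos (2 * pi * x) - 1 - (0 * x - 2 * pi * y) =
   (expR a - 1 - a) + expR a * (cos b - 1) by rewrite /a /b; ring.
have -> : expR (- (2 * pi * y)) * sin (2 * pi * x) - 0 - (0 * y + 2 * pi * x) =
   (expR a - 1) * sin b + (sin b - b) by rewrite /a /b; ring.
have E1 : 1 <= expR `|a| by rewrite -[1]expR0 ler_expR.
have Es : expR `|a| <= expR s by rewrite ler_expR.
have ea : expR a <= expR `|a| by rewrite ler_expR ler_norm.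
have t1 := abs_expRB1Bx_le a.
have t2 : `|expR a * (cos b - 1)| <= expR `|a| * b ^+ 2.
  by rewrite normrM (ger0_norm (expR_ge0 a)) ler_pM ?expR_ge0 // abs_cosB1_le.
have t3 : `|(expR a - 1) * sin b| <= `|a| * `|b| * expR `|a|.
  rewrite normrM mulrAC; apply: ler_pM => //; first exact: abs_expRB1_le.
  exact: abs_sin_le.
have t4 := abs_sinB_le b.
have ab : `|a| * `|b| <= s ^+ 2 by rewrite expr2; exact: ler_pM.
have a2 := sqr_ge0 a; have b2 := sqr_ge0 b.
have := ler_normD (expR a - 1 - a) (expR a * (cos b - 1)).
have := ler_normD ((expR a - 1) * sin b) (sin b - b).
have : 4 * s ^+ 2 * expR `|a| <= 4 * s ^+ 2 * expR s.
  by rewrite ler_wpM2l // mulr_ge0 // sqr_ge0.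
have : `|a| * `|b| * expR `|a| <= s ^+ 2 * expR `|a|.
  by rewrite ler_wpM2r // expR_ge0.
have : b ^+ 2 <= b ^+ 2 * expR `|a| by rewrite ler_peMr.
have : b ^+ 2 * expR `|a| <= s ^+ 2 * expR `|a|.
  by rewrite ler_wpM2r ?expR_ge0 // s2; lra.
have : a ^+ 2 * expR `|a| <= s ^+ 2 * expR `|a|.
  by rewrite ler_wpM2r ?expR_ge0 // s2; lra.
lra.
Qed.

End ComplexExponential.

(** * Complex derivatives at a point, and functions with zero derivative *)

Section ComplexDerivative.
Variable R : realType.
Notation C := (complex R).
Implicit Types (z w : C) (f g : C -> C).

(** A pointwise first-order expansion with a named derivative. Sum, product and chain rules together
    with [cderiv0_cst] are all the holomorphy that is used. *)
Definition cderiv f z (l : C) := forall e : R, 0 < e -> exists2 d : R, 0 < d &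
  forall h, cabs h < d -> cabs (f (z + h) - f z - l * h) <= e * cabs h.

Lemma cderiv_quad f z l (d K : R) : 0 < d -> (forall h, cabs h < d ->
  cabs (f (z + h) - f z - l * h) <= K * cabs h ^+ 2) -> cderiv f z l.
Proof.
move=> d0 hK e e0; exists (Num.min d (e / (`|K| + 1))).
  by rewrite lt_min d0 divr_gt0 // ltr_wpDl.
move=> h; rewrite lt_min => /andP[/hK hd he]; apply: le_trans hd _.
rewrite expr2 mulrA ler_wpM2r ?cabs_ge0 //.
move: he; rewrite ltr_pdivlMr ?ltr_wpDl // => he.
have := ler_norm K; have := cabs_ge0 h; nra.
Qed.

Lemma cderiv_cst (c : C) z : cderiv (fun=> c) z 0.
Proof.
move=> e e0; exists 1 => // h _; rewrite subrr mul0r subrr cabs0.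
by rewrite mulr_ge0 ?cabs_ge0 // ltW.
Qed.

Lemma cderiv_id z : cderiv id z 1.
Proof.
move=> e e0; exists 1 => // h _; rewrite /= mul1r [z + h]addrC addrK subrr cabs0.
by rewrite mulr_ge0 ?cabs_ge0 // ltW.
Qed.

Lemma cderivD f g z a b : cderiv f z a -> cderiv g z b ->
  cderiv (fun x => f x + g x) z (a + b).
Proof.
move=> hf hg e e0; have e2 : 0 < e / 2 by rewrite divr_gt0.
have [d1 d10 h1] := hf _ e2; have [d2 d20 h2] := hg _ e2.
exists (Num.min d1 d2) => [|h]; first by rewrite lt_min d10.
rewrite lt_min => /andP[/h1 k1 /h2 k2].
have -> : f (z + h) + g (z + h) - (f z + g z) - (a + b) * h =
  (f (z + h) - f z - a * h) + (g (z + h) - g z - b * h) by ring.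
apply: le_trans (cabsD _ _) _; lra.
Qed.

Lemma cderiv_bound f z l : cderiv f z l -> exists2 d : R, 0 < d &
  forall h, cabs h < d -> cabs (f (z + h) - f z) <= (cabs l + 1) * cabs h.
Proof.
move=> /(_ 1 ltr01) [d d0 hd]; exists d => // h /hd k.
have := cabsD (f (z + h) - f z - l * h) (l * h).
by rewrite subrK cabsM mulrDl mul1r; lra.
Qed.

Lemma cderivM f g z a b : cderiv f z a -> cderiv g z b ->
  cderiv (fun x => f x * g x) z (a * g z + f z * b).
Proof.
move=> hf hg e e0.
have [d3 d30 hb] := cderiv_bound hg; have [d4 d40 hc] := cderiv_bound hf.
set A := cabs a + 1; set B := cabs b + 1.
set D := cabs (f z) + cabs (g z) + 1.
have A0 : 0 < A by rewrite ltr_wpDl ?cabs_ge0.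
have B0 : 0 < B by rewrite ltr_wpDl ?cabs_ge0.
have D0 : 0 < D by rewrite ltr_wpDl ?addr_ge0 ?cabs_ge0.
have e2 : 0 < e / 2 / D by rewrite !divr_gt0.
have [d1 d10 h1] := hf _ e2; have [d2 d20 h2] := hg _ e2.
have d5 : 0 < e / 2 / (A * B) by rewrite !divr_gt0 // mulr_gt0.
exists (Num.min (Num.min (Num.min d1 d2) (Num.min d3 d4)) (e / 2 / (A * B))) => [|h].
  by rewrite !lt_min d10 d20 d30 d40.
rewrite !lt_min => /andP[/andP[/andP[/h1 k1 /h2 k2] /andP[/hb k3 /hc k4]] k5].
have -> : f (z + h) * g (z + h) - f z * g z - (a * g z + f z * b) * h =
  (f (z + h) - f z - a * h) * g z + (f z * (g (z + h) - g z - b * h)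
  + (f (z + h) - f z) * (g (z + h) - g z)) by ring.
apply: le_trans (cabsD _ _) _.
have := cabsD (f z * (g (z + h) - g z - b * h)) ((f (z + h) - f z) * (g (z + h) - g z)).
rewrite !cabsM => k6.
have k7 : cabs (f (z + h) - f z - a * h) * cabs (g z) <= e / 2 / D * cabs h * cabs (g z).
  by rewrite ler_wpM2r ?cabs_ge0.
have k8 : cabs (f z) * cabs (g (z + h) - g z - b * h) <= cabs (f z) * (e / 2 / D * cabs h).
  by rewrite ler_wpM2l ?cabs_ge0.
have k9 : cabs (f (z + h) - f z) * cabs (g (z + h) - g z) <= (A * cabs h) * (B * cabs h).
  by rewrite ler_pM ?cabs_ge0.
have k10 : e / 2 / D * cabs h * (cabs (g z) + cabs (f z)) <= e / 2 * cabs h.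
  rewrite mulrAC ler_wpM2r ?cabs_ge0 // -[leRHS](divfK (lt0r_neq0 D0)).
  by rewrite ler_wpM2l ?(ltW e2) // /D; lra.
have k11 : (A * cabs h) * (B * cabs h) <= e / 2 * cabs h.
  move: k5; rewrite ltr_pdivlMr ?mulr_gt0 // => k5.
  by have := cabs_ge0 h; nra.
lra.
Qed.

Lemma cderiv_comp f g z a b : cderiv g z b -> cderiv f (g z) a ->
  cderiv (fun x => f (g x)) z (a * b).
Proof.
move=> hg hf e e0.
have [d3 d30 hb] := cderiv_bound hg.
set A := cabs a + 1; set B := cabs b + 1.
have A0 : 0 < A by rewrite ltr_wpDl ?cabs_ge0.
have B0 : 0 < B by rewrite ltr_wpDl ?cabs_ge0.
have e1 : 0 < e / 2 / A by rewrite !divr_gt0.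
have e2 : 0 < e / 2 / B by rewrite !divr_gt0.
have [d1 d10 h1] := hf _ e2; have [d2 d20 h2] := hg _ e1.
exists (Num.min (Num.min d2 d3) (d1 / B)) => [|h].
  by rewrite !lt_min d20 d30 divr_gt0.
rewrite !lt_min ltr_pdivlMr // => /andP[/andP[/h2 k2 /hb k3] k4].
set k := g (z + h) - g z.
have kd : cabs k < d1 by apply: le_lt_trans k3 _; rewrite mulrC.
have k5 := h1 _ kd; rewrite addrCA subrr addr0 in k5.
have -> : f (g (z + h)) - f (g z) - a * b * h =
  (f (g (z + h)) - f (g z) - a * k) + a * (k - b * h) by rewrite /k; ring.
apply: le_trans (cabsD _ _) _; rewrite cabsM.
have k6 : e / 2 / B * cabs k <= e / 2 * cabs h.
  by rewrite -mulrA ler_wpM2l ?ler_pdivrMl // ltW // divr_gt0.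
have k7 : cabs a * cabs (k - b * h) <= e / 2 * cabs h.
  apply: (@le_trans _ _ (A * (e / 2 / A * cabs h))).
    by rewrite ler_pM ?cabs_ge0 // lerDl.
  by rewrite (_ : A * (e / 2 / A * _) = e / 2 * cabs h); last by field; rewrite gt_eqF.
lra.
Qed.

Lemma cderivZ (c : C) f z a : cderiv f z a -> cderiv (fun x => c * f x) z (c * a).
Proof.
by move=> h; have := cderivM (cderiv_cst c z) h; rewrite mul0r add0r.
Qed.

Lemma cderivN f z a : cderiv f z a -> cderiv (fun x => - f x) z (- a).
Proof.
move=> /(cderivZ (-1)); rewrite mulN1r; under eq_fun do rewrite mulN1r.
exact.
Qed.

Lemma cderivB f g z a b : cderiv f z a -> cderiv g z b ->
  cderiv (fun x => f x - g x) z (a - b).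
Proof. by move=> hf hg; apply: cderivD => //; apply: cderivN. Qed.

Lemma cderiv_inv z : z != 0 -> cderiv (fun x => x^-1) z (- z ^- 2).
Proof.
move=> z0; have az : 0 < cabs z by rewrite cabs_gt0.
apply: (@cderiv_quad _ _ _ (cabs z / 2) (2 / cabs z ^+ 3)); first by rewrite divr_gt0.
move=> h hz.
have k : cabs z / 2 <= cabs (z + h) by have := cabsD_ge z h; lra.
have zh : z + h != 0 by rewrite -cabs_gt0; apply: lt_le_trans k; rewrite divr_gt0.
have -> : (z + h)^-1 - z^-1 - - z ^- 2 * h = h ^+ 2 / (z ^+ 2 * (z + h)).
  by field; rewrite zh z0.
rewrite cabsM cabsV cabsM !cabsX mulrC ler_wpM2r ?sqr_ge0 //.
have -> : 2 / cabs z ^+ 3 = (cabs z ^+ 2 * (cabs z / 2))^-1 by field; rewrite gt_eqF.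
rewrite lef_pV2 ?posrE ?mulr_gt0 ?exprn_gt0 ?divr_gt0 ?cabs_gt0 //.
by rewrite ler_wpM2l // sqr_ge0.
Qed.

Lemma cderivX n z : cderiv (fun x => x ^+ n) z (n%:R * z ^+ n.-1).
Proof.
elim: n => [|n IH].
  by rewrite mul0r; under eq_fun do rewrite expr0; exact: cderiv_cst.
under eq_fun do rewrite exprS.
have := cderivM (cderiv_id z) IH; congr cderiv.
rewrite mul1r /= -natr1 mulrDl mul1r addrC; congr (_ + _).
by case: n {IH} => [|n]; rewrite ?mul0r ?mulr0 // mulrCA -exprS.
Qed.

Lemma cderiv_eq f z k l : k = l -> cderiv f z k -> cderiv f z l.
Proof. by move=> ->. Qed.

Lemma cderiv_qe z : cderiv (@qe R) z (@ctau R * qe z).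
Proof.
have p0 : 0 < 2 * pi :> R by rewrite mulr_gt0 ?pi_gt0.
have := @qe_taylor1 R; move: p0; set s := 2 * pi; clearbody s => p0 taylor.
apply: (@cderiv_quad _ _ _ 1 (cabs (qe z) * (4 * s ^+ 2 * expR s))) => // h h1.
rewrite qeD.
have -> : qe z * qe h - qe z - ctau R * qe z * h = qe z * (qe h - 1 - ctau R * h).
  by ring.
rewrite cabsM -!mulrA ler_wpM2l ?cabs_ge0 //.
apply: le_trans (taylor h) _.
have : expR (s * cabs h) <= expR s by rewrite ler_expR ger_pMr // ltW.
move/(ler_wpM2l (mulr_ge0 (mulr_ge0 (ler0n R 4) (sqr_ge0 s)) (sqr_ge0 (cabs h)))).
by rewrite exprMn; lra.
Qed.

(** The derivative of a path; it links [cderiv] with the real derivatives of the real and imaginary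
    parts. *)
Definition rderiv (g : R -> C) (t : R) (v : C) := forall e : R, 0 < e ->
  exists2 d : R, 0 < d & forall h : R, `|h| < d ->
  cabs (g (t + h) - g t - v * h%:C) <= e * `|h|.

Lemma cderiv_rderiv f (g : R -> C) t a v : rderiv g t v -> cderiv f (g t) a ->
  rderiv (fun s => f (g s)) t (a * v).
Proof.
move=> hg hf e e0.
set A := cabs a + 1; set B := cabs v + 1.
have A0 : 0 < A by rewrite ltr_wpDl ?cabs_ge0.
have B0 : 0 < B by rewrite ltr_wpDl ?cabs_ge0.
have e1 : 0 < e / 2 / A by rewrite !divr_gt0.
have e2 : 0 < e / 2 / B by rewrite !divr_gt0.
have [d3 d30 hb'] := hg 1 ltr01.
have hb h : `|h| < d3 -> cabs (g (t + h) - g t) <= B * `|h|.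
  move=> /hb' k; have := cabsD (g (t + h) - g t - v * h%:C) (v * h%:C).
  by rewrite subrK cabsM cabs_real /B mulrDl mul1r; lra.
have [d1 d10 h1] := hf _ e2; have [d2 d20 h2] := hg _ e1.
exists (Num.min (Num.min d2 d3) (d1 / B)) => [|h].
  by rewrite !lt_min d20 d30 divr_gt0.
rewrite !lt_min ltr_pdivlMr // => /andP[/andP[/h2 k2 /hb k3] k4].
set k := g (t + h) - g t.
have kd : cabs k < d1 by apply: le_lt_trans k3 _; rewrite mulrC.
have k5 := h1 _ kd; rewrite addrCA subrr addr0 in k5.
have -> : f (g (t + h)) - f (g t) - a * v * h%:C =
  (f (g (t + h)) - f (g t) - a * k) + a * (k - v * h%:C) by rewrite /k; ring.
apply: le_trans (cabsD _ _) _; rewrite cabsM.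
have k6 : e / 2 / B * cabs k <= e / 2 * `|h|.
  by rewrite -mulrA ler_wpM2l ?ler_pdivrMl // ltW // divr_gt0.
have k7 : cabs a * cabs (k - v * h%:C) <= e / 2 * `|h|.
  apply: (@le_trans _ _ (A * (e / 2 / A * `|h|))).
    by rewrite ler_pM ?cabs_ge0 // lerDl.
  by rewrite (_ : A * (e / 2 / A * _) = e / 2 * `|h|); last by field; rewrite gt_eqF.
lra.
Qed.

Lemma is_derive_eps (g : R -> R) (t v : R) :
  (forall e : R, 0 < e -> exists2 d : R, 0 < d & forall h : R, `|h| < d ->
    `|g (t + h) - g t - v * h| <= e * `|h|) -> is_derive t 1 g v.
Proof.
move=> hg.
have cv : h^-1 *: (g (h *: 1 + t) - g t) @[h --> 0^'] --> v.
  apply/cvgrPdist_le => e /hg [d d0 hd]; exists d => //= h.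
  rewrite /ball_ /= sub0r normrN => hh h0.
  have := hd h hh; rewrite [t + h]addrC => k.
  rewrite /GRing.scale /= mulr1.
  have -> : v - h^-1 * (g (h + t) - g t) = - (h^-1 * (g (h + t) - g t - v * h)).
    by field.
  by rewrite normrN normrM normfV ler_pdivrMl ?normr_gt0 // [_ * e]mulrC.
apply: DeriveDef; first by apply/cvg_ex; exists v.
exact: cvg_lim cv.
Qed.

Lemma rderiv_Re (g : R -> C) t v : rderiv g t v ->
  is_derive t 1 (fun s => complex.Re (g s)) (complex.Re v).
Proof.
move=> hg; apply: is_derive_eps => e /hg [d d0 hd]; exists d => // h /hd.
apply: le_trans; apply: le_trans (cabs_Re _).
by rewrite !ReD !ReN ReM /= mulr0 subr0.
Qed.

Lemma rderiv_Im (g : R -> C) t v : rderiv g t v ->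
  is_derive t 1 (fun s => complex.Im (g s)) (complex.Im v).
Proof.
move=> hg; apply: is_derive_eps => e /hg [d d0 hd]; exists d => // h /hd.
apply: le_trans; apply: le_trans (cabs_Im _).
by rewrite !ImD !ImN ImM /= mulr0 add0r.
Qed.

Lemma rderiv_line z w t : rderiv (fun s => z + s%:C * w) t w.
Proof.
move=> e e0; exists 1 => // h _.
rewrite rmorphD /= (_ : _ - _ - _ = 0); last by ring.
by rewrite cabs0 mulr_ge0 // ltW.
Qed.

Lemma is_derive0_eq (g : R -> R) :
  (forall t : R, 0 <= t <= 1 -> is_derive t 1 g 0) -> g 0 = g 1.
Proof.
move=> h.
have h1 (x : R) : x \in `]0, 1[ -> is_derive x 1 g ((fun=> 0) x).
  by rewrite in_itv /= => /andP[/ltW x0 /ltW x1]; apply: h; rewrite x0.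
have h2 : {within `[0, 1], continuous g}.
  apply: derivable_within_continuous => x; rewrite in_itv /= => /h hx.
  exact: ex_derive.
have [c _] := MVT_segment ler01 h1 h2.
by rewrite mul0r => /eqP; rewrite subr_eq0 => /eqP ->.
Qed.

(** The half-plane is convex: on the segment from [z] to [w] the real and imaginary parts have zero
    derivative, and the mean value theorem applies to each. *)
Lemma cderiv0_cst f : (forall z, 0 < complex.Im z -> cderiv f z 0) ->
  forall z w, 0 < complex.Im z -> 0 < complex.Im w -> f z = f w.
Proof.
move=> h z w z0 w0.
pose g (s : R) := f (z + s%:C * (w - z)).
have gd t : 0 <= t <= 1 -> rderiv g t 0.
  move=> /andP[t0 t1]; rewrite -(mul0r (w - z)); apply: cderiv_rderiv.
    exact: rderiv_line.
  by apply: h; rewrite ImD ImM /= mul0r addr0 ImD ImN; nra.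
have -> : f z = g 0 by rewrite /g mul0r addr0.
have -> : f w = g 1 by rewrite /g mul1r addrC subrK.
apply: complexP.
  by apply: (@is_derive0_eq (fun s => complex.Re (g s))) => t /gd /rderiv_Re.
by apply: (@is_derive0_eq (fun s => complex.Im (g s))) => t /gd /rderiv_Im.
Qed.

End ComplexDerivative.

(** * Partial fractions of the cotangent and of its derivative, by iterated duplication *)

Section PartialFractions.
Variable R : realType.
Notation C := (complex R).
Implicit Types (x y z w : C).
Local Notation tau := (@ctau R).

(** In terms of [v = expR (s / 2)] this compares [s v] with [2 (1 - v^2)], a weak form of
    [|s| <= 2 |sinh (s / 2)|]. *)
Lemma sqr_expR_le (s : R) : s ^+ 2 * expR s <= 4 * (1 - expR s) ^+ 2.
Proof.
set v := expR (s / 2); have v0 : 0 < v := expR_gt0 _.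
have -> : expR s = v ^+ 2 by rewrite /v expr2 -expRD; congr expR; field.
have h1 : 1 + s / 2 <= v := expR_ge1Dx _.
have h2 : v * (1 - s / 2) <= 1.
  have := expR_ge1Dx (- (s / 2)); rewrite expRN -/v => h.
  have := ler_wpM2l (ltW v0) h; rewrite divff ?gt_eqF //.
suff : (s * v) ^+ 2 <= (2 * (1 - v ^+ 2)) ^+ 2 by rewrite !exprMn; lra.
case: (leP 0 s) => s0.
  rewrite -(sqrrN (2 * _)); have sv : 0 <= s * v by rewrite mulr_ge0 // ltW.
  by rewrite ler_sqr ?nnegrE //; nra.
rewrite -(sqrrN (s * v)); have sv : 0 <= - (s * v) by nra.
by rewrite ler_sqr ?nnegrE //; nra.
Qed.

(** For [y <= 1/2] the quadratic remainder of the sine is at most half of [y]; beyond, [sin] is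
    increasing, and [sin (1/2) >= 1/4] suffices since [y <= pi / 2 < 2]. *)
Lemma sin_ge_lin (y : R) : 0 <= y <= pi / 2 -> y / 8 <= sin y.
Proof.
move=> /andP[y0 yp]; have /andP[p0 p2] := pihalf_02 R.
have small (t : R) : 0 <= t <= 2^-1 -> t / 2 <= sin t.
  move=> /andP[t0 t1]; have := abs_sinB_le t; rewrite ler_norml => /andP[h _].
  nra.
case: (leP y 2^-1) => yh; first by have := small y; rewrite y0 yh => /(_ isT); lra.
have h := small 2^-1; have : sin (2^-1 : R) < sin y.
  by rewrite ltr_sin ?in_itv //=; have := pi_ge2 R; lra.
by move: h; rewrite lexx invr_ge0 ler0n => /(_ isT); lra.
Qed.

(** In the strip [|Re x| <= 1/2] the only zero of [1 - qe x] is [x = 0], and it is simple. This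
    quantitative form provides all majorants of the partial fraction expansions. *)
Lemma sub1_qe_ge x : `|complex.Re x| <= 2^-1 ->
  cabs x ^+ 2 * cabs (qe x) <= 4 * cabs (1 - qe x) ^+ 2.
Proof.
case: x => a b /= ha; rewrite cabs_qe /=.
set s := - (2 * pi * b); have h1 := sqr_expR_le s.
have p2 := pi_ge2 R.
have hs : b ^+ 2 <= s ^+ 2.
  by rewrite /s sqrrN exprMn ler_peMl ?sqr_ge0 //; nra.
have h2 : a ^+ 2 <= 8 * (1 - cos (2 * pi * a)).
  have -> : 1 - cos (2 * pi * a) = 2 * sin (pi * a) ^+ 2.
    rewrite (_ : 2 * pi * a = pi * a + pi * a); last by ring.
    by rewrite cosD; have := cos2Dsin2 (pi * a); rewrite !expr2; lra.
  have -> : sin (pi * a) ^+ 2 = sin (pi * `|a|) ^+ 2.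
    case: (leP 0 a) => a0; first by rewrite ger0_norm.
    by rewrite ltr0_norm // mulrN sinN sqrrN.
  have a0 := normr_ge0 a; rewrite -(real_normK (num_real a)).
  have := @sin_ge_lin (pi * `|a|); rewrite mulr_ge0 ?pi_ge0 //=.
  move=> /(_ ltac:(nra)) h; have h3 : `|a| / 4 <= sin (pi * `|a|) by nra.
  have h4 : (`|a| / 4) ^+ 2 <= sin (pi * `|a|) ^+ 2.
    by rewrite ler_sqr ?nnegrE //; lra.
  by move: h4; rewrite expr_div_n; lra.
(* [|1 - r e^(i u)|^2 = (1 - r)^2 + 2 r (1 - cos u)] separates the imaginary direction, handled by
   [h1], from the real one, handled by [h2]. *)
have -> : cabs (1 - ((expR s * cos (2 * pi * a)) +i* (expR s * sin (2 * pi * a)))) ^+ 2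
   = (1 - expR s) ^+ 2 + 2 * expR s * (1 - cos (2 * pi * a)).
  rewrite cabs2 ReD ImD ReN ImN /= add0r sqrrN.
  have := cos2Dsin2 (2 * pi * a); set c := cos _; set d := sin _ => cd.
  have -> : (expR s * d) ^+ 2 = expR s ^+ 2 * (1 - c ^+ 2) by rewrite -cd; ring.
  by ring.
have e0 := expR_gt0 s; rewrite cabs2 /=; have := cos_le1 (2 * pi * a); nra.
Qed.

(** At [q = qe x], [ctau^2 * hq q] is [pi^2 / sin^2(pi x)] and [- (ctau / 2) * cq q] is
    [pi cot(pi x)]. *)
Definition hq (q : C) := q / (1 - q) ^+ 2.
Definition cq (q : C) := (1 + q) / (1 - q).

(** The duplication formula of the squared cosecant: [q] and [- q] are the two square roots of
    [q^2], that is the points [x / 2] and [(x + 1) / 2]. *)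
Lemma hq_double q : q ^+ 2 != 1 -> 4 * hq (q ^+ 2) = hq q + hq (- q).
Proof.
move=> h; have [a b] : 1 - q != 0 /\ 1 + q != 0.
  by split; apply: contra_neq h => /eqP; rewrite ?subr_eq0 ?addr_eq0 => /eqP;
    [move=> <-; rewrite expr1n | move=> e; rewrite -sqrrN -e expr1n].
rewrite /hq; have -> : 1 - q ^+ 2 = (1 - q) * (1 + q) by ring.
by field; rewrite opprK a b.
Qed.

Lemma cq_double q : q ^+ 2 != 1 -> 2 * cq (q ^+ 2) = cq q + cq (- q).
Proof.
move=> h; have [a b] : 1 - q != 0 /\ 1 + q != 0.
  by split; apply: contra_neq h => /eqP; rewrite ?subr_eq0 ?addr_eq0 => /eqP;
    [move=> <-; rewrite expr1n | move=> e; rewrite -sqrrN -e expr1n].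
rewrite /cq; have -> : 1 - q ^+ 2 = (1 - q) * (1 + q) by ring.
by field; rewrite opprK a b.
Qed.

Lemma qe_halve x : qe (x / 2) ^+ 2 = qe x.
Proof. by rewrite expr2 -qeD; congr qe; field. Qed.

Lemma qe_halve1 x : qe ((x + 1) / 2) = - qe (x / 2).
Proof. by rewrite mulrDl mul1r qeD qe_half mulrN1. Qed.

Lemma qe_div2n_neq1 x k N : qe x != 1 -> qe ((x + k%:R) / 2 ^+ N) != 1.
Proof.
apply: contra_neq => h; rewrite -(qeDn x k).
have n0 : (2 : C) ^+ N != 0 by rewrite expf_neq0 // pnatr_eq0.
have -> : x + k%:R = (2 ^ N)%:R * ((x + k%:R) / 2 ^+ N) by rewrite natrX mulrC divfK.
by rewrite qeMn h expr1n.
Qed.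

Section Multiplication.
Variables (f : C -> C) (lam : C).
Hypothesis fdouble : forall q, q ^+ 2 != 1 -> lam * f (q ^+ 2) = f q + f (- q).

(** Each round replaces a point [y] by [y / 2] and [(y + 1) / 2], so that [N] rounds reach all
    [(x + k) / 2^N]. *)
Lemma iter_double x N : qe x != 1 ->
  lam ^+ N * f (qe x) = \sum_(k < 2 ^ N) f (qe ((x + k%:R) / 2 ^+ N)).
Proof.
move=> x1; elim: N => [|N IH].
  by rewrite expn0 big_ord1 !expr0 mul1r addr0 divr1.
rewrite exprS -mulrA IH mulr_sumr expnS mul2n -addnn big_split_ord /= -big_split /=.
apply: eq_bigr => k _; set y := (x + k%:R) / _.
have qy : qe y != 1 by exact: qe_div2n_neq1.
have E := fdouble (q := qe (y / 2)); rewrite qe_halve -qe_halve1 in E.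
rewrite (E qy).
have e1 : y / 2 = (x + k%:R) / 2 ^+ N.+1.
  by rewrite /y exprS invfM [in RHS]mulrCA mulrC.
have e2 : (y + 1) / 2 = (x + (2 ^ N + k)%:R) / 2 ^+ N.+1.
  have n0 : (2 : C) ^+ N != 0 by rewrite expf_neq0 // pnatr_eq0.
  rewrite mulrDl e1 natrD natrX [2 ^+ N + _]addrC addrA [in RHS]mulrDl.
  by congr (_ + _); rewrite exprS invfM mulrCA divff // mulr1 mul1r.
by rewrite e1 e2.
Qed.

(** The upper half of the points is moved down by one period, which centres the sum and pairs
    [x + k] with [x - k - 1]; all arguments then lie in the strip of [sub1_qe_ge]. *)
Lemma iter_double_pair x N : qe x != 1 ->
  lam ^+ N.+1 * f (qe x) = \sum_(k < 2 ^ N)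
    (f (qe ((x + k%:R) / 2 ^+ N.+1)) + f (qe ((x - k.+1%:R) / 2 ^+ N.+1))).
Proof.
move=> x1; rewrite iter_double // expnS mul2n -addnn big_split_ord /= big_split /=.
congr (_ + _); rewrite (reindex_inj rev_ord_inj) /=.
apply: eq_bigr => k _; rewrite -(qeBn _ 1); congr (f (qe _)).
have n0 : (2 : C) ^+ N.+1 != 0 by rewrite expf_neq0 // pnatr_eq0.
rewrite natrD natrB // natrX exprS; field.
by rewrite expf_neq0 // pnatr_eq0.
Qed.

End Multiplication.

Lemma two_pow_cvg0 : (fun N => (2 ^+ N)^-1 : R) @ \oo --> (0 : R).
Proof.
under eq_fun do rewrite -exprVn.
by apply: cvg_expr; rewrite ger0_norm ?invr_ge0 // invf_lt1 // ltr1n.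
Qed.

Lemma qe_div2n_cvg y : ccvg (fun N => 2 ^+ N * (1 - qe (y / 2 ^+ N))) (- (tau * y)).
Proof.
set K := 4 * (2 * pi * cabs y) ^+ 2 * expR (2 * pi * cabs y).
have p0 : 0 <= 2 * pi :> R by rewrite mulr_ge0 ?pi_ge0.
apply: (@ccvg_squeeze _ _ _ (fun N => K * (2 ^+ N)^-1) 0%N) => [N _|]; last first.
  rewrite -[X in _ --> X](mulr0 K).
  by apply: cvgM; [exact: cvg_cst | exact: two_pow_cvg0].
have n0 : (2 : C) ^+ N != 0 by rewrite expf_neq0 // pnatr_eq0.
have -> : 2 ^+ N * (1 - qe (y / 2 ^+ N)) - - (tau * y) =
   - (2 ^+ N * (qe (y / 2 ^+ N) - 1 - tau * (y / 2 ^+ N))).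
  by field.
have aN : cabs ((2 : C) ^+ N) = 2 ^+ N by rewrite cabsX cabs_nat.
rewrite cabsN cabsM aN.
have P0 : 0 < (2 : R) ^+ N by rewrite exprn_gt0.
have P1 : 1 <= (2 : R) ^+ N by rewrite exprn_ege1 // ler1n.
have := ler_wpM2l (ltW P0) (qe_taylor1 (y / 2 ^+ N)).
move/le_trans; apply; rewrite cabsM cabsV aN.
have e1 : expR (2 * pi * (cabs y / 2 ^+ N)) <= expR (2 * pi * cabs y).
  by rewrite ler_expR ler_wpM2l // ler_pdivrMr // ler_peMr ?cabs_ge0.
apply: (@le_trans _ _ (2 ^+ N * (4 * (2 * pi * (cabs y / 2 ^+ N)) ^+ 2 * expR (2 * pi * cabs y)))).
  by rewrite ler_wpM2l ?(ltW P0) // ler_wpM2l // mulr_ge0 ?sqr_ge0.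
by rewrite /K le_eqVlt; apply/orP; left; apply/eqP; field; rewrite gt_eqF.
Qed.

Lemma cabs_frac_le x (n : nat) : n%:R <= `|complex.Re x| -> n%:R <= cabs x.
Proof. by move/le_trans; apply; exact: cabs_Re. Qed.

(** Only the integers 0 and 1 can be close to a point of this strip, and [qe x != 1] excludes both;
    the distance to the others is seen on the real part. *)
Lemma strip_ge x : 0 <= complex.Re x < 1 -> qe x != 1 -> exists2 c : R, 0 < c &
  forall k, c * k.+1%:R <= cabs (x + k%:R) /\ c * k.+1%:R <= cabs (x - k.+1%:R).
Proof.
move=> /andP[x0 x1] qx.
have hx : 0 < cabs x.
  by rewrite cabs_gt0; apply: contra_neq qx => ->; exact: qe0.
have hx1 : 0 < cabs (x - 1).
  rewrite cabs_gt0 subr_eq0; apply: contra_neq qx => ->; exact: qe1.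
have Ren n : complex.Re (n%:R : C) = n%:R.
  by have -> : (n%:R : C) = (n%:R)%:C by rewrite rmorph_nat.
exists (Num.min (Num.min (cabs x) (cabs (x - 1))) 2^-1).
  by rewrite !lt_min hx hx1 invr_gt0 ltr0n.
set c := Num.min _ _.
have c1 : c <= cabs x by rewrite /c !ge_min lexx.
have c2 : c <= cabs (x - 1) by rewrite /c !ge_min lexx orbT.
have c3 : c <= 2^-1 by rewrite /c !ge_min lexx orbT.
case=> [|k]; first by rewrite addr0 mulr1.
have k0 : 0 <= k%:R :> R by [].
have big : c * k.+2%:R <= k.+1%:R.
  apply: (@le_trans _ _ (2^-1 * k.+2%:R)); first by rewrite ler_wpM2r.
  by rewrite -(natr1 k.+1) -(natr1 k); lra.
split; apply: le_trans big _; apply: cabs_frac_le; rewrite ?ReD ?ReN !Ren.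
  by apply: le_trans (ler_norm _); lra.
rewrite -normrN; apply: le_trans (ler_norm _).
by rewrite -(natr1 k.+1); lra.
Qed.

Lemma bser_inv_sqr : bser (fun k => (k.+1%:R ^+ 2)^-1 : R).
Proof.
split=> [k|]; first by rewrite invr_ge0 sqr_ge0.
exists 2 => n.
(* The telescoping remainder [1 / (n + 1)] strengthens the bound enough for induction. *)
suff : \sum_(i < n.+1) (i.+1%:R ^+ 2)^-1 <= 2 - n.+1%:R^-1 :> R.
  move=> h; apply: (@le_trans _ _ (2 - n.+1%:R^-1)); last by rewrite gerBl invr_ge0.
  by apply: le_trans h; rewrite big_ord_recr /= lerDl invr_ge0 sqr_ge0.
elim: n => [|n IH]; first by rewrite big_ord1 expr1n invr1; lra.
rewrite big_ord_recr /=; set t : R := n.+1%:R in IH *.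
have t0 : 0 < t by rewrite ltr0n.
have -> : n.+2%:R = t + 1 :> R by rewrite natr1.
suff h : ((t + 1) ^+ 2)^-1 <= t^-1 - (t + 1)^-1.
  by apply: (le_trans (lerD IH h)); rewrite addrA subrK.
have -> : t^-1 - (t + 1)^-1 = (t * (t + 1))^-1 by field; rewrite !gt_eqF //; lra.
by rewrite lef_pV2 ?posrE ?exprn_gt0 ?mulr_gt0 //; nra.
Qed.

End PartialFractions.

Section PartialFractionSums.
Variable R : realType.
Notation C := (complex R).
Implicit Types (x y z w : C).
Local Notation tau := (@ctau R).

Lemma ctau_neq0 : tau != 0.
Proof. by rewrite -cabs_gt0 cabs_ctau mulr_gt0 // pi_gt0. Qed.

Lemma two_pow_neq0 N : (2 : C) ^+ N != 0.
Proof. by rewrite expf_neq0 // pnatr_eq0. Qed.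

Lemma cabs_two_pow N : cabs ((2 : C) ^+ N) = 2 ^+ N.
Proof. by rewrite cabsX cabs_nat. Qed.

Lemma four_pow (S : pzRingType) N : (4 : S) ^+ N = (2 ^+ N) ^+ 2.
Proof. by rewrite -exprM mulnC exprM expr2 -natrM. Qed.

Lemma cinv_pow_cvg0 : ccvg (fun N => (2 ^+ N)^-1 : C) 0.
Proof.
apply: (@ccvg_squeeze _ _ _ (fun N => (2 ^+ N)^-1) 0%N); last exact: two_pow_cvg0.
by move=> N _; rewrite subr0 cabsV cabs_two_pow.
Qed.

Lemma qe_div2n_cvg1 y : ccvg (fun N => qe (y / 2 ^+ N)) 1.
Proof.
have := ccvgB (ccvg_cst 1) (ccvgM cinv_pow_cvg0 (qe_div2n_cvg y)).
rewrite mul0r subr0; apply: (@ccvg_eq _ _ _ _ 0%N) => N _.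
by rewrite mulKf ?two_pow_neq0 // opprB addrC subrK.
Qed.

Lemma hq_qe_le y : `|complex.Re y| <= 2^-1 -> y != 0 ->
  cabs (hq (qe y)) <= 4 * (cabs y ^+ 2)^-1.
Proof.
move=> h1 y0; rewrite /hq cabsM cabsV cabsX.
have y2 : 0 < cabs y ^+ 2 by rewrite exprn_gt0 // cabs_gt0.
have := sub1_qe_ge h1; set t := cabs (1 - _) ^+ 2; set r := cabs (qe y) => h.
have r0 : 0 < r by rewrite cabs_gt0 qe_neq0.
have t0 : 0 < t by have : 0 < cabs y ^+ 2 * r by [rewrite mulr_gt0]; lra.
by rewrite ler_pdivrMr // mulrAC ler_pdivlMr // mulrC.
Qed.

Lemma Re_divn x (n : nat) : complex.Re (x / 2 ^+ n) = complex.Re x / 2 ^+ n.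
Proof.
have -> : ((2 : C) ^+ n)^-1 = ((2 ^+ n)^-1)%:C by rewrite fmorphV rmorphXn /= rmorph_nat.
by rewrite ReM /= mulr0 subr0.
Qed.

Lemma Re_nat n : complex.Re (n%:R : C) = n%:R.
Proof. by have -> : (n%:R : C) = (n%:R)%:C by rewrite rmorph_nat. Qed.

Lemma Im_nat n : complex.Im (n%:R : C) = 0.
Proof. by have -> : (n%:R : C) = (n%:R)%:C by rewrite rmorph_nat. Qed.

Lemma strip_Re_le x N k : 0 <= complex.Re x < 1 -> (k < 2 ^ N)%N ->
  `|complex.Re ((x + k%:R) / 2 ^+ N.+1)| <= 2^-1 /\
  `|complex.Re ((x - k.+1%:R) / 2 ^+ N.+1)| <= 2^-1.
Proof.
move=> /andP[x0 x1] kN; rewrite !Re_divn !normrM.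
have P0 : 0 < (2 : R) ^+ N by rewrite exprn_gt0.
rewrite !(ger0_norm (_ : 0 <= (2 ^+ N.+1)^-1)); last by rewrite invr_ge0 exprn_ge0.
have P1 : 0 < (2 : R) ^+ N.+1 by rewrite exprn_gt0.
rewrite !ler_pdivrMr // exprS mulKf ?pnatr_eq0 //.
have : k.+1%:R <= (2 : R) ^+ N by rewrite -natrX ler_nat.
have k0 : 0 <= k%:R :> R by [].
rewrite !ReD !ReN !Re_nat -(natr1 k) !ler_norml => h.
by split; apply/andP; split; lra.
Qed.

(** After division by [4^(N+1)] each summand of [iter_double_pair] tends to an inverse square and is
    dominated by a multiple of [1 / (k + 1)^2], while the left side stays equal to [hq (qe x)].
    Tannery's theorem passes to the limit. *)
Lemma pf_hq_strip x : 0 <= complex.Re x < 1 -> qe x != 1 ->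
  csum (fun k => (x + k%:R) ^- 2 + (x - k.+1%:R) ^- 2) (tau ^+ 2 * hq (qe x)).
Proof.
move=> hx qx; have [c c0 hc] := strip_ge hx qx.
have xk0 k : x + k%:R != 0.
  by rewrite -cabs_gt0; apply: lt_le_trans (hc k).1; rewrite mulr_gt0.
have xk1 k : x - k.+1%:R != 0.
  by rewrite -cabs_gt0; apply: lt_le_trans (hc k).2; rewrite mulr_gt0.
pose b (k : nat) : R := 8 / c ^+ 2 * (k.+1%:R ^+ 2)^-1.
pose w N k := (4 ^+ N.+1)^-1 *
   (hq (qe ((x + k%:R) / 2 ^+ N.+1)) + hq (qe ((x - k.+1%:R) / 2 ^+ N.+1))).
pose v k := (tau * (x + k%:R)) ^- 2 + (tau * (x - k.+1%:R)) ^- 2.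
have hb : bser b by apply: bserZ (bser_inv_sqr R); rewrite divr_ge0 // sqr_ge0.
have term N y : y != 0 -> `|complex.Re (y / 2 ^+ N)| <= 2^-1 ->
    cabs ((4 ^+ N)^-1 * hq (qe (y / 2 ^+ N))) <= 4 * (cabs y ^+ 2)^-1.
  move=> y0 hy; rewrite cabsM cabsV cabsX cabs_nat.
  have P0 : 0 < (4 : R) ^+ N by rewrite exprn_gt0.
  rewrite ler_pdivrMl //.
  apply: le_trans (hq_qe_le hy _) _.
    by rewrite mulf_neq0 // invr_neq0 // two_pow_neq0.
  have -> : (4 : R) ^+ N = (2 ^+ N) ^+ 2 by rewrite four_pow.
  rewrite cabsM cabsV cabs_two_pow exprMn invfM exprVn invrK.
  by rewrite le_eqVlt; apply/orP; left; apply/eqP; ring.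
have dom N k : (0 <= N)%N -> (k < 2 ^ N)%N -> cabs (w N k) <= b k.
  move=> _ kN; have [r1 r2] := strip_Re_le hx kN.
  have t1 := term _ _ (xk0 k) r1; have t2 := term _ _ (xk1 k) r2.
  rewrite /w mulrDr; apply: le_trans (cabsD _ _) _.
  have i1 : (cabs (x + k%:R) ^+ 2)^-1 <= (c * k.+1%:R) ^- 2.
    rewrite lef_pV2 ?posrE ?exprn_gt0 ?cabs_gt0 ?mulr_gt0 //.
    by rewrite lerXn2r ?nnegrE ?mulr_ge0 ?cabs_ge0 ?(ltW c0) //; exact: (hc k).1.
  have i2 : (cabs (x - k.+1%:R) ^+ 2)^-1 <= (c * k.+1%:R) ^- 2.
    rewrite lef_pV2 ?posrE ?exprn_gt0 ?cabs_gt0 ?mulr_gt0 //.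
    by rewrite lerXn2r ?nnegrE ?mulr_ge0 ?cabs_ge0 ?(ltW c0) //; exact: (hc k).2.
  have -> : b k = 8 * (c * k.+1%:R) ^- 2 by rewrite /b [in RHS]exprMn [in RHS]invfM mulrA.
  apply: le_trans (lerD t1 t2) _; move: i1 i2.
  by move: (_ ^-1) (_ ^-1) (_ ^-1) => X Y Z; lra.
have lim1 y : y != 0 ->
    ccvg (fun N => (4 ^+ N)^-1 * hq (qe (y / 2 ^+ N))) ((tau * y) ^- 2).
  move=> y0; have ty : - (tau * y) != 0 by rewrite oppr_eq0 mulf_neq0 // ctau_neq0.
  have := ccvgM (qe_div2n_cvg1 y) (ccvgV (expf_neq0 2 ty) (ccvgX 2 (qe_div2n_cvg y))).
  rewrite mul1r sqrrN; apply: (@ccvg_eq _ _ _ _ 0%N) => N _.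
  rewrite /hq exprMn invfM -four_pow.
  by ring.
have cv k : ccvg (w^~ k) (v k).
  have := ccvgD (lim1 _ (xk0 k)) (lim1 _ (xk1 k)).
  by move/ccvgS; apply: (@ccvg_eq _ _ _ _ 0%N) => N _; rewrite /w mulrDr.
have big K : exists N, forall n, (N <= n)%N -> (K <= 2 ^ n)%N.
  by exists K => n Kn; apply: leq_trans Kn (ltnW (ltn_expl _ _)).
have [vb lim] := tannery hb dom cv big.
have sv : csumv v = hq (qe x).
  apply: (ccvg_unique lim); apply: (ccvg_eq (N0 := 0%N) _ (ccvg_cst _)) => N _.
  rewrite -mulr_sumr -(iter_double_pair (@hq_double R)) // mulKf // expf_neq0 //.
have := csumZ (tau ^+ 2) (csumvP (bser_cabs_le hb vb)); rewrite sv.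
apply: csum_eq => k /=; rewrite /v; move: (xk0 k) (xk1 k).
move: (x + _) (x - _) => p q p0 q0; field.
by rewrite p0 q0 ctau_neq0.
Qed.

(** Single cotangent terms decay only like [1 / k]. In a pair the numerator is [1 - p q], where
    [p q] is [qe] of [(2 x - 1) / 2^(N+1)]: it is small and independent of [k], which restores
    summability. *)
Lemma cq_pair (p q : C) : 1 - p != 0 -> 1 - q != 0 ->
  cq p + cq q = 2 * (1 - p * q) / ((1 - p) * (1 - q)).
Proof. by move=> a b; rewrite /cq; field; rewrite a b. Qed.



Lemma pf_cq_strip x : 0 <= complex.Re x < 1 -> qe x != 1 ->
  csum (fun k => (x + k%:R)^-1 + (x - k.+1%:R)^-1) (- (tau / 2) * cq (qe x)).
Proof.
move=> hx qx; have [c c0 hc] := strip_ge hx qx.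
have xk0 k : x + k%:R != 0.
  by rewrite -cabs_gt0; apply: lt_le_trans (hc k).1; rewrite mulr_gt0.
have xk1 k : x - k.+1%:R != 0.
  by rewrite -cabs_gt0; apply: lt_le_trans (hc k).2; rewrite mulr_gt0.
pose w N k := (2 ^+ N.+1)^-1 *
   (cq (qe ((x + k%:R) / 2 ^+ N.+1)) + cq (qe ((x - k.+1%:R) / 2 ^+ N.+1))).
pose v k := - (2 / (tau * (x + k%:R))) - 2 / (tau * (x - k.+1%:R)).
set s := 2 * pi : R; have s0 : 0 <= s by rewrite mulr_ge0 // pi_ge0.
pose D := cabs (2 * x - 1).
pose K := (s + 4 * s ^+ 2 * expR s) * expR (s / 2) * 8.
pose b (k : nat) : R := K * D / c ^+ 2 * (k.+1%:R ^+ 2)^-1.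
have K0 : 0 <= K.
  rewrite /K mulr_ge0 // mulr_ge0 ?expR_ge0 // addr_ge0 // mulr_ge0 ?expR_ge0 //.
  by rewrite mulr_ge0 // sqr_ge0.
have hb : bser b.
  by apply: bserZ (bser_inv_sqr R); rewrite divr_ge0 ?sqr_ge0 // mulr_ge0 // cabs_ge0.
have lin y : cabs y <= 1 -> cabs (1 - qe y) <= (s + 4 * s ^+ 2 * expR s) * cabs y.
  move=> y1; have y0 := cabs_ge0 y.
  have -> : 1 - qe y = - ((qe y - 1 - tau * y) + tau * y) by ring.
  rewrite cabsN; apply: le_trans (cabsD _ _) _; rewrite cabsM cabs_ctau -/s.
  have := qe_taylor1 y; rewrite -/s => t.
  have E : expR (s * cabs y) <= expR s by rewrite ler_expR ler_piMr.
  have E0 := expR_gt0 s.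
  have : 4 * (s * cabs y) ^+ 2 * expR (s * cabs y) <= 4 * s ^+ 2 * expR s * cabs y.
    apply: (@le_trans _ _ (4 * (s * cabs y) ^+ 2 * expR s)).
      by rewrite ler_wpM2l // mulr_ge0 ?sqr_ge0.
    rewrite exprMn (_ : 4 * (s ^+ 2 * cabs y ^+ 2) * expR s =
      4 * s ^+ 2 * expR s * (cabs y * cabs y)); last by ring.
    rewrite ler_wpM2l ?ler_piMr // mulr_ge0 ?expR_ge0 // mulr_ge0 // sqr_ge0 //.
  lra.
have lo y : `|complex.Re y| <= 2^-1 -> cabs (qe y) * cabs y ^+ 2 <= 4 * cabs (1 - qe y) ^+ 2.
  by move=> h; rewrite mulrC; exact: sub1_qe_ge.
(* From this rank on [y1 + y2] has modulus at most 1, as the linear bound [lin] requires. *)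
have [N0 hN0] : exists N0 : nat, forall N, (N0 <= N)%N -> D <= 2 ^+ N.+1.
  exists (Num.bound D) => N hN; apply: le_trans (ltW (archi_boundP (cabs_ge0 _))) _.
  rewrite -natrX ler_nat; apply: leq_trans hN _.
  by apply: leq_trans (leqnSn _) _; apply: ltnW; exact: ltn_expl.
have dom N k : (N0 <= N)%N -> (k < 2 ^ N)%N -> cabs (w N k) <= b k.
  move=> /hN0 DM kN; have [r1 r2] := strip_Re_le hx kN.
  set M : R := 2 ^+ N.+1 in DM; have M0 : 0 < M by rewrite exprn_gt0.
  set y1 := (x + k%:R) / _ in r1; set y2 := (x - k.+1%:R) / _ in r2.
  have n0 := two_pow_neq0 N.+1.
  have ay (t : C) : cabs (t / 2 ^+ N.+1) = cabs t / M by rewrite cabsM cabsV cabs_two_pow.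
  have nz (y : C) : y != 0 -> `|complex.Re y| <= 2^-1 -> 1 - qe y != 0.
    move=> y0 /lo h; rewrite -cabs_gt0 lt_neqAle cabs_ge0 andbT eq_sym.
    apply/eqP => e; move: h; rewrite e expr0n mulr0 leNgt mulr_gt0 //.
      by rewrite cabs_gt0 qe_neq0.
    by rewrite exprn_gt0 // cabs_gt0.
  have y10 : y1 != 0 by rewrite mulf_neq0 // invr_neq0.
  have y20 : y2 != 0 by rewrite mulf_neq0 // invr_neq0.
  have p0 := nz _ y10 r1; have q0 := nz _ y20 r2.
  rewrite /w -/y1 -/y2 cq_pair // cabsM cabsV cabs_two_pow -/M -qeD.
  rewrite cabsM cabsV !cabsM cabs_nat.
  have yD : cabs (y1 + y2) = D / M.
    by rewrite -mulrDl ay /D; congr (cabs _ / _); rewrite -natr1; ring.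
  have yD1 : cabs (y1 + y2) <= 1 by rewrite yD ler_pdivrMr // mul1r.
  have l1 := lin _ yD1; rewrite yD in l1.
  have P0 : 0 < cabs (1 - qe y1) by rewrite cabs_gt0.
  have Q0 : 0 < cabs (1 - qe y2) by rewrite cabs_gt0.
  (* The product of the two lower bounds [lo], after a square root; [expR (s / 2)] bounds the
     inverse square root of [|qe (y1 + y2)|], since [|y1 + y2| <= 1]. *)
  have l2 : cabs y1 * cabs y2 <= 4 * expR (s / 2) * (cabs (1 - qe y1) * cabs (1 - qe y2)).
    rewrite -ler_sqr ?nnegrE ?mulr_ge0 ?cabs_ge0 ?expR_ge0 //.
    have E : 1 <= expR s * (cabs (qe y1) * cabs (qe y2)).
      rewrite -cabsM -qeD cabs_qe -/s -expRD -[X in X <= _]expR0 ler_expR.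
      have := ler_norm (complex.Im (y1 + y2)); have := cabs_Im (y1 + y2).
      rewrite (_ : s + _ = s * (1 - complex.Im (y1 + y2))); last by rewrite mulrBr mulr1.
      by move=> h1 h2; rewrite mulr_ge0 //; lra.
    have k1 := lo _ r1; have k2 := lo _ r2.
    have k3 : (cabs (qe y1) * cabs y1 ^+ 2) * (cabs (qe y2) * cabs y2 ^+ 2) <=
       (4 * cabs (1 - qe y1) ^+ 2) * (4 * cabs (1 - qe y2) ^+ 2).
      by apply: ler_pM => //; rewrite mulr_ge0 ?cabs_ge0 ?sqr_ge0.
    have k4 := ler_wpM2l (expR_ge0 s) k3.
    have k5 : expR (s / 2) ^+ 2 = expR s by rewrite expr2 -expRD; congr expR; field.
    have k6 := ler_wpM2r (mulr_ge0 (sqr_ge0 (cabs y1)) (sqr_ge0 (cabs y2))) E.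
    rewrite !exprMn k5; apply: (@le_trans _ _ (expR s * (cabs (qe y1) * cabs y1 ^+ 2 * (cabs (qe y2) * cabs y2 ^+ 2)))).
      by apply: le_trans (le_trans k6 _); rewrite ?mul1r // le_eqVlt; apply/orP; left; apply/eqP; ring.
    by apply: le_trans k4 _; rewrite le_eqVlt; apply/orP; left; apply/eqP; ring.
  have l3 : c ^+ 2 * k.+1%:R ^+ 2 / M ^+ 2 <= cabs y1 * cabs y2.
    rewrite !ay (_ : c ^+ 2 * k.+1%:R ^+ 2 / M ^+ 2 = (c * k.+1%:R / M) * (c * k.+1%:R / M)).
      by apply: ler_pM; rewrite ?divr_ge0 ?mulr_ge0 ?(ltW c0) ?(ltW M0) //
        ler_pM2r ?invr_gt0 //; [exact: (hc k).1 | exact: (hc k).2].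
    by field; rewrite gt_eqF.
  have l4 := le_trans l3 l2.
  have kk : 0 < k.+1%:R :> R by rewrite ltr0n.
  have key (A B PQ E c2 k2 DD : R) : 0 < c2 -> 0 < k2 -> 0 < PQ -> 0 <= A -> 0 <= DD -> 0 <= E ->
      B <= A * (DD / M) -> c2 * k2 / M ^+ 2 <= 4 * E * PQ ->
      M^-1 * (2 * B / PQ) <= A * E * 8 * DD / c2 * k2^-1.
    move=> c20 k20 PQ0 A0 D0 E0 hB hE.
    have g1 : (M ^+ 2 * PQ)^-1 <= 4 * E / (c2 * k2).
      rewrite ler_pdivlMr ?mulr_gt0 // mulrC ler_pdivrMr ?mulr_gt0 ?exprn_gt0 //.
      by move: hE; rewrite ler_pdivrMr ?exprn_gt0 // => hE; lra.
    apply: (@le_trans _ _ (2 * A * DD * (M ^+ 2 * PQ)^-1)).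
      have -> : 2 * A * DD * (M ^+ 2 * PQ)^-1 = M^-1 * (2 * (A * (DD / M)) / PQ).
        by field; rewrite !gt_eqF.
      by rewrite ler_wpM2l ?invr_ge0 ?(ltW M0) // ler_pM2r ?invr_gt0 // ler_pM2l.
    have -> : A * E * 8 * DD / c2 * k2^-1 = 2 * A * DD * (4 * E / (c2 * k2)).
      by field; rewrite !gt_eqF.
    by rewrite ler_wpM2l // !mulr_ge0.
  have := key _ _ _ _ _ _ _ _ _ _ _ _ _ l1 l4.
  rewrite /b /K; apply => //; rewrite ?exprn_gt0 ?mulr_gt0 ?expR_ge0 ?cabs_ge0 //.
  by rewrite addr_ge0 // mulr_ge0 ?expR_ge0 // mulr_ge0 // sqr_ge0.
have lim1 y : y != 0 ->
    ccvg (fun N => (2 ^+ N)^-1 * cq (qe (y / 2 ^+ N))) (- (2 / (tau * y))).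
  move=> y0; have ty : - (tau * y) != 0 by rewrite oppr_eq0 mulf_neq0 // ctau_neq0.
  have := ccvgM (ccvgD (ccvg_cst 1) (qe_div2n_cvg1 y)) (ccvgV ty (qe_div2n_cvg y)).
  rewrite invrN mulrN; apply: (@ccvg_eq _ _ _ _ 0%N) => N _.
  by rewrite /cq invfM; ring.
have cv k : ccvg (w^~ k) (v k).
  have := ccvgD (lim1 _ (xk0 k)) (lim1 _ (xk1 k)).
  by move/ccvgS; apply: (@ccvg_eq _ _ _ _ 0%N) => N _; rewrite /w mulrDr.
have big n : exists N, forall m, (N <= m)%N -> (n <= 2 ^ m)%N.
  by exists n => m Kn; apply: leq_trans Kn (ltnW (ltn_expl _ _)).
have [vb lim] := tannery hb dom cv big.
have sv : csumv v = cq (qe x).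
  apply: (ccvg_unique lim); apply: (ccvg_eq (N0 := 0%N) _ (ccvg_cst _)) => N _.
  by rewrite -mulr_sumr -(iter_double_pair (@cq_double R)) // mulKf // expf_neq0.
have := csumZ (- (tau / 2)) (csumvP (bser_cabs_le hb vb)); rewrite sv.
rewrite mulNr -mulNr; apply: csum_eq => k /=; rewrite /v; move: (xk0 k) (xk1 k).
move: (x + _) (x - _) => p q p0 q0; field.
by rewrite p0 q0 ctau_neq0.
Qed.

End PartialFractionSums.

(** * Partial fractions at all non-integral points, and the value of zeta(2) *)

Section EisensteinE2.
Variable R : realType.
Notation C := (complex R).
Implicit Types (x y z w : C).
Local Notation tau := (@ctau R).

Lemma bser_geom (r : R) : 0 <= r < 1 -> bser (fun k => r ^+ k).
Proof.
move=> /andP[r0 r1]; split=> [k|]; first exact: exprn_ge0.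
have r2 : 0 < 1 - r by rewrite subr_gt0.
exists (1 - r)^-1 => n.
suff -> : \sum_(i < n) r ^+ i = (1 - r ^+ n) / (1 - r).
  by rewrite -[leRHS]mul1r ler_pM2r ?invr_gt0 // gerBl exprn_ge0.
elim: n => [|n IH]; first by rewrite big_ord0 expr0 subrr mul0r.
by rewrite big_ord_recr /= IH exprS; field; rewrite gt_eqF.
Qed.

Lemma inv_nat_cvg0 x : ccvg (fun K => (x + K%:R)^-1) 0.
Proof.
apply/ccvgP => e e0; pose B := cabs x + e^-1 + 1.
have B0 : 0 <= B by rewrite addr_ge0 // addr_ge0 ?cabs_ge0 // invr_ge0 ltW.
exists (Num.bound B) => n hn; rewrite subr0 cabsV.
have h : B < n%:R by apply: lt_le_trans (archi_boundP B0) _; rewrite ler_nat.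
have := cabsD_ge n%:R x; rewrite cabs_nat [_ + x]addrC => h2.
have h3 : e^-1 < cabs (x + n%:R) by move: h; rewrite /B; lra.
have h4 : 0 < e^-1 by rewrite invr_gt0.
by rewrite -[e]invrK ltf_pV2 // posrE // (lt_trans h4).
Qed.

Lemma inv_nat_cvg0N x : ccvg (fun K => (x - K%:R)^-1) 0.
Proof.
have := ccvgN (inv_nat_cvg0 (- x)); rewrite oppr0.
by apply: (@ccvg_eq _ _ _ _ 0%N) => n _; rewrite -invrN opprD opprK.
Qed.

Section Shift.
Variable g : C -> C.
Hypothesis gp : forall x, ccvg (fun K => g (x + K%:R)) 0.
Hypothesis gn : forall x, ccvg (fun K => g (x - K%:R)) 0.

(** Shifting by 1 adds the boundary term [g (x + n) - g (x - n)] to the partial sum of length [n],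
    and this tends to 0. *)
Lemma csum_pair_shift x l : csum (fun k => g (x + k%:R) + g (x - k.+1%:R)) l ->
  csum (fun k => g (x + 1 + k%:R) + g (x + 1 - k.+1%:R)) l.
Proof.
move=> h; have := ccvgD h (ccvgB (gp x) (gn x)); rewrite subr0 addr0.
apply: (@ccvg_eq _ _ _ _ 0%N) => n _; elim: n => [|n IH].
  by rewrite !big_ord0 addr0 subr0 subrr addr0.
rewrite big_ord_recr /= [in RHS]big_ord_recr /= -IH.
have -> : x + 1 + n%:R = x + n.+1%:R by rewrite -natr1; ring.
have -> : x + 1 - n.+1%:R = x - n%:R by rewrite -natr1; ring.
by ring.
Qed.

Lemma csum_pair_unshift x l : csum (fun k => g (x + k%:R) + g (x - k.+1%:R)) l ->
  csum (fun k => g (x - 1 + k%:R) + g (x - 1 - k.+1%:R)) l.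
Proof.
move=> h; have := ccvgD h (ccvgB (gn (x - 1)) (gp (x - 1))); rewrite subr0 addr0.
apply: (@ccvg_eq _ _ _ _ 0%N) => n _; elim: n => [|n IH].
  by rewrite !big_ord0 addr0 subr0 subrr addr0.
rewrite big_ord_recr /= [in RHS]big_ord_recr /= -IH.
have -> : x - 1 + n.+1%:R = x + n%:R by rewrite -natr1; ring.
have -> : x - 1 - n%:R = x - n.+1%:R by rewrite -natr1; ring.
by ring.
Qed.

(** Both sides are unchanged by integral translations, and every point is an integer away from the
    strip. *)
Lemma csum_pair_strip (F : C -> C) : (forall x, F (x + 1) = F x) ->
  (forall x, 0 <= complex.Re x < 1 -> qe x != 1 ->
     csum (fun k => g (x + k%:R) + g (x - k.+1%:R)) (F x)) ->
  forall x, qe x != 1 -> csum (fun k => g (x + k%:R) + g (x - k.+1%:R)) (F x).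
Proof.
move=> Fp h x qx.
have Re_int (m : int) : complex.Re (m%:~R : C) = m%:~R.
  by have -> : (m%:~R : C) = (m%:~R)%:C by rewrite rmorph_int.
have [y [n [Ex hy qy]]] : exists y, exists n : int,
    [/\ x = y + n%:~R, 0 <= complex.Re y < 1 & qe y != 1].
  pose n := Num.floor (complex.Re x); exists (x - n%:~R), n; split.
  - by rewrite subrK.
  - rewrite ReD ReN Re_int; have := floor_itv (complex.Re x); rewrite -/n intrD.
    by move=> /andP[a b]; apply/andP; split; lra.
  - move: qx; case: n => k; first by rewrite qeBn.
    by rewrite NegzE mulrNz opprK qeDn.
rewrite Ex; have := h y hy qy; case: n {Ex hy h qy} => k; last first.
  rewrite NegzE mulrNz -pmulrn; elim: k.+1 => [|j IH] hj; first by rewrite subr0.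
  have -> : y - j.+1%:R = y - j%:R - 1 by rewrite -natr1; ring.
  rewrite -(Fp (y - j%:R - 1)) subrK; apply: csum_pair_unshift; exact: IH.
rewrite -pmulrn; elim: k => [|j IH] hj; first by rewrite addr0.
have -> : y + j.+1%:R = y + j%:R + 1 by rewrite -addrA natr1.
by rewrite Fp; apply: csum_pair_shift; exact: IH.
Qed.

Lemma csum_pair_center x l : csum (fun k => g (x + k%:R) + g (x - k.+1%:R)) l ->
  csum (fun k => g (x + k.+1%:R) + g (x - k.+1%:R)) (l - g x).
Proof.
move=> h; have := ccvgD h (ccvgB (gp x) (ccvg_cst (g x))); rewrite add0r.
apply: (@ccvg_eq _ _ _ _ 0%N) => n _; elim: n => [|n IH].
  by rewrite !big_ord0 addr0 subrr addr0.
by rewrite big_ord_recr /= [in RHS]big_ord_recr /= -IH; ring.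
Qed.

End Shift.

Lemma invsq_nat_cvg0 x : ccvg (fun K => (x + K%:R) ^- 2) 0.
Proof.
have := ccvgX 2 (inv_nat_cvg0 x); rewrite expr0n /=.
by apply: (@ccvg_eq _ _ _ _ 0%N) => n _; rewrite exprVn.
Qed.

Lemma invsq_nat_cvg0N x : ccvg (fun K => (x - K%:R) ^- 2) 0.
Proof.
have := ccvgX 2 (inv_nat_cvg0N x); rewrite expr0n /=.
by apply: (@ccvg_eq _ _ _ _ 0%N) => n _; rewrite exprVn.
Qed.

Lemma pf_hq x : qe x != 1 ->
  csum (fun k => (x + k%:R) ^- 2 + (x - k.+1%:R) ^- 2) (tau ^+ 2 * hq (qe x)).
Proof.
apply: (csum_pair_strip (g := fun y => y ^- 2) invsq_nat_cvg0 invsq_nat_cvg0N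
  (F := fun x => tau ^+ 2 * hq (qe x))); first by move=> y; rewrite qeD1.
exact: pf_hq_strip.
Qed.

Lemma pf_cq x : qe x != 1 ->
  csum (fun k => (x + k%:R)^-1 + (x - k.+1%:R)^-1) (- (tau / 2) * cq (qe x)).
Proof.
apply: (csum_pair_strip (g := fun y => y^-1) inv_nat_cvg0 inv_nat_cvg0N
  (F := fun x => - (tau / 2) * cq (qe x))); first by move=> y; rewrite qeD1.
exact: pf_cq_strip.
Qed.

(** The expansion of [hq] at [x = 1/2] evaluates the sum over odd integers,
    [pi^2 / 8 = - ctau^2 / 32]; the even integers contribute a quarter of the whole, hence the
    factor 4/3. *)
Lemma zeta2 : csum (fun k => (k.+1%:R ^+ 2)^-1) (- tau ^+ 2 / 24).
Proof.
have odd_part : csum (fun k => ((2 * k).+1%:R ^+ 2)^-1) (- tau ^+ 2 / 32).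
  have q1 : qe (2^-1 : C) != 1.
    by rewrite qe_half -subr_eq0 -opprD oppr_eq0 -(natrD _ 1 1) pnatr_eq0.
  have := csumZ (8^-1) (pf_hq q1); rewrite qe_half /hq opprK.
  have -> : 8^-1 * (tau ^+ 2 * (-1 / (1 + 1) ^+ 2)) = - tau ^+ 2 / 32 by field.
  apply: csum_eq => k /=.
  have k0 : ((2 * k).+1%:R : C) != 0 by rewrite pnatr_eq0.
  have -> : (2^-1 : C) + k%:R = (2 * k).+1%:R / 2 by rewrite -(natr1 (2 * k)) natrM; field.
  have -> : (2^-1 : C) - k.+1%:R = - ((2 * k).+1%:R / 2).
    by rewrite -(natr1 (2 * k)) -(natr1 k) natrM; field.
  by move: k0; move: (_.+1%:R) => p p0; field.
have hb : bser (fun k => cabs ((k.+1%:R ^+ 2)^-1 : C)).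
  by apply: bser_le (bser_inv_sqr R) => k; rewrite cabs_ge0 cabsV cabsX cabs_nat lexx.
have hz := csumvP hb; set Z := csumv _ in hz.
have h2 : csum (fun k => (k.+1%:R ^+ 2)^-1 : C) (- tau ^+ 2 / 32 + 4^-1 * Z).
  have : ccvg (fun n => \sum_(k < 2 * n) (k.+1%:R ^+ 2)^-1 : C) (- tau ^+ 2 / 32 + 4^-1 * Z).
    have := ccvgD odd_part (csumZ 4^-1 hz).
    apply: (@ccvg_eq _ _ _ _ 0%N) => n _; elim: n => [|n IH].
      by rewrite muln0 !big_ord0 addr0.
    rewrite mulnS !big_ord_recr /= -IH.
    have -> : (2 * n).+2%:R = 2 * n.+1%:R :> C by rewrite -natrM mulnS.
    have n0 : (n.+1%:R : C) != 0 by rewrite pnatr_eq0.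
    have q0 : ((2 * n).+1%:R : C) != 0 by rewrite pnatr_eq0.
    move: n0 q0; move: (n.+1%:R) ((2 * n).+1%:R) => p q p0 q0.
    by move: (\sum_(i < n) _) (\sum_(i < n) _) => A B; field; rewrite p0 q0.
  move=> h; have h' : ccvg (fun n => \sum_(k < 2 * n) (k.+1%:R ^+ 2)^-1 : C) Z.
    apply: (ccvg_sub (m := fun n => (2 * n)%N) _ hz) => K; exists K => n Kn.
    by rewrite mul2n -addnn (leq_trans Kn) // leq_addr.
  by rewrite (ccvg_unique h h').
have e := csum_unique hz h2.
suff -> : - tau ^+ 2 / 24 = Z by [].
have -> : - tau ^+ 2 / 24 = 4 / 3 * (- tau ^+ 2 / 32) by field.
have -> : - tau ^+ 2 / 32 = Z - 4^-1 * Z by rewrite {1}e addrK.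
by field.
Qed.

(** Comparison with the telescoping sequence [2 / sqrt n]. The exponent 3/2 is what remains for each
    index when a decay of order [(m + n)^-3] is split into a product. *)
Lemma bser_inv_sqrt3 : bser (fun k => (k.+1%:R * Num.sqrt k.+1%:R)^-1 : R).
Proof.
split=> [k|]; first by rewrite invr_ge0 mulr_ge0 // sqrtr_ge0.
exists 3 => n.
suff h : \sum_(i < n.+1) (i.+1%:R * Num.sqrt i.+1%:R)^-1 <= 3 - 2 / Num.sqrt n.+1%:R :> R.
  apply: (@le_trans _ _ (3 - 2 / Num.sqrt n.+1%:R)); last first.
    by rewrite gerBl divr_ge0 // sqrtr_ge0.
  by apply: le_trans h; rewrite big_ord_recr /= lerDl invr_ge0 mulr_ge0 // sqrtr_ge0.
elim: n => [|n IH]; first by rewrite big_ord1 sqrtr1 mulr1 invr1; lra.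
rewrite big_ord_recr /=; set s : R := Num.sqrt n.+1%:R in IH *; set t : R := Num.sqrt n.+2%:R.
have s0 : 0 < s by rewrite sqrtr_gt0 ltr0n.
have st : s <= t by rewrite ler_wsqrtr // ler_nat.
have t0 : 0 < t by apply: lt_le_trans st.
have s2 : s ^+ 2 = n.+1%:R by rewrite sqr_sqrtr.
have t2 : t ^+ 2 = s ^+ 2 + 1 by rewrite s2 natr1 sqr_sqrtr.
have -> : n.+2%:R = t ^+ 2 :> R by rewrite sqr_sqrtr.
suff h : (t ^+ 2 * t)^-1 <= 2 / s - 2 / t.
  by apply: (le_trans (lerD IH h)); rewrite addrA subrK.
have -> : 2 / s - 2 / t = 2 * (t - s) / (s * t) by field; rewrite !gt_eqF.
rewrite ler_pdivlMr ?mulr_gt0 // mulrC ler_pdivrMr ?mulr_gt0 ?exprn_gt0 //.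
have e1 : (t - s) * (t + s) = 1 by rewrite -subr_sqr; lra.
have d0 : 0 < t - s by nra.
have : s * (t + s) <= 2 * t ^+ 2 by nra.
move/(ler_wpM2l (mulr_ge0 (ltW d0) (ltW t0))) => h.
have -> : s * t = (t - s) * t * (s * (t + s)) by rewrite mulrACA; nra.
apply: le_trans h _; lra.
Qed.

End EisensteinE2.

(** * The lattice double series and the transformation law of [E2] *)

Section EisensteinTransformation.
Variable R : realType.
Notation C := (complex R).
Implicit Types (x y z w q : C).
Local Notation tau := (@ctau R).

Lemma hqV q : hq q^-1 = hq q.
Proof.
have [->|q0] := eqVneq q 0; first by rewrite invr0.
have [->|q1] := eqVneq q 1; first by rewrite invr1.
have h1 : 1 - q != 0 by rewrite subr_eq0 eq_sym.
have h2 : 1 - q^-1 != 0 by rewrite subr_eq0 eq_sym invr_eq1.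
rewrite /hq; have -> : 1 - q^-1 = - ((1 - q) / q) by field.
by field; rewrite q0 h1.
Qed.

Lemma cabs_qe_lt1 z : 0 < complex.Im z -> cabs (qe z) < 1.
Proof.
move=> z0; rewrite cabs_qe -[X in _ < X]expR0 ltr_expR oppr_lt0.
by rewrite !mulr_gt0 // pi_gt0.
Qed.

Lemma ImZn n z : complex.Im (n%:R * z) = n%:R * complex.Im z.
Proof. by rewrite ImM Re_nat Im_nat mul0r addr0. Qed.

Lemma qe_neq1 x : complex.Im x != 0 -> qe x != 1.
Proof.
move=> x0; apply/eqP => e; move: (cabs_qe x); rewrite e cabs1 => /esym.
rewrite -[RHS]expR0 => /expR_inj /eqP; rewrite oppr_eq0 mulf_eq0 (negPf x0) orbF.
by move=> /eqP h; have := pi_gt0 R; lra.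
Qed.

Lemma hq_le q : cabs q < 1 -> cabs (hq q) <= (1 - cabs q) ^- 2 * cabs q.
Proof.
move=> q1; rewrite /hq cabsM cabsV cabsX mulrC ler_wpM2r ?cabs_ge0 //.
have h : 0 < 1 - cabs q by rewrite subr_gt0.
have k : 1 - cabs q <= cabs (1 - q) by have := cabsB_ge 1 q; rewrite cabs1.
rewrite lef_pV2 ?posrE ?exprn_gt0 // ?(lt_le_trans h) //.
by rewrite lerXn2r ?nnegrE ?cabs_ge0 // ltW.
Qed.

(** The sum of [sigma_1(n) q^n], so that [E2 = 1 - 24 Psum]. *)
Definition Psum z : C := csumv (fun m => hq (qe z ^+ m.+1)).

Lemma bser_hq z : 0 < complex.Im z -> bser (fun m => cabs (hq (qe z ^+ m.+1))).
Proof.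
move=> /cabs_qe_lt1 q1; set r := cabs (qe z) in q1.
have r0 : 0 <= r by exact: cabs_ge0.
have r2 : 0 < 1 - r by rewrite subr_gt0.
apply: bser_le (bserZ (c := (1 - r) ^- 2 * r) _ (bser_geom (r := r) _)); last first.
- by rewrite r0.
- by rewrite mulr_ge0 // invr_ge0 sqr_ge0.
move=> m; rewrite cabs_ge0 /=.
have rm : cabs (qe z ^+ m.+1) <= r by rewrite cabsX -/r exprS ler_piMr // exprn_ile1 // ltW.
have rm1 : cabs (qe z ^+ m.+1) < 1 by apply: le_lt_trans rm q1.
apply: le_trans (hq_le rm1) _; rewrite -mulrA -exprS -[in leRHS]cabsX.
rewrite ler_wpM2r ?cabs_ge0 // lef_pV2 ?posrE ?exprn_gt0 // ?subr_gt0 //.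
by rewrite lerXn2r ?nnegrE ?subr_ge0 ?(ltW q1) ?(ltW rm1) ?lerD2l ?lerN2.
Qed.

Lemma PsumP z : 0 < complex.Im z -> csum (fun m => hq (qe z ^+ m.+1)) (Psum z).
Proof. by move=> z0; apply: csumvP; exact: bser_hq. Qed.

(** The imaginary part gives the bound [m y], the triangle inequality the bound [n - m |z|]. *)
Lemma lattice_ge z : 0 < complex.Im z -> exists2 c : R, 0 < c & forall m n : nat,
  c * (m%:R + n%:R) <= cabs (m%:R * z + n%:R) /\
  c * (m%:R + n%:R) <= cabs (m%:R * z - n%:R).
Proof.
move=> z0; set y := complex.Im z in z0; set a := cabs z.
have a0 : 0 <= a := cabs_ge0 _.
have d0 : 0 < y + a + 1 by lra.
(* With weights [a + 1] and [y] the two bounds add up to exactly [y (m + n)]. *)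
exists (y / (y + a + 1)) => [|m n]; first by rewrite divr_gt0.
have key (t : R) : m%:R * y <= t -> n%:R - m%:R * a <= t ->
    y / (y + a + 1) * (m%:R + n%:R) <= t.
  move=> h1 h2; rewrite mulrAC ler_pdivrMr //.
  have h3 := ler_wpM2l (ltW z0) h2; have a1 : 0 <= a + 1 by lra.
  have h4 := ler_wpM2l a1 h1; lra.
have imn (u : C) : complex.Im u = 0 -> m%:R * y <= cabs (m%:R * z + u).
  move=> u0; apply: le_trans (cabs_Im _); rewrite ImD u0 addr0 ImZn.
  exact: ler_norm.
have az : cabs (m%:R * z) = m%:R * a by rewrite cabsM cabs_nat.
split; apply: key.
- by apply: imn; rewrite Im_nat.
- by have := cabsD_ge n%:R (m%:R * z); rewrite cabs_nat az [_ + _ * z]addrC.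
- by apply: imn; rewrite ImN Im_nat oppr0.
- by have := cabsB_ge n%:R (m%:R * z); rewrite cabs_nat az cabsB.
Qed.

(* [s m n - t m n], where [s m n] sums the four terms [(+-M z +- N)^-2] for
   [M = m + 1], [N = n + 1], and [t m n] telescopes in [n]. *)
Definition Ereg z (m n : nat) : C :=
  2 * ((m.+1%:R * z + n.+1%:R) ^- 2 + (m.+1%:R * z - n.+1%:R) ^- 2) -
  4 * (n.+1%:R / ((m.+1%:R * z) ^+ 2 - n.+1%:R ^+ 2)
       - n%:R / ((m.+1%:R * z) ^+ 2 - n%:R ^+ 2)).

(** The derivative of [n / (a^2 - n^2)] in [n] is [(a^2 + n^2) / (a^2 - n^2)^2], so the telescoping
    difference matches the four-term sum to leading order. The decay improves from order -2 to order
    -3, which makes the double series absolutely convergent. *)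
Lemma Ereg_le z : 0 < complex.Im z -> exists2 K : R, 0 <= K & forall m n,
  cabs (Ereg z m n) <= K * (m.+1%:R * Num.sqrt m.+1%:R)^-1 * (n.+1%:R * Num.sqrt n.+1%:R)^-1.
Proof.
move=> z0; have [c c0 hc] := lattice_ge z0.
set A := cabs z; have A0 : 0 <= A := cabs_ge0 _.
exists (48 * (1 + A ^+ 2) / c ^+ 6).
  by rewrite divr_ge0 ?exprn_ge0 ?(ltW c0) // mulr_ge0 // addr_ge0 // sqr_ge0.
move=> m n; set M : R := m.+1%:R; set N : R := n.+1%:R.
have M1 : 1 <= M by rewrite ler1n.
have N1 : 1 <= N by rewrite ler1n.
set S := M + N; have S0 : 0 < S by rewrite /S; lra.
have [p1 p2] := hc m.+1 n.+1; have [p3 p4] := hc m.+1 n.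
have cS : 0 < c * S by rewrite mulr_gt0.
have nN : n%:R = N - 1 by rewrite /N -natr1 addrK.
have cS2 : c * S / 2 <= c * (m.+1%:R + n%:R).
  by rewrite -mulrA ler_pM2l // nN -/M /S; lra.
have cS3 : 0 < c * S / 2 by rewrite divr_gt0.
move: p1 p2; rewrite -/M -/N -/S => p1 p2.
have {}p3 := le_trans cS2 p3; have {}p4 := le_trans cS2 p4.
rewrite /Ereg; have Az : cabs (m.+1%:R * z) = M * A by rewrite cabsM cabs_nat.
have cn : cabs (n.+1%:R : C) = N by rewrite cabs_nat.
have cv : cabs (n%:R : C) = N - 1 by rewrite cabs_nat.
move: p1 p2 p3 p4 Az cn cv; rewrite -(natr1 n).
move: (m.+1%:R * z) (n%:R) => a v p1 p2 p3 p4 Az cn cv.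
set D := a ^+ 2 - (v + 1) ^+ 2; set D' := a ^+ 2 - v ^+ 2.
have nz (u : C) (e : R) : 0 < e -> e <= cabs u -> u != 0.
  by move=> e0 eu; rewrite -cabs_gt0 (lt_le_trans e0).
have z1 := nz _ _ cS p1; have z2 := nz _ _ cS p2.
have z3 := nz _ _ cS3 p3; have z4 := nz _ _ cS3 p4.
have ED : D = (a + (v + 1)) * (a - (v + 1)) by rewrite /D; ring.
have ED' : D' = (a + v) * (a - v) by rewrite /D'; ring.
(* Over the common denominator the cancellation becomes visible: numerator of degree 3, denominator
   of degree 6. *)
have -> : 2 * ((a + (v + 1)) ^- 2 + (a - (v + 1)) ^- 2) - 4 * ((v + 1) / D - v / D') =
  4 * ((v + 1) * D + (a ^+ 2 + (v + 1) ^+ 2) * (2 * (v + 1) - 1)) / (D ^+ 2 * D').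
  by rewrite ED ED'; field; rewrite z1 z2 z3 z4.
have num : cabs (4 * ((v + 1) * D + (a ^+ 2 + (v + 1) ^+ 2) * (2 * (v + 1) - 1)))
    <= 12 * (1 + A ^+ 2) * S ^+ 3.
  have T : cabs (a ^+ 2) = M ^+ 2 * A ^+ 2 by rewrite cabsX Az exprMn.
  have T2 : cabs ((v + 1) ^+ 2) = N ^+ 2 by rewrite cabsX cn.
  set B := M ^+ 2 * A ^+ 2 + N ^+ 2.
  have D1 : cabs D <= B by have := cabsD (a ^+ 2) (- (v + 1) ^+ 2); rewrite cabsN T T2.
  have D2 : cabs (a ^+ 2 + (v + 1) ^+ 2) <= B.
    by have := cabsD (a ^+ 2) ((v + 1) ^+ 2); rewrite T T2.
  have D3 : cabs (2 * (v + 1) - 1) <= 2 * N.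
    have -> : 2 * (v + 1) - 1 = (v + 1) + v by ring.
    by have := cabsD (v + 1) v; rewrite cn cv; lra.
  have B0 : 0 <= B by rewrite addr_ge0 ?mulr_ge0 ?sqr_ge0.
  have BS : B <= (1 + A ^+ 2) * S ^+ 2.
    have MS : M ^+ 2 <= S ^+ 2 by rewrite lerXn2r ?nnegrE /S; lra.
    have NS : N ^+ 2 <= S ^+ 2 by rewrite lerXn2r ?nnegrE /S; lra.
    by have := ler_wpM2r (sqr_ge0 A) MS; rewrite /B; lra.
  rewrite cabsM cabs_nat.
  have k1 : cabs ((v + 1) * D) <= N * B.
    by rewrite cabsM cn ler_wpM2l //; lra.
  have k2 : cabs ((a ^+ 2 + (v + 1) ^+ 2) * (2 * (v + 1) - 1)) <= B * (2 * N).
    by rewrite cabsM ler_pM ?cabs_ge0.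
  have k3 := cabsD ((v + 1) * D) ((a ^+ 2 + (v + 1) ^+ 2) * (2 * (v + 1) - 1)).
  have k4 : N * B <= S * ((1 + A ^+ 2) * S ^+ 2).
    by apply: ler_pM => //; rewrite /S; lra.
  have k5 : S * ((1 + A ^+ 2) * S ^+ 2) = (1 + A ^+ 2) * S ^+ 3 by ring.
  rewrite k5 in k4; lra.
have den : (c * S) ^+ 6 / 4 <= cabs (D ^+ 2 * D').
  rewrite cabsM cabsX ED ED' !cabsM.
  have -> : (c * S) ^+ 6 / 4 = (c * S * (c * S)) ^+ 2 * ((c * S / 2) * (c * S / 2)).
    by field.
  have h1 : c * S * (c * S) <= cabs (a + (v + 1)) * cabs (a - (v + 1)).
    by apply: ler_pM => //; rewrite ltW.
  have h2 : (c * S / 2) * (c * S / 2) <= cabs (a + v) * cabs (a - v).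
    by apply: ler_pM => //; rewrite ltW.
  have h0 : 0 <= c * S * (c * S) by rewrite mulr_ge0 // ltW.
  apply: ler_pM => //; rewrite ?sqr_ge0 ?(mulr_ge0 (ltW cS3) (ltW cS3)) //.
  by rewrite lerXn2r ?nnegrE // (le_trans h0).
have D60 : 0 < (c * S) ^+ 6 / 4 by rewrite divr_gt0 // exprn_gt0.
rewrite cabsM cabsV ler_pdivrMr ?(lt_le_trans D60) //.
apply: le_trans num _.
set p := Num.sqrt M; set q := Num.sqrt N.
have p0 : 0 < p by rewrite sqrtr_gt0; lra.
have q0 : 0 < q by rewrite sqrtr_gt0; lra.
have Mp : M = p ^+ 2 by rewrite sqr_sqrtr //; lra.
have Nq : N = q ^+ 2 by rewrite sqr_sqrtr //; lra.
set Q := 48 * (1 + A ^+ 2) / c ^+ 6 * (M * p)^-1 / (N * q).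
have M0 : 0 < M := lt_le_trans ltr01 M1; have N0 : 0 < N := lt_le_trans ltr01 N1.
have A1 : 0 < 1 + A ^+ 2 by have := sqr_ge0 A; lra.
have Q0 : 0 < Q by rewrite /Q !divr_gt0 ?mulr_gt0 ?exprn_gt0.
apply: (@le_trans _ _ (Q * ((c * S) ^+ 6 / 4))); last by rewrite ler_pM2l.
have -> : Q * ((c * S) ^+ 6 / 4) = 12 * (1 + A ^+ 2) * S ^+ 3 * (S ^+ 3 / (M * p * (N * q))).
  rewrite /Q; field.
  by rewrite !gt_eqF.
rewrite -[leLHS]mulr1 ler_pM2l; last first.
  by rewrite !mulr_gt0 ?exprn_gt0.
rewrite ler_pdivlMr ?mulr_gt0 // mul1r.
(* The remaining inequality is [sqrt (M N) <= M + N], cubed. *)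
have -> : M * p * (N * q) = (p * q) ^+ 3 by rewrite Mp Nq; ring.
rewrite lerXn2r ?nnegrE ?mulr_ge0 ?(ltW p0) ?(ltW q0) ?(ltW S0) //.
by rewrite /S Mp Nq; nra.
Qed.

End EisensteinTransformation.

Section EisensteinLaw.
Variable R : realType.
Notation C := (complex R).
Implicit Types (x y z w q : C).
Local Notation tau := (@ctau R).

Lemma Im_neq0_addn x n : complex.Im x != 0 -> x + n%:R != 0.
Proof.
by apply: contra_neq => e; have := congr1 (@complex.Im R) e; rewrite ImD Im_nat addr0.
Qed.

Lemma Im_neq0_subn x n : complex.Im x != 0 -> x - n%:R != 0.
Proof.
apply: contra_neq => e; have := congr1 (@complex.Im R) e.
by rewrite ImD ImN Im_nat subr0.
Qed.

Lemma cabs_expr_cvg0 q : cabs q < 1 -> ccvg (fun n => q ^+ n) 0.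
Proof.
move=> q1; apply: (@ccvg_squeeze _ _ _ (fun n => cabs q ^+ n) 0%N) => [n _|].
  by rewrite subr0 cabsX.
by apply: cvg_expr; rewrite ger0_norm ?cabs_ge0.
Qed.

Lemma Im_inv_opp z : 0 < complex.Im z -> 0 < complex.Im (- z^-1).
Proof.
move=> z0; rewrite ImN ImV mulNr opprK divr_gt0 // exprn_gt0 // cabs_gt0.
by apply: contraTneq z0 => ->; rewrite ltxx.
Qed.

Lemma Im_neq0 z : 0 < complex.Im z -> z != 0.
Proof. by move=> z0; apply: contraTneq z0 => ->; rewrite ltxx. Qed.

(** Summed over [n], the telescoping part contributes nothing because [n / (x^2 - n^2)] tends to
    0. *)
Lemma Ereg_row z m : 0 < complex.Im z ->
  csum (Ereg z m) (2 * (tau ^+ 2 * hq (qe z ^+ m.+1) - (m.+1%:R * z) ^- 2)).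
Proof.
move=> z0; set x := m.+1%:R * z.
have x0 : complex.Im x != 0 by rewrite ImZn mulf_neq0 ?pnatr_eq0 // gt_eqF.
have h1 := csumZ 2 (csum_pair_center (g := fun y => y ^- 2) (@invsq_nat_cvg0 R) (pf_hq (qe_neq1 x0))).
have h2 : csum (fun n => n.+1%:R / (x ^+ 2 - n.+1%:R ^+ 2) - n%:R / (x ^+ 2 - n%:R ^+ 2)) 0.
  have := ccvgZ (2^-1) (ccvgB (inv_nat_cvg0N x) (inv_nat_cvg0 x)).
  rewrite subr0 mulr0; apply: (@ccvg_eq _ _ _ _ 0%N) => n _; elim: n => [|n IH].
    by rewrite big_ord0 subr0 addr0 subrr mulr0.
  rewrite big_ord_recr /= -IH.
  have E (k : nat) : k%:R / (x ^+ 2 - k%:R ^+ 2) = 2^-1 * ((x - k%:R)^-1 - (x + k%:R)^-1).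
    have a := Im_neq0_addn k x0; have b := Im_neq0_subn k x0.
    have -> : x ^+ 2 - k%:R ^+ 2 = (x - k%:R) * (x + k%:R) by ring.
    by move: a b; move: (k%:R) => v a b; field; rewrite a b.
  by rewrite !E; ring.
have := csumB h1 (csumZ 4 h2); rewrite mulr0 subr0 -qeMn.
exact.
Qed.

(** The column sums of [n / ((M z)^2 - n^2)] over [M >= 1], from the cotangent expansion at [n / z].
    The column [n = 0] is set apart, since the cotangent has a pole there. *)
Definition Gcol z (n : nat) : C :=
  if n == 0%N then 0 else - (2 * z)^-1 * (- (tau / 2) * cq (qe (n%:R / z)) - (n%:R / z)^-1).

Lemma Im_divn z n : 0 < complex.Im z -> complex.Im (n.+1%:R / z) != 0.
Proof.
move=> z0; have := Im_inv_opp z0; rewrite ImN => h.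
by rewrite ImZn mulf_neq0 ?pnatr_eq0 //; apply: contraTneq h => ->; rewrite oppr0 ltxx.
Qed.

Lemma Gcol_sum z n : 0 < complex.Im z ->
  csum (fun m => n%:R / ((m.+1%:R * z) ^+ 2 - n%:R ^+ 2)) (Gcol z n).
Proof.
move=> z0; have zn := Im_neq0 z0; case: n => [|n].
  have := ccvg_cst (0 : C); rewrite /Gcol eqxx; apply: (@ccvg_eq _ _ _ _ 0%N) => n _.
  by rewrite big1 // => i _; rewrite mul0r.
set x := n.+1%:R / z; have x0 : complex.Im x != 0 := Im_divn n z0.
have := csum_pair_center (g := fun y => y^-1) (@inv_nat_cvg0 R) (pf_cq (qe_neq1 x0)).
move/(csumZ (- (2 * z)^-1)); apply: csum_eq => m /=.
have -> : n.+1%:R = x * z by rewrite /x divfK.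
have a := Im_neq0_addn m.+1 x0; have b := Im_neq0_subn m.+1 x0.
have -> : (m.+1%:R * z) ^+ 2 - (x * z) ^+ 2 = - (z ^+ 2 * (x + m.+1%:R) * (x - m.+1%:R)) by ring.
by move: a b; move: (m.+1%:R) => v a b; field; rewrite zn a b.
Qed.

(** Factoring [z] out turns each column into a partial fraction expansion at [n / z]; [hqV] replaces
    [qe (n / z)] by the power of [qe (- 1 / z)], which lies in the unit disc. *)
Lemma Ereg_col z n : 0 < complex.Im z ->
  csum (fun m => Ereg z m n) (2 * z ^- 2 * (tau ^+ 2 * hq (qe (- z^-1) ^+ n.+1)) -
     2 * n.+1%:R ^- 2 - 4 * (Gcol z n.+1 - Gcol z n)).
Proof.
move=> z0; have zn := Im_neq0 z0.
set x := n.+1%:R / z; have x0 : complex.Im x != 0 := Im_divn n z0.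
have h1 := csumZ (2 * z ^- 2) (csum_pair_center (g := fun y => y ^- 2) (@invsq_nat_cvg0 R) (pf_hq (qe_neq1 x0))).
have := csumB h1 (csumZ 4 (csumB (Gcol_sum n.+1 z0) (Gcol_sum n z0))).
have n0 : (n.+1%:R : C) != 0 by rewrite pnatr_eq0.
have -> : qe x = (qe (- z^-1) ^+ n.+1)^-1 by rewrite -qeMn -qeN mulrN opprK.
rewrite hqV; have -> : 2 * z ^- 2 * (tau ^+ 2 * hq (qe (- z^-1) ^+ n.+1) - x ^- 2) =
  2 * z ^- 2 * (tau ^+ 2 * hq (qe (- z^-1) ^+ n.+1)) - 2 * n.+1%:R ^- 2.
  by rewrite /x; move: n0; move: (n.+1%:R) (hq _) => p h p0; field; rewrite p0 zn.
apply: csum_eq => m /=; rewrite /Ereg; congr (_ - _).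
have nE : n.+1%:R = x * z by rewrite /x divfK.
have a := Im_neq0_addn m.+1 x0; have b := Im_neq0_subn m.+1 x0.
have -> : m.+1%:R * z + n.+1%:R = z * (x + m.+1%:R) by rewrite nE; ring.
have -> : m.+1%:R * z - n.+1%:R = - (z * (x - m.+1%:R)) by rewrite nE; ring.
by move: a b; move: (m.+1%:R) => v a b; field; rewrite zn a b.
Qed.

(** As [n] grows, [qe (n / z)] tends to infinity and [cq] to -1. The nonzero limit is what the
    telescoping part leaves when columns are summed, and it becomes the anomaly of [E2]. *)
Lemma Gcol_cvg z : 0 < complex.Im z -> ccvg (Gcol z) (- (tau / (4 * z))).
Proof.
move=> z0; have zn := Im_neq0 z0.
have p1 := cabs_qe_lt1 (Im_inv_opp z0).
have c1 := cabs_expr_cvg0 p1; set p := qe (- z^-1) in p1 c1.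
have c2 : ccvg (fun n => (p ^+ n + 1) / (p ^+ n - 1)) ((0 + 1) / (0 - 1)).
  apply: ccvgM; first by apply: ccvgD => //; exact: ccvg_cst.
  apply: ccvgV; first by rewrite sub0r oppr_eq0 oner_eq0.
  by apply: ccvgB => //; exact: ccvg_cst.
have c3 := ccvgZ z (inv_nat_cvg0 (0 : C)).
have := ccvgZ (- (2 * z)^-1) (ccvgB (ccvgZ (- (tau / 2)) c2) c3).
have -> : - (2 * z)^-1 * (- (tau / 2) * ((0 + 1) / (0 - 1)) - z * 0) = - (tau / (4 * z)).
  by field.
apply: (@ccvg_eq _ _ _ _ 1%N) => -[//|n] _; rewrite /Gcol /= add0r invf_div.
congr (_ * (_ * _ - _)).
have -> : qe (n.+1%:R / z) = (p ^+ n.+1)^-1 by rewrite -qeMn -qeN mulrN opprK.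
have pn0 : p ^+ n.+1 != 0 by rewrite expf_neq0 // qe_neq0.
have pn1 : p ^+ n.+1 != 1.
  by apply/eqP => e; have := cabsX p n.+1; rewrite e cabs1 => /esym/eqP;
     rewrite lt_eqF // exprn_ilt1 // cabs_ge0.
have d1 : p ^+ n.+1 - 1 != 0 by rewrite subr_eq0.
rewrite /cq; move: pn0 d1; move: (p ^+ n.+1) => v v0 v1.
have -> : 1 - v^-1 = (v - 1) / v by field.
by field; rewrite v0 v1.
Qed.

(* The quasi-modularity of [E2 = 1 - 24 P]: the anomaly [12 / (tau z)] is the
   difference between the two orders of summation over the lattice. *)
Lemma Psum_inv z : 0 < complex.Im z ->
  1 - 24 * Psum z + 12 / (tau * z) = z ^- 2 * (1 - 24 * Psum (- z^-1)).
Proof.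
move=> z0; have zn := Im_neq0 z0; have tn := ctau_neq0 R.
have [K K0 hK] := Ereg_le z0.
have rows : csum (fun m => 2 * (tau ^+ 2 * hq (qe z ^+ m.+1) - (m.+1%:R * z) ^- 2))
    (2 * (tau ^+ 2 * Psum z - z ^- 2 * (- tau ^+ 2 / 24))).
  have := csumZ 2 (csumB (csumZ (tau ^+ 2) (PsumP z0)) (csumZ (z ^- 2) (@zeta2 R))).
  apply: csum_eq => m /=; congr (_ * (_ - _)).
  by rewrite [in RHS]exprMn [in RHS]invfM mulrC.
have cols : csum (fun n => 2 * z ^- 2 * (tau ^+ 2 * hq (qe (- z^-1) ^+ n.+1)) -
     2 * n.+1%:R ^- 2 - 4 * (Gcol z n.+1 - Gcol z n))
    (2 * z ^- 2 * (tau ^+ 2 * Psum (- z^-1)) - 2 * (- tau ^+ 2 / 24) - 4 * (- (tau / (4 * z)))).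
  apply: csumB.
    apply: csumB; last exact: csumZ (@zeta2 R).
    by apply: csumZ; apply: csumZ; apply: PsumP; exact: Im_inv_opp.
  apply: csumZ; apply: (ccvg_eq (N0 := 0%N)) (Gcol_cvg z0) => n _.
  elim: n => [|n IH]; first by rewrite big_ord0.
  by rewrite big_ord_recr /= -IH addrC subrK.
have bs := bser_inv_sqrt3 R.
have := csum_swap (bserZ K0 bs) bs hK (fun m => Ereg_row m z0) (fun n => Ereg_col n z0) rows.
move=> /(csum_unique cols) e.
have e' : 12 / tau ^+ 2 * (2 * (tau ^+ 2 * Psum z - z ^- 2 * (- tau ^+ 2 / 24))) =
  12 / tau ^+ 2 * (2 * z ^- 2 * (tau ^+ 2 * Psum (- z^-1)) - 2 * (- tau ^+ 2 / 24) -
    4 * (- (tau / (4 * z)))) by rewrite e.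
have e2 : 12 / tau ^+ 2 * (2 * (tau ^+ 2 * Psum z - z ^- 2 * (- tau ^+ 2 / 24))) =
   24 * Psum z + z ^- 2 by field; rewrite tn zn.
have e3 : 12 / tau ^+ 2 * (2 * z ^- 2 * (tau ^+ 2 * Psum (- z^-1)) - 2 * (- tau ^+ 2 / 24) -
    4 * (- (tau / (4 * z)))) = 24 * z ^- 2 * Psum (- z^-1) + 1 + 12 / (tau * z).
  by field; rewrite tn zn.
move: e'; rewrite e2 e3 => e'.
have -> : 1 - 24 * Psum z + 12 / (tau * z) = 1 + 12 / (tau * z) + z ^- 2 - (24 * Psum z + z ^- 2).
  by ring.
by rewrite e'; ring.
Qed.

End EisensteinLaw.

(** * Series in [q] on the half-plane and their termwise derivatives *)

Section EulerProduct.
Variable R : realType.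
Notation C := (complex R).
Implicit Types (x y z w q : C).
Local Notation tau := (@ctau R).

(** Radius of convergence at least 1, in the form given by Cauchy's inequalities. *)
Definition adm (a : nat -> C) := forall r : R, 0 <= r < 1 ->
  exists B : R, forall k, cabs (a k) * r ^+ k <= B.

Lemma adm_bser (a : nat -> C) (r : R) : adm a -> 0 <= r < 1 ->
  bser (fun k => cabs (a k) * r ^+ k).
Proof.
move=> ha /andP[r0 r1]; pose s := (1 + r) / 2.
have s0 : 0 < s by rewrite /s; lra.
have s1 : 0 <= s < 1 by rewrite /s; apply/andP; split; lra.
have [B hB] := ha s s1.
have rs : 0 <= r / s < 1.
  by rewrite divr_ge0 ?(ltW s0) //= ltr_pdivrMr // /s; lra.
have B0 : 0 <= B by apply: le_trans (hB 0%N); rewrite expr0 mulr1 cabs_ge0.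
apply: bser_le (bserZ B0 (bser_geom rs)) => k.
rewrite mulr_ge0 ?cabs_ge0 ?exprn_ge0 //=.
have := ler_wpM2r (exprn_ge0 k (andP rs).1) (hB k); apply: le_trans.
by rewrite -mulrA -exprMn mulrCA divff ?gt_eqF // mulr1.
Qed.

(** Each of [1, s, ..., s^k] is at least [s^k], and their sum is below [1 / (1 - s)]. *)
Lemma natr_geom_le (s : R) k : 0 <= s < 1 -> k.+1%:R * s ^+ k <= (1 - s)^-1.
Proof.
move=> /andP[s0 s1]; have d0 : 0 < 1 - s by rewrite subr_gt0.
rewrite -[leRHS]mul1r ler_pdivlMr //.
suff : k.+1%:R * s ^+ k * (1 - s) <= 1 - s ^+ k.+1 by have := exprn_ge0 k.+1 s0; lra.
elim: k => [|k IH]; first by rewrite !mul1r expr1.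
have p1 : s ^+ k.+1 <= 1 by rewrite exprn_ile1 // ltW.
move: IH p1; rewrite -(natr1 k.+1) !exprS; move: (s ^+ k) (k.+1%:R) => t n IH p1.
have h1 := ler_wpM2l s0 IH; have h2 := ler_wpM2l (ltW d0) p1; lra.
Qed.

Lemma adm_natr (a : nat -> C) : adm a -> adm (fun k => k.+1%:R * a k).
Proof.
move=> ha r /andP[r0 r1]; pose s := (1 + r) / 2.
have s0 : 0 < s by rewrite /s; lra.
have s1 : 0 <= s < 1 by rewrite /s; apply/andP; split; lra.
have [B hB] := ha s s1.
have rs : 0 <= r / s < 1.
  by rewrite divr_ge0 ?(ltW s0) //= ltr_pdivrMr // /s; lra.
exists (B * (1 - r / s)^-1) => k; rewrite cabsM cabs_nat.
have -> : k.+1%:R * cabs (a k) * r ^+ k = (cabs (a k) * s ^+ k) * (k.+1%:R * (r / s) ^+ k).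
  have : s ^+ k != 0 by rewrite expf_neq0 // gt_eqF.
  by rewrite (expr_div_n r s); move: (s ^+ k) (r ^+ k) => t u t0; field.
apply: ler_pM => //; last exact: natr_geom_le.
  by rewrite mulr_ge0 ?cabs_ge0 // exprn_ge0 // ltW.
by rewrite mulr_ge0 // exprn_ge0 // (andP rs).1.
Qed.

Lemma adm_le (a b : nat -> C) (K : R) : 0 <= K ->
  (forall k, cabs (b k) <= K * cabs (a k)) -> adm a -> adm b.
Proof.
move=> K0 h ha r hr; have [B hB] := ha r hr; exists (K * B) => k.
apply: (@le_trans _ _ (K * cabs (a k) * r ^+ k)).
  by rewrite ler_wpM2r // exprn_ge0 // (andP hr).1.
by rewrite -mulrA ler_wpM2l.
Qed.

(** The coefficient [a k] multiplies [q^(k+1)]: all these series vanish at infinity and can be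
    integrated termwise. *)
Definition qser (a : nat -> C) z := csumv (fun k => a k * qe z ^+ k.+1).

Lemma qser_bser a z : adm a -> 0 < complex.Im z ->
  bser (fun k => cabs (a k * qe z ^+ k.+1)).
Proof.
move=> ha /cabs_qe_lt1 q1; set r := cabs (qe z) in q1.
have r0 : 0 <= r by exact: cabs_ge0.
have hr : 0 <= r < 1 by rewrite r0.
apply: bser_le (adm_bser ha hr) => k; rewrite cabs_ge0 cabsM cabsX -/r /=.
by rewrite ler_wpM2l ?cabs_ge0 // exprS ler_piMl ?exprn_ge0 // ltW.
Qed.

Lemma qserP a z : adm a -> 0 < complex.Im z ->
  csum (fun k => a k * qe z ^+ k.+1) (qser a z).
Proof. by move=> ha z0; apply: csumvP; exact: qser_bser. Qed.

(** Termwise Taylor expansion with step [n h]. For [|h| < y / 2] the factor [exp(2 pi n |h|)] costs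
    at most half of the decay of [|q|^n], so the remainders are dominated by [n^2 |a_k| rho^k] with
    [rho = exp(- pi y) < 1]. *)
Lemma cderiv_qser a z : adm a -> 0 < complex.Im z ->
  cderiv (qser a) z (tau * qser (fun k => k.+1%:R * a k) z).
Proof.
move=> ha z0; set y := complex.Im z in z0.
have ha1 := adm_natr ha; have ha2 := adm_natr ha1.
pose rho := expR (- (pi * y)).
have rho0 : 0 <= rho := expR_ge0 _.
have rho1 : 0 <= rho < 1.
  by rewrite rho0 /= -[X in _ < X]expR0 ltr_expR oppr_lt0 mulr_gt0 // pi_gt0.
have [_ [B hB]] := adm_bser ha2 rho1.
set s := 2 * pi : R; have s0 : 0 <= s by rewrite mulr_ge0 // pi_ge0.
apply: (@cderiv_quad _ _ _ _ (y / 2) (4 * s ^+ 2 * B)); first by rewrite divr_gt0.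
move=> h hh.
have zh : 0 < complex.Im (z + h).
  rewrite ImD -/y; have := cabs_Im h; have := ler_norm (- complex.Im h).
  by rewrite normrN; lra.
have := csumB (csumB (qserP ha zh) (qserP ha z0)) (csumZ (tau * h) (qserP ha1 z0)).
have -> : tau * h * qser (fun k => k.+1%:R * a k) z = tau * qser (fun k => k.+1%:R * a k) z * h by ring.
pose b (k : nat) := 4 * s ^+ 2 * cabs h ^+ 2 * (cabs (k.+1%:R * (k.+1%:R * a k)) * rho ^+ k).
move=> hs; apply: (csum_cabs_le (b := b) hs); last first.
  move=> n; rewrite /b -mulr_sumr [leRHS]mulrAC ler_wpM2l ?hB //.
  by rewrite mulr_ge0 ?sqr_ge0 // mulr_ge0 // sqr_ge0.
move=> k; set n := k.+1; set q := qe z.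
have -> : a k * qe (z + h) ^+ n - a k * q ^+ n - tau * h * (n%:R * a k * q ^+ n) =
  a k * q ^+ n * (qe (n%:R * h) - 1 - tau * (n%:R * h)).
  by rewrite qeD exprMn qeMn -/q; ring.
rewrite !cabsM cabsX.
have t := qe_taylor1 (n%:R * h); rewrite cabsM cabs_nat -/s in t.
have e1 : cabs q ^+ n * expR (s * (n%:R * cabs h)) <= rho ^+ k.
  rewrite /q cabs_qe -/s -expRM_natl -expRD.
  apply: (@le_trans _ _ (rho ^+ n)); last first.
    by rewrite exprS ler_piMl ?exprn_ge0 // ltW // (andP rho1).2.
  rewrite /rho -expRM_natl ler_expR -/y.
  have -> : n%:R * - (s * y) + s * (n%:R * cabs h) = n%:R * (- (s * y) + s * cabs h).
    by ring.
  rewrite ler_wpM2l //; have : s * cabs h <= s * (y / 2) by rewrite ler_wpM2l // ltW.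
  by rewrite /s; lra.
apply: (@le_trans _ _ (cabs (a k) * cabs q ^+ n * (4 * (s * (n%:R * cabs h)) ^+ 2 * expR (s * (n%:R * cabs h))))).
  by rewrite ler_wpM2l // mulr_ge0 ?cabs_ge0 // exprn_ge0 // cabs_ge0.
rewrite /b !cabsM cabs_nat -/n.
have -> : cabs (a k) * cabs q ^+ n * (4 * (s * (n%:R * cabs h)) ^+ 2 * expR (s * (n%:R * cabs h))) =
  4 * s ^+ 2 * cabs h ^+ 2 * (n%:R * (n%:R * cabs (a k)) * (cabs q ^+ n * expR (s * (n%:R * cabs h)))).
  by ring.
apply: ler_wpM2l; first by rewrite mulr_ge0 ?sqr_ge0 // mulr_ge0 // sqr_ge0.
by apply: ler_wpM2l => //; rewrite mulr_ge0 // mulr_ge0 // cabs_ge0.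
Qed.

End EulerProduct.

(** * Coefficients of powers of the Euler product *)

Section EulerSeries.
Variable R : realType.
Notation C := (complex R).
Implicit Types (x y z w q : C).
Local Notation tau := (@ctau R).
Variable e : nat.

(** Truncated product with a sign parameter: [-1] gives the Euler product, [1] a product that
    dominates it coefficientwise. *)
Definition eulp (S : nzRingType) (sg : S) (N : nat) : {poly S} :=
  \prod_(n < N) (1 + sg *: 'X^(n.+1)) ^+ e.

(** Factors beyond the [k]-th leave the coefficient of degree [k] unchanged, so the truncation at
    [k] already gives it. *)
Definition eulc (k : nat) : C := (eulp (-1 : C) k)`_k.

Lemma eulpS (S : nzRingType) (sg : S) N :
  eulp sg N.+1 = eulp sg N * (1 + sg *: 'X^(N.+1)) ^+ e.
Proof. by rewrite /eulp big_ord_recr. Qed.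

Lemma eulp_stable N k : (k <= N)%N -> (eulp (-1 : C) N)`_k = eulc k.
Proof.
rewrite /eulc; elim: N => [|N IH]; first by rewrite leqn0 => /eqP ->.
rewrite leq_eqVlt => /orP[/eqP -> //|]; rewrite ltnS => kN.
rewrite -(IH kN) eulpS.
have [r ->] : exists r : {poly C}, (1 + (-1) *: 'X^(N.+1)) ^+ e = 1 + 'X^(N.+1) * r.
  elim: e => [|m [r Hr]]; first by exists 0; rewrite mulr0 addr0 expr0.
  exists (r - 1 + (-1) *: ('X^(N.+1) * r)); rewrite exprS Hr !scaleN1r; ring.
by rewrite mulrDr mulr1 coefD mulrCA coefXnM ltnS kN addr0.
Qed.

Definition pdom (P : {poly C}) (A : {poly R}) := forall k, cabs P`_k <= A`_k.

Lemma pdomM P Q A B : pdom P A -> pdom Q B -> pdom (P * Q) (A * B).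
Proof.
move=> hA hB k; rewrite !coefM; apply: le_trans (cabs_sum _ _ _) _.
by apply: ler_sum => i _; rewrite cabsM ler_pM ?cabs_ge0.
Qed.

Lemma pdomX P A n : pdom P A -> pdom (P ^+ n) (A ^+ n).
Proof.
move=> h; elim: n => [|n IH]; last by rewrite !exprS; apply: pdomM.
by move=> k; rewrite !expr0 !coef1 cabs_nat.
Qed.

Lemma pdom_eulp N : pdom (eulp (-1 : C) N) (eulp (1 : R) N).
Proof.
elim: N => [|N IH]; first by move=> k; rewrite /eulp !big_ord0 !coef1 cabs_nat.
rewrite !eulpS; apply: pdomM => //; apply: pdomX => k.
rewrite !coefD !coefZ !coef1 !coefXn; apply: le_trans (cabsD _ _) _.
by rewrite cabsM cabsN cabs1 !cabs_nat.
Qed.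

Lemma coef_horner_le (A : {poly R}) (r : R) k : 0 <= r -> (forall i, 0 <= A`_i) ->
  A`_k * r ^+ k <= A.[r].
Proof.
move=> r0 hA; rewrite horner_coef; case: (ltnP k (size A)) => h; last first.
  by rewrite nth_default // mul0r sumr_ge0 // => i _; rewrite mulr_ge0 ?exprn_ge0.
rewrite (bigD1 (Ordinal h)) //= lerDl sumr_ge0 // => i _.
by rewrite mulr_ge0 ?exprn_ge0.
Qed.

(** The inequality [1 + x <= expR x] bounds the product by the exponential of a geometric series,
    uniformly in [N]. *)
Lemma eulp_horner_le (r : R) N : 0 <= r < 1 ->
  (eulp (1 : R) N).[r] <= expR (e%:R * (r / (1 - r))).
Proof.
move=> /andP[r0 r1]; have d0 : 0 < 1 - r by rewrite subr_gt0.
have h : (eulp (1 : R) N).[r] <= expR (e%:R * \sum_(n < N) r ^+ n.+1).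
  elim: N => [|N IH]; first by rewrite /eulp !big_ord0 hornerC mulr0 expR0.
  rewrite eulpS hornerM big_ord_recr /= mulrDr expRD horner_exp.
  rewrite hornerD hornerZ hornerXn hornerC mul1r.
  have p1 : 0 <= r ^+ N.+1 := exprn_ge0 _ r0.
  apply: ler_pM => //.
  - by rewrite /eulp horner_prod prodr_ge0 // => i _;
      rewrite horner_exp hornerD hornerZ hornerXn hornerC mul1r exprn_ge0 // addr_ge0 // exprn_ge0.
  - by rewrite exprn_ge0 // addr_ge0.
  - rewrite expRM_natl lerXn2r ?nnegrE ?expR_ge0 ?addr_ge0 //.
    exact: expR_ge1Dx.
apply: le_trans h _; rewrite ler_expR ler_wpM2l //.
have -> : \sum_(n < N) r ^+ n.+1 = r * \sum_(n < N) r ^+ n.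
  by rewrite mulr_sumr; apply: eq_bigr => i _; rewrite exprS.
rewrite ler_wpM2l //.
have -> : \sum_(i < N) r ^+ i = (1 - r ^+ N) / (1 - r).
  elim: N => [|n IH]; first by rewrite big_ord0 expr0 subrr mul0r.
  by rewrite big_ord_recr /= IH exprS; field; rewrite gt_eqF.
by rewrite ler_pdivrMr // mulVf ?gt_eqF // gerBl exprn_ge0.
Qed.

Lemma eulp_coef_le (r : R) N k : 0 <= r < 1 ->
  cabs (eulp (-1 : C) N)`_k * r ^+ k <= expR (e%:R * (r / (1 - r))).
Proof.
move=> hr; have /andP[r0 r1] := hr; apply: le_trans (eulp_horner_le N hr).
apply: le_trans (coef_horner_le k r0 _); last first.
  by move=> i; apply: le_trans (cabs_ge0 _) (pdom_eulp N i).
by rewrite ler_wpM2r ?exprn_ge0 // pdom_eulp.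
Qed.

Lemma adm_eulc : adm eulc.
Proof.
move=> r hr; exists (expR (e%:R * (r / (1 - r)))) => k.
exact: eulp_coef_le.
Qed.

(* [f] ranges over coefficientwise multipliers, e.g. those of differentiation. *)
Lemma eulp_cvg (f : nat -> C) q : (forall k, cabs (f k) <= k.+1%:R) -> cabs q < 1 ->
  csum (fun k => f k * eulc k * q ^+ k) (csumv (fun k => f k * eulc k * q ^+ k)) /\
  ccvg (fun N => \sum_(k < maxn N (size (eulp (-1 : C) N))) f k * (eulp (-1 : C) N)`_k * q ^+ k)
    (csumv (fun k => f k * eulc k * q ^+ k)).
Proof.
move=> hf q1; set r := cabs q in q1; have r0 : 0 <= r := cabs_ge0 _.
pose s := (1 + r) / 2; have s0 : 0 < s by rewrite /s; lra.
have s1 : 0 <= s < 1 by rewrite /s; apply/andP; split; lra.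
have rs : 0 <= r / s < 1.
  by rewrite divr_ge0 ?(ltW s0) //= ltr_pdivrMr // /s; lra.
set B := expR (e%:R * (s / (1 - s))).
pose a := (fun k => ((r / s) ^+ k)%:C) : nat -> C.
have aE k : cabs (a k) = (r / s) ^+ k by rewrite cabs_real ger0_norm ?exprn_ge0 // (andP rs).1.
pose u := (1 + r / s) / 2.
have hu : 0 <= u < 1.
  by have /andP[a1 a2] := rs; rewrite /u; apply/andP; split; lra.
have u0 : 0 < u by have /andP[a1 a2] := rs; rewrite /u; lra.
have ru : 0 <= (r / s) / u < 1.
  have /andP[a1 a2] := rs.
  by rewrite divr_ge0 ?(ltW u0) //= ltr_pdivrMr // /u; lra.
have bs : bser (fun k => B * (1 - u)^-1 * ((r / s) / u) ^+ k).
  apply: bserZ (bser_geom ru); rewrite mulr_ge0 ?expR_ge0 // invr_ge0.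
  by case/andP: hu => _ /ltW; rewrite subr_ge0.
have [|| |vb lim] := @tannery R (fun k => B * (1 - u)^-1 * ((r / s) / u) ^+ k)
  (fun N k => f k * (eulp (-1 : C) N)`_k * q ^+ k) (fun k => f k * eulc k * q ^+ k)
  (fun N => maxn N (size (eulp (-1 : C) N))) 0%N bs.
- move=> N k _ _; rewrite !cabsM cabsX -/r.
  have h1 := eulp_coef_le N k s1; rewrite -/B in h1.
  have h2 := natr_geom_le k hu.
  have us : 0 < u ^+ k by rewrite exprn_gt0.
  have ss : 0 < s ^+ k by rewrite exprn_gt0.
  have rr : 0 <= r ^+ k by rewrite exprn_ge0.
  apply: (@le_trans _ _ ((k.+1%:R * u ^+ k) * (cabs (eulp (-1 : C) N)`_k * s ^+ k) * ((r / s) / u) ^+ k)).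
    rewrite (expr_div_n (r / s) u) (expr_div_n r s).
    have -> : k.+1%:R * u ^+ k * (cabs (eulp (-1 : C) N)`_k * s ^+ k) * (r ^+ k / s ^+ k / u ^+ k) =
      k.+1%:R * cabs (eulp (-1 : C) N)`_k * r ^+ k.
      by move: us ss; move: (u ^+ k) (s ^+ k) => U V U0 V0; field; rewrite !gt_eqF.
    by rewrite ler_wpM2r // ler_wpM2r ?cabs_ge0.
  rewrite ler_wpM2r ?exprn_ge0 ?(andP ru).1 // mulrC.
  by apply: ler_pM => //; rewrite mulr_ge0 ?cabs_ge0 // ltW.
- move=> k; apply: (ccvg_eq (N0 := k) _ (ccvg_cst _)) => N kN.
  by rewrite eulp_stable.
- by move=> K; exists K => n Kn; rewrite leq_max Kn.
by split => //; apply: csumvP; exact: bser_cabs_le bs vb.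
Qed.

Lemma horner_wide (P : {poly C}) q N :
  P.[q] = \sum_(k < maxn N (size P)) P`_k * q ^+ k.
Proof. by rewrite (horner_coef_wide q (leq_maxr N _)). Qed.

Definition Eul q : C := csumv (fun k => eulc k * q ^+ k).

Lemma EulP q : cabs q < 1 -> csum (fun k => eulc k * q ^+ k) (Eul q).
Proof.
move=> q1; have h (k : nat) : cabs (1 : C) <= k.+1%:R :> R by rewrite cabs1 ler1n.
have [+ _] := eulp_cvg h q1.
by rewrite /Eul (_ : (fun k => 1 * eulc k * q ^+ k) = (fun k => eulc k * q ^+ k)) //;
   apply/funext => k; rewrite mul1r.
Qed.

Lemma eulp_horner q N : (eulp (-1 : C) N).[q] = \prod_(n < N) (1 - q ^+ n.+1) ^+ e.
Proof.
rewrite /eulp horner_prod; apply: eq_bigr => i _.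
by rewrite horner_exp hornerD hornerZ hornerXn hornerC mulN1r.
Qed.

Lemma Eul_cvg q : cabs q < 1 -> ccvg (fun N => \prod_(n < N) (1 - q ^+ n.+1) ^+ e) (Eul q).
Proof.
move=> q1; have h (k : nat) : cabs (1 : C) <= k.+1%:R :> R by rewrite cabs1 ler1n.
have [_ +] := eulp_cvg h q1.
rewrite (_ : (fun k => 1 * eulc k * q ^+ k) = (fun k => eulc k * q ^+ k)); last first.
  by apply/funext => k; rewrite mul1r.
apply: (@ccvg_eq _ _ _ _ 0%N) => N _; rewrite -eulp_horner (horner_wide _ q N).
by apply: eq_bigr => k _; rewrite mul1r.
Qed.

(** The logarithmic derivative of [q] times the finite product; for [e = 24] its limit is [E2] by
    the Lambert series. *)
Lemma eulp_deriv q N : cabs q < 1 ->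
  ('X * eulp (-1 : C) N)^`().[q] = (eulp (-1 : C) N).[q] *
    (1 - e%:R * \sum_(n < N) n.+1%:R * q ^+ n.+1 / (1 - q ^+ n.+1)).
Proof.
move=> q1; suff H : q * (eulp (-1 : C) N)^`().[q] = (eulp (-1 : C) N).[q] *
    (- e%:R * \sum_(n < N) n.+1%:R * q ^+ n.+1 / (1 - q ^+ n.+1)).
  by rewrite derivM derivX mul1r hornerD hornerM hornerX H; ring.
elim: N => [|N IH].
  by rewrite /eulp !big_ord0 mulr0 mulr0 derivC hornerC mulr0.
rewrite eulpS derivM hornerD !hornerM mulrDr mulrA IH big_ord_recr /=.
set S := \sum_(i < N) _; set P := (eulp _ N).[q].
have d0 : 1 - q ^+ N.+1 != 0.
  rewrite subr_eq0; apply/eqP => h; have := cabsX q N.+1; rewrite -h cabs1 => /esym/eqP.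
  by rewrite lt_eqF // exprn_ilt1 // cabs_ge0.
rewrite deriv_exp hornerMn hornerM !horner_exp !derivD !derivZ derivXn derivC add0r.
rewrite !hornerD !hornerZ hornerMn !hornerXn !hornerC /= !mulN1r.
(* Stated with the factor [m] so that it also holds for [m = 0], where the predecessor is
   truncated. *)
have EF (m : nat) (t : C) : m%:R * t ^+ m = m%:R * (t * t ^+ m.-1).
  by case: m => [|m]; rewrite ?mul0r // -exprS.
have := EF e (1 - q ^+ N.+1).
rewrite -[q ^+ N *+ _]mulr_natl -[(_ * _) *+ e]mulr_natl; set x := q ^+ N.+1; set F := (1 - x) ^+ e.-1; set E := (1 - x) ^+ e => HE.
have -> : P * E * (- e%:R * (S + N.+1%:R * x / (1 - x))) =
  - P * (e%:R * E) * S - P * (e%:R * E) * (N.+1%:R * x / (1 - x)) by ring.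
rewrite [X in _ - P * X * _]HE.
have -> : P * (e%:R * ((1 - x) * F)) * (N.+1%:R * x / (1 - x)) = P * e%:R * F * (N.+1%:R * x).
  by field.
by rewrite /x exprS; ring.
Qed.

End EulerSeries.

(** * The derivative of [Delta] and its modularity *)

Section DiscriminantModular.
Variable R : realType.
Notation C := (complex R).
Implicit Types (x y z w q : C).
Local Notation tau := (@ctau R).

Lemma csum_geom q : cabs q < 1 -> csum (fun n => q ^+ n) (1 - q)^-1.
Proof.
move=> q1; have d0 : 1 - q != 0.
  by apply: contraTneq q1 => /eqP; rewrite subr_eq0 => /eqP <-; rewrite cabs1 ltxx.
have := ccvgM (ccvgB (ccvg_cst 1) (cabs_expr_cvg0 q1)) (ccvg_cst (1 - q)^-1).
rewrite subr0 mul1r; apply: (@ccvg_eq _ _ _ _ 0%N) => n _.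
elim: n => [|n IH]; first by rewrite big_ord0 expr0 subrr mul0r.
by rewrite big_ord_recr /= -IH exprS; field.
Qed.

Lemma bser_natr_geom (r : R) : 0 <= r < 1 -> bser (fun n => n.+1%:R * r ^+ n.+1).
Proof.
move=> hr; have ha : adm (fun _ : nat => 1 : C).
  by move=> s /andP[s0 s1]; exists 1 => k; rewrite cabs1 mul1r exprn_ile1 // ltW.
have /andP[r0 r1] := hr.
apply: bser_le (adm_bser (adm_natr ha) hr) => n.
rewrite mulr_ge0 ?exprn_ge0 //= mulr1 cabs_nat ler_wpM2l //.
by rewrite exprS ler_piMl ?exprn_ge0 // ltW.
Qed.

Lemma csum_natr_geom q : cabs q < 1 -> csum (fun n => n.+1%:R * q ^+ n.+1) (hq q).
Proof.
move=> q1; have d0 : 1 - q != 0.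
  by apply: contraTneq q1 => /eqP; rewrite subr_eq0 => /eqP <-; rewrite cabs1 ltxx.
have hr : 0 <= cabs q < 1 by rewrite cabs_ge0.
have bs : bser (fun n => cabs (n.+1%:R * q ^+ n.+1)).
  by apply: bser_le (bser_natr_geom hr) => n; rewrite cabs_ge0 cabsM cabs_nat cabsX lexx.
have t0 : ccvg (fun n => n.+1%:R * q ^+ n.+1) 0.
  by apply: (ccvg_squeeze (N0 := 0%N) _ (bser_cvg0 bs)) => n _; rewrite subr0.
have t1 : ccvg (fun n => n%:R * q ^+ n) 0 by apply/ccvgS.
have := ccvgM (ccvgB (ccvgZ q (ccvgB (ccvg_cst 1) (cabs_expr_cvg0 q1)))
   (ccvgZ ((1 - q) * q) t1)) (ccvg_cst ((1 - q) ^- 2)).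
rewrite subr0 mulr1 mulr0 subr0 -/(hq q); apply: (@ccvg_eq _ _ _ _ 0%N) => n _.
elim: n => [|n IH].
  by rewrite big_ord0 expr0 subrr !mul0r !mulr0 subrr mul0r.
by rewrite big_ord_recr /= -IH -(natr1 n) exprS; field.
Qed.

(** Both series are the double series of [n q^(m n)], summed in two orders;
    [(m + 1)(n + 1) >= m + (n + 1)] supplies the product majorant. *)
Lemma Lambert z : 0 < complex.Im z ->
  csum (fun n => n.+1%:R * qe z ^+ n.+1 / (1 - qe z ^+ n.+1)) (Psum z).
Proof.
move=> z0; have q1 := cabs_qe_lt1 z0; set q := qe z in q1 *.
have hr : 0 <= cabs q < 1 by rewrite cabs_ge0.
have qn n : cabs (q ^+ n.+1) < 1 by rewrite cabsX exprn_ilt1 // cabs_ge0.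
apply: (@csum_swap _ _ _ (fun m n => n.+1%:R * q ^+ (m.+1 * n.+1)) _ _ _
  (bser_geom hr) (bser_natr_geom hr) _ _ _ (PsumP z0)).
- move=> m n; rewrite cabsM cabs_nat cabsX mulrCA ler_wpM2l // -exprD.
  rewrite -(subnK (_ : (m + n.+1 <= m.+1 * n.+1)%N)); last by rewrite mulSn addnC leq_add2l leq_pmulr.
  by rewrite exprD ler_piMl ?exprn_ge0 ?cabs_ge0 // exprn_ile1 ?cabs_ge0 // ltW.
- move=> m; have := csum_natr_geom (qn m); apply: csum_eq => n.
  by rewrite -exprM.
- move=> n; have := csumZ (n.+1%:R * q ^+ n.+1) (csum_geom (qn n)).
  by apply: csum_eq => m /=; rewrite -mulrA -exprM -exprD mulnC mulSn.
Qed.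

Definition Del z : C := qser (eulc R 24) z.

Lemma DelE z : 0 < complex.Im z -> Del z = qe z * Eul 24 (qe z).
Proof.
move=> z0; apply: (csum_unique (qserP (@adm_eulc R 24) z0)).
have := csumZ (qe z) (EulP 24 (cabs_qe_lt1 z0)); apply: csum_eq => k /=.
by rewrite exprS mulrCA.
Qed.

(** The partial products have a common positive lower bound: [1 - y >= exp(- y / (1 - y))], and the
    exponents sum to a geometric series. *)
Lemma Eul_neq0 e q : cabs q < 1 -> Eul e q != 0.
Proof.
move=> q1; set r := cabs q in q1; have r0 : 0 <= r := cabs_ge0 _.
have d0 : 0 < 1 - r by rewrite subr_gt0.
have hr : 0 <= r < 1 by rewrite r0.
have [b0 [B hB]] := bser_geom hr.
have low n : expR (- (e%:R * (B / (1 - r)))) <= cabs (\prod_(i < n) (1 - q ^+ i.+1) ^+ e).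
  apply: (@le_trans _ _ (expR (- (e%:R * \sum_(i < n) r ^+ i.+1 / (1 - r))))).
    rewrite ler_expR lerN2 ler_wpM2l // -mulr_suml ler_pM2r ?invr_gt0 //.
    apply: le_trans (hB n); apply: ler_sum => i _.
    by rewrite exprS ler_piMl ?exprn_ge0 // ltW.
  elim: n => [|n IH]; first by rewrite !big_ord0 mulr0 oppr0 expR0 cabs1.
  rewrite !big_ord_recr /= mulrDr opprD expRD cabsM ler_pM ?expR_ge0 //.
  rewrite -mulrN expRM_natl cabsX lerXn2r ?nnegrE ?expR_ge0 ?cabs_ge0 //.
  set y := r ^+ n.+1.
  have y1 : y <= r by rewrite /y exprS ler_piMr // exprn_ile1 // ltW.
  have y0 : 0 <= y by rewrite exprn_ge0.
  have : 1 - y <= cabs (1 - q ^+ n.+1) by have := cabsB_ge 1 (q ^+ n.+1); rewrite cabs1 cabsX.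
  apply: le_trans; rewrite expRN -[leRHS]invrK lef_pV2 ?posrE ?expR_gt0 ?invr_gt0 ?subr_gt0 ?(le_lt_trans y1) //.
  apply: le_trans (expR_ge1Dx _).
  have -> : (1 - y)^-1 = 1 + y / (1 - y) by field; lra.
  by rewrite lerD2l ler_wpM2l // lef_pV2 ?posrE //; lra.
apply/eqP => E0; have := Eul_cvg e q1; rewrite E0 => lim.
have [N hN] := ccvg_lt lim (expR_gt0 (- (e%:R * (B / (1 - r))))).
by have := hN N (leqnn N); rewrite subr0 ltNge low.
Qed.

Lemma Del_neq0 z : 0 < complex.Im z -> Del z != 0.
Proof. by move=> z0; rewrite DelE // mulf_neq0 ?qe_neq0 // Eul_neq0 // cabs_qe_lt1. Qed.

(** The identity [eulp_deriv] passes to the limit: [Delta' = 2 pi i E2 Delta]. *)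
Lemma cderiv_Del z : 0 < complex.Im z ->
  cderiv Del z (tau * (Del z * (1 - 24 * Psum z))).
Proof.
move=> z0; have q1 := cabs_qe_lt1 z0; have ha := @adm_eulc R 24.
apply: cderiv_eq (cderiv_qser ha z0); congr (_ * _).
apply: (csum_unique (qserP (adm_natr ha) z0)).
set q := qe z in q1 *.
have hf (k : nat) : cabs (k.+1%:R : C) <= k.+1%:R by rewrite cabs_nat.
have [s1 s2] := eulp_cvg 24 hf q1.
have -> : Del z * (1 - 24 * Psum z) = q * csumv (fun k => k.+1%:R * eulc R 24 k * q ^+ k).
  rewrite DelE // -/q -mulrA; congr (_ * _).
  have lim := ccvgM (Eul_cvg 24 q1) (ccvgB (ccvg_cst 1) (ccvgZ 24 (Lambert z0))).
  apply: (ccvg_unique lim); apply: (ccvg_eq (N0 := 0%N) _ s2) => N _.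
  rewrite -/q -eulp_horner -eulp_deriv //.
  (* The derivative of [X P] has size at most that of [P], so both polynomials are evaluated over
     the same index range. *)
  set P := eulp _ _ _; have sz : (size ('X * P)^`() <= maxn N (size P))%N.
    apply: leq_trans (size_poly _ _) _; apply: leq_trans (leq_maxr _ _).
    by have := size_polyMleq 'X P; rewrite size_polyX; case: (size ('X * P)) => [|m].
  rewrite (horner_coef_wide q sz); apply: eq_bigr => k _.
  by rewrite coef_deriv coefXM /= mulr_natl.
have := csumZ q s1; apply: csum_eq => k /=.
by rewrite exprS mulrCA.
Qed.

Lemma cderiv_opp_inv z : z != 0 -> cderiv (fun x => - x^-1) z (z ^- 2).
Proof. by move=> z0; rewrite -[z ^- 2]opprK; apply: cderivN; exact: cderiv_inv. Qed.

(** The quotient of the two sides has zero derivative: its logarithmic derivative is the law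
    [Psum_inv], whose anomaly cancels the contribution [-12 / z] of the twelfth power. The value of
    the quotient is read at [i], which is fixed by inversion and satisfies [i^12 = 1]. *)
Lemma Del_inv z : 0 < complex.Im z -> Del (- z^-1) = z ^+ 12 * Del z.
Proof.
pose f x : C := Del (- x^-1) * x^-1 ^+ 12 * (Del x)^-1.
have df x : 0 < complex.Im x -> cderiv f x 0.
  move=> x0; have xn := Im_neq0 x0; have w0 := Im_inv_opp x0.
  have Dn := Del_neq0 x0; have tn := ctau_neq0 R.
  have d1 := cderiv_comp (cderiv_opp_inv xn) (cderiv_Del w0).
  have d2 := cderiv_comp (cderiv_inv xn) (cderivX 12 x^-1).
  have d3 := cderiv_comp (cderiv_Del x0) (cderiv_inv Dn).
  apply: cderiv_eq (cderivM (cderivM d1 d2) d3).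
  have law := Psum_inv x0.
  set G := Del (- x^-1); set F := Del x in Dn *.
  have -> : (tau * (G * (1 - 24 * Psum (- x^-1))) * x ^- 2) =
    tau * G * (x ^- 2 * (1 - 24 * Psum (- x^-1))) by ring.
  rewrite -law /=; move: (Psum x) => P; field.
  by rewrite xn Dn tn.
move=> z0; have zn := Im_neq0 z0; have Dn := Del_neq0 z0.
pose ii : C := 0 +i* 1; have i0 : 0 < complex.Im ii by [].
have i2 : ii * ii = -1 by apply: complexP => /=; ring.
have iV : - ii^-1 = ii.
  have iin := Im_neq0 i0; apply: (mulfI iin).
  by rewrite mulrN divff // i2.
have := cderiv0_cst df z0 i0; rewrite /f iV.
have Di := Del_neq0 i0.
have -> : ii^-1 = - ii by rewrite -[X in - X]iV opprK.
have -> : (- ii) ^+ 12 = 1.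
  have -> : (- ii) ^+ 12 = (ii * ii) ^+ 6 by ring.
  by rewrite i2; ring.
have -> : Del ii * 1 / Del ii = 1 by rewrite [Del ii * 1]mulr1 mulfV.
have alg (G F X : C) : F != 0 -> X != 0 -> G * X^-1 / F = 1 -> G = X * F.
  move=> F0 X0 /(congr1 (fun u => u * (X * F))); rewrite mul1r => <-.
  by field; rewrite F0 X0.
by rewrite exprVn => e; apply: alg; rewrite // expf_neq0.
Qed.

End DiscriminantModular.

(** * Gaussian binomials and the finite Jacobi triple product *)

Section TripleProduct.
Variable R : realType.
Notation C := (complex R).
Implicit Types (t w x q Q : C).

Definition poch Q m : C := \prod_(i < m) (1 - Q ^+ i.+1).

(** Gaussian binomials by Pascal's rule. When the subtraction [m' - k'] is truncated, the entry it
    multiplies is 0. *)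
Fixpoint gauss Q (m k : nat) : C :=
  match m, k with
  | _, 0%N => 1
  | 0%N, _.+1 => 0
  | m'.+1, k'.+1 => gauss Q m' k'.+1 + Q ^+ (m' - k') * gauss Q m' k'
  end.

Lemma gauss0 Q m : gauss Q m 0 = 1. Proof. by case: m. Qed.

Lemma gauss_small Q m k : (m < k)%N -> gauss Q m k = 0.
Proof.
elim: m k => [|m IH] [|k] //= mk.
by rewrite !IH ?mulr0 ?addr0 // ltnW.
Qed.

Lemma pochS Q m : poch Q m.+1 = poch Q m * (1 - Q ^+ m.+1).
Proof. by rewrite /poch big_ord_recr. Qed.

(** The product form holds for every [Q], even where some Pochhammer factor vanishes. *)
Lemma gauss_poch Q m k : (k <= m)%N -> gauss Q m k * (poch Q k * poch Q (m - k)) = poch Q m.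
Proof.
elim: m k => [|m IH] [|k] // km.
- by rewrite /= /poch !big_ord0 !mul1r.
- by rewrite gauss0 subn0 /poch big_ord0 !mul1r.
rewrite ltnS in km; rewrite /= subSS mulrDl.
have e1 : Q ^+ (m - k) * gauss Q m k * (poch Q k.+1 * poch Q (m - k)) =
    poch Q m * (Q ^+ (m - k) * (1 - Q ^+ k.+1)).
  by rewrite -(IH k km) pochS; ring.
have e2 : gauss Q m k.+1 * (poch Q k.+1 * poch Q (m - k)) = poch Q m * (1 - Q ^+ (m - k)).
  move: km; rewrite leq_eqVlt => /orP[/eqP -> |km].
    by rewrite gauss_small // subnn expr0 subrr mulr0 mul0r.
  rewrite -(IH k.+1 km); have -> : (m - k)%N = (m - k.+1).+1 by rewrite -subSn.
  by rewrite (pochS Q (m - k.+1)); ring.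
rewrite e1 e2 pochS -mulrDr; congr (_ * _).
have -> : Q ^+ m.+1 = Q ^+ (m - k) * Q ^+ k.+1 by rewrite -exprD addnS subnK.
by ring.
Qed.

Lemma q_binomial Q x m : \prod_(j < m) (1 + x * Q ^+ j) =
  \sum_(k < m.+1) Q ^+ 'C(k, 2) * gauss Q m k * x ^+ k.
Proof.
elim: m => [|m IH]; first by rewrite big_ord0 big_ord1 /= !expr0 !mulr1.
rewrite big_ord_recr /= IH [RHS]big_ord_recl /= !expr0 !mulr1.
have -> : \sum_(i < m.+1) Q ^+ 'C(bump 0 i, 2) * gauss Q m.+1 (bump 0 i) * x ^+ bump 0 i =
   \sum_(i < m.+1) Q ^+ 'C(i.+1, 2) * gauss Q m i.+1 * x ^+ i.+1 +
   x * Q ^+ m * \sum_(i < m.+1) Q ^+ 'C(i, 2) * gauss Q m i * x ^+ i.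
  rewrite mulr_sumr -big_split /=; apply: eq_bigr => i _; rewrite /bump /= add1n.
  have im : (i <= m)%N by rewrite -ltnS.
  have -> : Q ^+ m = Q ^+ (m - i) * Q ^+ i by rewrite -exprD subnK.
  by rewrite binS bin1 exprD exprS /=; ring.
have -> : \sum_(i < m.+1) Q ^+ 'C(i.+1, 2) * gauss Q m i.+1 * x ^+ i.+1 =
    \sum_(k < m.+1) Q ^+ 'C(k, 2) * gauss Q m k * x ^+ k - 1.
  rewrite big_ord_recr /= gauss_small // mulr0 mul0r addr0.
  by rewrite [in RHS]big_ord_recl /= gauss0 !expr0 !mulr1 addrAC subrr add0r.
by ring.
Qed.

Lemma bin2_sqr k : (2 * 'C(k, 2) + k = k * k)%N.
Proof. by elim: k => [|k IH] //; rewrite binS bin1; nia. Qed.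

Definition tripleP t w N : C :=
  \prod_(i < N) ((1 + w * t ^+ (2 * i).+1) * (1 + w^-1 * t ^+ (2 * i).+1)).

(** The q-binomial theorem with [m = 2 N], [Q = t^2] and [x = w t^(1 - 2 N)]: the last [N] factors
    are [1 + w t^(2 i + 1)], and the first [N], reversed, are [1 + w^-1 t^(2 i + 1)] up to the
    monomial [w^N t^(- N^2)]. *)
Lemma triple_finite t w N : t != 0 -> w != 0 ->
  tripleP t w N = \sum_(k < (N + N).+1)
    (w ^+ N)^-1 * t ^+ (N * N) * ((t ^+ 2) ^+ 'C(k, 2) * gauss (t ^+ 2) (N + N) k * (w * t / t ^+ (2 * N)) ^+ k).
Proof.
move=> t0 w0; rewrite -mulr_sumr -q_binomial big_split_ord /=.
set x := w * t / _.
have T0 n : t ^+ n != 0 by rewrite expf_neq0.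
have e1 : \prod_(i < N) (1 + x * (t ^+ 2) ^+ (N + i)) = \prod_(i < N) (1 + w * t ^+ (2 * i).+1).
  apply: eq_bigr => i _; congr (1 + _); rewrite /x -exprM mulnDr exprD exprS.
  by move: (T0 (2 * N)%N); move: (t ^+ (2 * N)) => u u0; field.
have e2 : \prod_(i < N) (1 + x * (t ^+ 2) ^+ i) =
    w ^+ N * (t ^+ (N * N))^-1 * \prod_(i < N) (1 + w^-1 * t ^+ (2 * i).+1).
  rewrite (reindex_inj rev_ord_inj) /=.
  have -> : w ^+ N * (t ^+ (N * N))^-1 = \prod_(i < N) (w / t ^+ (2 * i).+1).
    elim: (N) => [|n IH]; first by rewrite big_ord0 !expr0 invr1 mulr1.
    rewrite big_ord_recr /= -IH exprS.
    have -> : (n.+1 * n.+1 = n * n + (2 * n).+1)%N by nia.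
    by rewrite exprD; field; rewrite !T0.
  rewrite -big_split /=; apply: eq_bigr => i _.
  have iN := ltn_ord i.
  have -> : w / t ^+ (2 * i).+1 * (1 + w^-1 * t ^+ (2 * i).+1) = 1 + w / t ^+ (2 * i).+1.
    by field; rewrite T0 w0.
  congr (1 + _); rewrite /x -exprM.
  have e : t ^+ (2 * N) = t * t ^+ (2 * (N - i.+1)) * t ^+ (2 * i).+1.
    by rewrite -exprS -exprD; congr (t ^+ _); lia.
  by rewrite e; field; rewrite !T0.
rewrite e1 e2 /tripleP big_split /=.
by field; rewrite T0 expf_neq0.
Qed.

(** As [2 C(k, 2) + k = k^2], the total exponent of [t] is [(k - N)^2]; here [k - N = n]. *)
Lemma triple_term t w N k n : t != 0 -> w != 0 -> (k = N + n)%N ->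
  (w ^+ N)^-1 * t ^+ (N * N) * ((t ^+ 2) ^+ 'C(k, 2) * gauss (t ^+ 2) (N + N) k * (w * t / t ^+ (2 * N)) ^+ k)
  = w ^+ n * t ^+ (n * n) * gauss (t ^+ 2) (N + N) k.
Proof.
move=> t0 w0 kE; have T0 m : t ^+ m != 0 by rewrite expf_neq0.
have W0 m : w ^+ m != 0 by rewrite expf_neq0.
move: (gauss _ _ _) => g; rewrite [(w * t / _) ^+ k]expr_div_n [(w * t) ^+ k]exprMn -!exprM.
have e1 : w ^+ k = w ^+ N * w ^+ n by rewrite -exprD kE.
have e2 : t ^+ (N * N) * t ^+ (2 * 'C(k, 2)) * t ^+ k = t ^+ (n * n) * t ^+ (2 * N * k).
  by rewrite -!exprD -addnA bin2_sqr kE; congr (t ^+ _); nia.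
have -> : (w ^+ N)^-1 * t ^+ (N * N) * (t ^+ (2 * 'C(k, 2)) * g * (w ^+ k * t ^+ k / t ^+ (2 * N * k)))
  = (w ^+ N)^-1 * w ^+ k * (t ^+ (N * N) * t ^+ (2 * 'C(k, 2)) * t ^+ k) / t ^+ (2 * N * k) * g by ring.
by rewrite e1 e2; field; rewrite T0 W0.
Qed.

Lemma triple_termN t w N k n : t != 0 -> w != 0 -> (k + n = N)%N ->
  (w ^+ N)^-1 * t ^+ (N * N) * ((t ^+ 2) ^+ 'C(k, 2) * gauss (t ^+ 2) (N + N) k * (w * t / t ^+ (2 * N)) ^+ k)
  = (w ^+ n)^-1 * t ^+ (n * n) * gauss (t ^+ 2) (N + N) k.
Proof.
move=> t0 w0 kE; have T0 m : t ^+ m != 0 by rewrite expf_neq0.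
have W0 m : w ^+ m != 0 by rewrite expf_neq0.
move: (gauss _ _ _) => g; rewrite [(w * t / _) ^+ k]expr_div_n [(w * t) ^+ k]exprMn -!exprM.
have e1 : w ^+ N = w ^+ k * w ^+ n by rewrite -exprD kE.
have e2 : t ^+ (N * N) * t ^+ (2 * 'C(k, 2)) * t ^+ k = t ^+ (n * n) * t ^+ (2 * N * k).
  by rewrite -!exprD -addnA bin2_sqr -kE; congr (t ^+ _); nia.
have -> : (w ^+ N)^-1 * t ^+ (N * N) * (t ^+ (2 * 'C(k, 2)) * g * (w ^+ k * t ^+ k / t ^+ (2 * N * k)))
  = (w ^+ N)^-1 * w ^+ k * (t ^+ (N * N) * t ^+ (2 * 'C(k, 2)) * t ^+ k) / t ^+ (2 * N * k) * g by ring.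
by rewrite e1 e2; field; rewrite T0 !W0.
Qed.

Lemma triple_one t N : t != 0 -> tripleP t 1 N = gauss (t ^+ 2) (N + N) N +
  \sum_(n < N) t ^+ (n.+1 * n.+1) *
    (gauss (t ^+ 2) (N + N) (N + n.+1) + gauss (t ^+ 2) (N + N) (N - n.+1)).
Proof.
move=> t0; have o0 : (1 : C) != 0 := oner_neq0 _.
rewrite triple_finite // -addSn big_split_ord /= big_ord_recr /=.
rewrite (@triple_term t 1 N N 0) ?addn0 // expr0 [1 * t ^+ _]mul1r muln0 expr0 [1 * gauss _ _ _]mul1r.
rewrite (reindex_inj rev_ord_inj) /=.
under eq_bigr => i _ do rewrite (@triple_termN t 1 N (N - i.+1) i.+1) ?subnK // expr1n invr1 mul1r.
under [X in _ + _ + X]eq_bigr => i _ do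
  rewrite (@triple_term t 1 N (N.+1 + i) i.+1) ?addSnnS // expr1n mul1r.
rewrite addrAC [LHS]addrC; congr (_ + _); rewrite -big_split /=.
by apply: eq_bigr => i _; rewrite ?addSnnS; ring.
Qed.

(** At [w = t] the indices [n] and [- n - 1] carry the same power [t^(n^2 + n)] and are grouped; the
    index [N] has no partner and gives the isolated term. *)
Lemma triple_t t N : t != 0 -> tripleP t t N = t ^+ (N * N + N) * gauss (t ^+ 2) (N + N) (N + N) +
  \sum_(n < N) t ^+ (n * n + n) *
    (gauss (t ^+ 2) (N + N) (N + n) + gauss (t ^+ 2) (N + N) (N - n.+1)).
Proof.
move=> t0; rewrite triple_finite // -addnS big_split_ord /= [X in _ + X]big_ord_recr /=.
rewrite (@triple_term t t N (N + N) N) // -exprD [(N + N * N)%N]addnC.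
rewrite (reindex_inj rev_ord_inj) /=.
have e (i : 'I_N) : (t ^+ i.+1)^-1 * t ^+ (i.+1 * i.+1) = t ^+ (i * i + i).
  have -> : (i.+1 * i.+1 = i.+1 + (i * i + i))%N by nia.
  by rewrite exprD mulKf // expf_neq0.
under eq_bigr => i _ do rewrite (@triple_termN t t N (N - i.+1) i.+1) ?subnK // e.
under [X in _ + (X + _)]eq_bigr => i _ do
  rewrite (@triple_term t t N (N + i) i) // -exprD [(i + i * i)%N]addnC.
rewrite addrA [LHS]addrC; congr (_ + _); rewrite -big_split /=.
by apply: eq_bigr => i _; ring.
Qed.

End TripleProduct.

(** * Theta constants as Euler products *)

Section ThetaIdentities.
Variable R : realType.
Notation C := (complex R).
Implicit Types (t w x q Q : C).
Local Notation E := (@Eul R 1).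

Lemma ccvg_bounded (u : nat -> C) l : ccvg u l -> exists2 B : R, 0 <= B & forall n, cabs (u n) <= B.
Proof.
move=> /ccvg_lt /(_ ltr01) [N hN]; exists (cabs l + 1 + \sum_(i < N) cabs (u i)).
  by rewrite !addr_ge0 ?cabs_ge0 ?sumr_ge0 // => i _; exact: cabs_ge0.
move=> n; case: (ltnP n N) => nN.
  rewrite (bigD1 (Ordinal nN)) //= addrCA lerDl !addr_ge0 ?cabs_ge0 ?sumr_ge0 // => i _.
  exact: cabs_ge0.
have h := hN n nN; have := cabsD (u n - l) l; rewrite subrK => h2.
have : 0 <= \sum_(i < N) cabs (u i) by rewrite sumr_ge0 // => i _; exact: cabs_ge0.
lra.
Qed.

Lemma poch_cvg Q : cabs Q < 1 -> ccvg (poch Q) (E Q).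
Proof.
by move=> /(Eul_cvg 1); apply: (@ccvg_eq _ _ _ _ 0%N) => n _; apply: eq_bigr => i _.
Qed.

Lemma poch_neq0 Q n : cabs Q < 1 -> poch Q n != 0.
Proof.
move=> Q1; apply/prodf_neq0 => i _; rewrite subr_eq0; apply/eqP => h.
by have := cabsX Q i.+1; rewrite -h cabs1 => /esym/eqP; rewrite lt_eqF // exprn_ilt1 // cabs_ge0.
Qed.

Lemma gaussE Q m k : cabs Q < 1 -> (k <= m)%N ->
  gauss Q m k = poch Q m / (poch Q k * poch Q (m - k)).
Proof.
by move=> Q1 km; rewrite -(gauss_poch Q km) mulfK // mulf_neq0 // poch_neq0.
Qed.

Lemma gauss_le Q : cabs Q < 1 -> exists2 B : R, 0 <= B & forall m k, cabs (gauss Q m k) <= B.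
Proof.
move=> Q1; have [A A0 hA] := ccvg_bounded (poch_cvg Q1).
have [B B0 hB] := ccvg_bounded (ccvgV (Eul_neq0 1 Q1) (poch_cvg Q1)).
exists (A * (B * B)) => [|m k]; first by rewrite !mulr_ge0.
case: (leqP k m) => km; last by rewrite gauss_small // cabs0 !mulr_ge0.
by rewrite gaussE // invfM !cabsM !ler_pM ?mulr_ge0 ?cabs_ge0.
Qed.

(** Near the middle, all three Pochhammer symbols of the quotient tend to the same nonzero
    product. *)
Lemma gauss_cvg Q j : cabs Q < 1 ->
  ccvg (fun N => gauss Q (N + N) (N + j)) (E Q)^-1 /\
  ccvg (fun N => gauss Q (N + N) (N - j)) (E Q)^-1.
Proof.
move=> Q1; have E0 := Eul_neq0 1 Q1; have pc := poch_cvg Q1.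
have c1 : ccvg (fun N => poch Q (N + N)) (E Q).
  by apply: (ccvg_sub (m := fun N => (N + N)%N) _ pc) => K; exists K => n Kn;
     rewrite (leq_trans Kn) // leq_addr.
have c2 : ccvg (fun N => poch Q (N + j)) (E Q).
  by apply: (ccvg_sub (m := fun N => (N + j)%N) _ pc) => K; exists K => n Kn;
     rewrite (leq_trans Kn) // leq_addr.
have c3 : ccvg (fun N => poch Q (N - j)) (E Q).
  by apply: (ccvg_sub (m := fun N => (N - j)%N) _ pc) => K; exists (K + j)%N => n; lia.
have := ccvgM c1 (ccvgV (mulf_neq0 E0 E0) (ccvgM c2 c3)).
have -> : E Q / (E Q * E Q) = (E Q)^-1 by field.
move=> h; split.
  apply: (ccvg_eq (N0 := j) _ h) => N jN; rewrite gaussE ?leq_add2l //.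
  by rewrite subnDl.
apply: (ccvg_eq (N0 := j) _ h) => N jN; rewrite gaussE //; last first.
  by rewrite (leq_trans (leq_subr _ _)) // leq_addr.
have -> : (N + N - (N - j) = N + j)%N by lia.
by rewrite [poch Q (N + j) * _]mulrC.
Qed.

(** Jacobi's [theta_3], the sum of [t^(n^2)] over all integers. *)
Definition th3 t : C := 1 + 2 * csumv (fun n => t ^+ (n.+1 * n.+1)).
(** Jacobi's [theta_2] divided by [2 t^(1/4)], which avoids fractional powers. *)
Definition th2 t : C := csumv (fun n => t ^+ (n * n + n)).

Lemma cabsX_lt1 t n : cabs t < 1 -> cabs (t ^+ n.+1) < 1.
Proof. by move=> t1; rewrite cabsX exprn_ilt1 // cabs_ge0. Qed.

Lemma expr_le_geom (r : R) m n : 0 <= r < 1 -> (m <= n)%N -> r ^+ n <= r ^+ m.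
Proof. by move=> /andP[r0 r1] mn; apply: ler_wiXn2l => //; exact: ltW. Qed.

Lemma bser_pow t (f : nat -> nat) : cabs t < 1 -> (forall n, (n <= f n)%N) ->
  bser (fun n => cabs (t ^+ f n)).
Proof.
move=> t1 hf; have hr : 0 <= cabs t < 1 by rewrite cabs_ge0.
apply: bser_le (bser_geom hr) => n; rewrite cabs_ge0 cabsX.
exact: expr_le_geom.
Qed.

Lemma theta_limit t (f : nat -> nat) (g h : nat -> nat -> C) (l : C) :
  cabs t < 1 -> (forall n, (n <= f n)%N) ->
  (exists2 B : R, 0 <= B & forall N n, cabs (g N n) <= B) ->
  (forall n, ccvg (g^~ n) l) ->
  ccvg (fun N => \sum_(n < N) t ^+ f n * g N n) (l * csumv (fun n => t ^+ f n)).
Proof.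
move=> t1 hf [B B0 hB] hl; have bs := bser_pow t1 hf.
have [|||_ lim] := @tannery R (fun n => B * cabs (t ^+ f n)) (fun N n => t ^+ f n * g N n)
   (fun n => l * t ^+ f n) id 0%N (bserZ B0 bs).
- by move=> N n _ _; rewrite cabsM mulrC ler_wpM2r ?cabs_ge0.
- by move=> n; rewrite mulrC; apply: ccvgZ.
- by move=> K; exists K.
by rewrite -(csumvE (csumZ l (csumvP bs))).
Qed.

Lemma oddprod t N : cabs t < 1 ->
  \prod_(i < N) (1 + t ^+ (2 * i).+1) = poch (- t) (N + N) / poch (t ^+ 2) N.
Proof.
move=> t1; have t2 : cabs (t ^+ 2) < 1 := cabsX_lt1 1 t1.
suff h : \prod_(i < N) (1 + t ^+ (2 * i).+1) * poch (t ^+ 2) N = poch (- t) (N + N).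
  by rewrite -h mulfK // poch_neq0.
elim: N => [|N IH]; first by rewrite /poch !big_ord0 mulr1.
rewrite big_ord_recr /= addSn addnS !pochS -IH addnn -mul2n.
have o : (- t) ^+ (2 * N).+1 = - t ^+ (2 * N).+1.
  by rewrite exprNn -signr_odd /= oddM /= expr1 mulN1r.
have -> : (- t) ^+ (2 * N).+2 = (t ^+ 2) ^+ N.+1.
  by rewrite exprS o mulrNN -exprS -exprM mulnS.
by rewrite o opprK; ring.
Qed.

Lemma oddprod_cvg t : cabs t < 1 ->
  ccvg (fun N => \prod_(i < N) (1 + t ^+ (2 * i).+1)) (E (- t) / E (t ^+ 2)).
Proof.
move=> t1; have t2 : cabs (t ^+ 2) < 1 := cabsX_lt1 1 t1.
have n1 : cabs (- t) < 1 by rewrite cabsN.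
have c1 : ccvg (fun N => poch (- t) (N + N)) (E (- t)).
  by apply: (ccvg_sub (m := fun N => (N + N)%N) _ (poch_cvg n1)) => K; exists K => n Kn;
     rewrite (leq_trans Kn) // leq_addr.
have := ccvgM c1 (ccvgV (Eul_neq0 1 t2) (poch_cvg t2)).
by apply: (@ccvg_eq _ _ _ _ 0%N) => N _; rewrite oddprod.
Qed.

Lemma evenprod Q N : cabs Q < 1 ->
  \prod_(i < N) (1 + Q ^+ i.+1) = poch (Q ^+ 2) N / poch Q N.
Proof.
move=> Q1; suff h : \prod_(i < N) (1 + Q ^+ i.+1) * poch Q N = poch (Q ^+ 2) N.
  by rewrite -h mulfK // poch_neq0.
rewrite /poch -big_split /=; apply: eq_bigr => i _.
by rewrite -exprM mulnC exprM; ring.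
Qed.

Lemma evenprod_cvg Q : cabs Q < 1 ->
  ccvg (fun N => \prod_(i < N) (1 + Q ^+ i.+1)) (E (Q ^+ 2) / E Q).
Proof.
move=> Q1; have Q2 : cabs (Q ^+ 2) < 1 := cabsX_lt1 1 Q1.
have := ccvgM (poch_cvg Q2) (ccvgV (Eul_neq0 1 Q1) (poch_cvg Q1)).
by apply: (@ccvg_eq _ _ _ _ 0%N) => N _; rewrite evenprod.
Qed.

(** Two evaluations of the triple product at [w = 1]: as a product it is [(E (- t) / E (t^2))^2], as
    a series [th3 t / E (t^2)]. *)
Lemma th3_prod t : cabs t < 1 -> t != 0 -> E (- t) ^+ 2 = E (t ^+ 2) * th3 t.
Proof.
move=> t1 t0; have t2 : cabs (t ^+ 2) < 1 := cabsX_lt1 1 t1.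
have E0 := Eul_neq0 1 t2.
have lhs : ccvg (tripleP t 1) ((E (- t) / E (t ^+ 2)) ^+ 2).
  apply: (ccvg_eq (N0 := 0%N) _ (ccvgX 2 (oddprod_cvg t1))) => N _.
  rewrite /tripleP expr2 -big_split /=; apply: eq_bigr => i _.
  by rewrite invr1 !mul1r.
have [B B0 hB] := gauss_le t2.
have rhs : ccvg (tripleP t 1) ((E (t ^+ 2))^-1 + ((E (t ^+ 2))^-1 + (E (t ^+ 2))^-1) * csumv (fun n => t ^+ (n.+1 * n.+1))).
  rewrite (funext (fun N => @triple_one R t N t0)).
  apply: ccvgD.
    apply: (ccvg_eq (N0 := 0%N) _ (gauss_cvg 0 t2).1) => N _; by rewrite addn0.
  apply: (theta_limit (f := fun n => (n.+1 * n.+1)%N) (g := fun N n =>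
    gauss (t ^+ 2) (N + N) (N + n.+1) + gauss (t ^+ 2) (N + N) (N - n.+1))) => //.
  - by move=> n; nia.
  - exists (B + B); first by rewrite addr_ge0.
    by move=> N n; apply: le_trans (cabsD _ _) (lerD (hB _ _) (hB _ _)).
  - by move=> n; have [a b] := gauss_cvg n.+1 t2; apply: ccvgD.
have e := ccvg_unique lhs rhs.
have -> : E (- t) ^+ 2 = E (t ^+ 2) ^+ 2 * (E (- t) / E (t ^+ 2)) ^+ 2.
  by move: (E (- t)) (E (t ^+ 2)) E0 => a b b0; field.
by rewrite e /th3; field.
Qed.

Lemma th2_prod t : cabs t < 1 -> t != 0 -> E (t ^+ 4) ^+ 2 = E (t ^+ 2) * th2 t.
Proof.
move=> t1 t0; have t2 : cabs (t ^+ 2) < 1 := cabsX_lt1 1 t1.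
have E0 := Eul_neq0 1 t2.
have t4 : t ^+ 4 = (t ^+ 2) ^+ 2 by rewrite -exprM.
have lhs : ccvg (tripleP t t) (2 * (E (t ^+ 4) / E (t ^+ 2)) ^+ 2).
  have ev := evenprod_cvg t2; rewrite -t4 in ev.
  (* At [w = t] the factor [1 + w^-1 t] equals 2; taking it out shifts one of the two products by
     one index. *)
  apply/ccvgS; have := ccvgZ 2 (ccvgM ((ccvgS _ _).1 ev) ev); rewrite -expr2.
  apply: (@ccvg_eq _ _ _ _ 0%N) => N _.
  rewrite /tripleP [in RHS]big_split /=.
  have -> : \prod_(i < N.+1) (1 + t * t ^+ (2 * i).+1) = \prod_(i < N.+1) (1 + (t ^+ 2) ^+ i.+1).
    by apply: eq_bigr => i _; rewrite -exprS -exprM mulnS.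
  have -> : \prod_(i < N.+1) (1 + t^-1 * t ^+ (2 * i).+1) = \prod_(i < N.+1) (1 + (t ^+ 2) ^+ i).
    by apply: eq_bigr => i _; rewrite exprS mulKf // -exprM.
  by rewrite [X in _ = _ * X]big_ord_recl /= expr0; ring.
have [B B0 hB] := gauss_le t2.
have rhs : ccvg (tripleP t t) (0 + ((E (t ^+ 2))^-1 + (E (t ^+ 2))^-1) * csumv (fun n => t ^+ (n * n + n))).
  rewrite (funext (fun N => @triple_t R t N t0)).
  apply: ccvgD.
    have g0 := bser_cvg0 (bser_pow (f := fun N => (N * N + N)%N) t1 (fun n => leq_addl _ _)).
    apply: (ccvg_squeeze (b := fun N => B * cabs (t ^+ (N * N + N))) (N0 := 0%N)) => [N _|].
      by rewrite subr0 cabsM mulrC ler_wpM2r ?cabs_ge0.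
    by rewrite -[X in _ --> X](mulr0 B); apply: cvgM => //; exact: cvg_cst.
  apply: (theta_limit (f := fun n => (n * n + n)%N) (g := fun N n =>
    gauss (t ^+ 2) (N + N) (N + n) + gauss (t ^+ 2) (N + N) (N - n.+1))) => //.
  - by move=> n; exact: leq_addl.
  - exists (B + B); first by rewrite addr_ge0.
    by move=> N n; apply: le_trans (cabsD _ _) (lerD (hB _ _) (hB _ _)).
  - by move=> n; apply: ccvgD; [exact: (gauss_cvg n t2).1 | exact: (gauss_cvg n.+1 t2).2].
have e := ccvg_unique lhs rhs.
have -> : E (t ^+ 4) ^+ 2 = E (t ^+ 2) ^+ 2 * (2 * (E (t ^+ 4) / E (t ^+ 2)) ^+ 2) / 2.
  by move: (E (t ^+ 4)) (E (t ^+ 2)) E0 => a b b0; field.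
by rewrite e /th2; field.
Qed.

(** Since [(1 + t^k)(1 - t^k) = 1 - t^(2 k)], the odd [k] supply the odd factors of [E (t^2)], and
    [E (t^4)] supplies the even ones. *)
Lemma Eul_quad t : cabs t < 1 -> E t * E (- t) * E (t ^+ 4) = E (t ^+ 2) ^+ 3.
Proof.
move=> t1; have t2 : cabs (t ^+ 2) < 1 := cabsX_lt1 1 t1.
have n1 : cabs (- t) < 1 by rewrite cabsN.
have t4 : cabs (t ^+ 4) < 1 := cabsX_lt1 3 t1.
have E0 := Eul_neq0 1 t2.
have h1 := oddprod_cvg t1; have h2 := oddprod_cvg n1.
rewrite opprK sqrrN in h2.
have h3 := ccvgM (ccvgM h1 h2) (poch_cvg t4).
have h4 : ccvg (fun N => poch (t ^+ 2) (N + N)) (E (t ^+ 2)).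
  by apply: (ccvg_sub (m := fun N => (N + N)%N) _ (poch_cvg t2)) => K; exists K => n Kn;
     rewrite (leq_trans Kn) // leq_addr.
have h5 : E (- t) / E (t ^+ 2) * (E t / E (t ^+ 2)) * E (t ^+ 4) = E (t ^+ 2).
  apply: (ccvg_unique h3); apply: (ccvg_eq (N0 := 0%N) _ h4) => N _.
  elim: N => [|N IH]; first by rewrite /poch !big_ord0 !mulr1.
  rewrite !big_ord_recr /= addSn addnS !pochS IH addnn -mul2n.
  rewrite exprNn -signr_odd /= oddM /= expr1 mulN1r.
  have -> : (t ^+ 4) ^+ N.+1 = (t ^+ 2) ^+ (2 * N).+2 by rewrite -!exprM; congr (t ^+ _); lia.
  have -> : (t ^+ 2) ^+ (2 * N).+1 = t ^+ (2 * N).+1 * t ^+ (2 * N).+1.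
    by rewrite -exprD -exprM; congr (t ^+ _); lia.
  by ring.
move: h5 E0; move: (E t) (E (- t)) (E (t ^+ 4)) (E (t ^+ 2)) => a b c d h5 d0.
have -> : a * b * c = b / d * (a / d) * c * d ^+ 2 by field.
by rewrite h5; ring.
Qed.

End ThetaIdentities.

(** * Jacobi's quartic identity and the eigenvalue of [T_2] on [Delta] *)

Section JacobiHecke.
Variable R : realType.
Notation C := (complex R).
Implicit Types (t w x q Q z : C).
Local Notation E := (@Eul R 1).

(** Squares are sorted by parity: [(2 n)^2 = 4 n^2] and [(2 n + 1)^2 = 4 (n^2 + n) + 1]. *)
Lemma th3_split t : cabs t < 1 -> th3 t = th3 (t ^+ 4) + 2 * t * th2 (t ^+ 4).
Proof.
move=> t1; have t4 : cabs (t ^+ 4) < 1 := cabsX_lt1 3 t1.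
have b1 := bser_pow (f := fun n => (n.+1 * n.+1)%N) t1.
have b2 := bser_pow (f := fun n => (n.+1 * n.+1)%N) t4.
have b3 := bser_pow (f := fun n => (n * n + n)%N) t4.
have {b1} s1 := csumvP (b1 (fun n => ltac:(nia))).
have {b2} s2 := csumvP (b2 (fun n => ltac:(nia))).
have {b3} s3 := csumvP (b3 (fun n => ltac:(nia))).
suff e : csumv (fun n => t ^+ (n.+1 * n.+1)) =
   csumv (fun n => (t ^+ 4) ^+ (n.+1 * n.+1)) + t * csumv (fun n => (t ^+ 4) ^+ (n * n + n)).
  by rewrite /th3 /th2 e; ring.
have h : ccvg (fun N => \sum_(n < N + N) t ^+ (n.+1 * n.+1)) (csumv (fun n => t ^+ (n.+1 * n.+1))).
  by apply: (ccvg_sub (m := fun N => (N + N)%N) _ s1) => K; exists K => n Kn;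
     rewrite (leq_trans Kn) // leq_addr.
apply: (ccvg_unique h); apply: (ccvg_eq (N0 := 0%N) _ (ccvgD s2 (csumZ t s3))) => N _.
elim: N => [|N IH]; first by rewrite !big_ord0 addr0.
rewrite addnS addSn !big_ord_recr /= -IH.
have -> : t ^+ ((N + N).+1 * (N + N).+1) = t * (t ^+ 4) ^+ (N * N + N).
  by rewrite -exprM -exprS; congr (t ^+ _); nia.
have -> : t ^+ ((N + N).+2 * (N + N).+2) = (t ^+ 4) ^+ (N.+1 * N.+1).
  by rewrite -exprM; congr (t ^+ _); nia.
by ring.
Qed.

Lemma th3_near1 (r : R) t : 0 <= r < 1 -> cabs t <= r ->
  cabs (th3 t - 1) <= 2 / (1 - r) * cabs t.
Proof.
move=> /andP[r0 r1] tr; have t1 : cabs t < 1 := le_lt_trans tr r1.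
have d0 : 0 < 1 - r by rewrite subr_gt0.
have b1 := csumvP (bser_pow (f := fun n => (n.+1 * n.+1)%N) t1 (fun n => ltac:(nia))).
rewrite /th3 addrAC subrr add0r cabsM cabs_nat -mulrA ler_wpM2l //.
apply: (csum_cabs_le (b := fun n => cabs t * r ^+ n) b1) => n.
  rewrite cabsX; have -> : (n.+1 * n.+1 = (n.+1 * n + n).+1)%N by nia.
  rewrite exprS ler_wpM2l ?cabs_ge0 //.
  apply: (@le_trans _ _ (cabs t ^+ n)).
    by apply: expr_le_geom; [rewrite cabs_ge0 | nia].
  by rewrite lerXn2r ?nnegrE ?cabs_ge0.
rewrite -mulr_sumr mulrC ler_wpM2r ?cabs_ge0 //.
have -> : \sum_(i < n) r ^+ i = (1 - r ^+ n) / (1 - r).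
  elim: n => [|n IH]; first by rewrite big_ord0 expr0 subrr mul0r.
  by rewrite big_ord_recr /= IH exprS; field; rewrite gt_eqF.
by rewrite ler_pdivrMr // mulVf ?gt_eqF // gerBl exprn_ge0.
Qed.

Local Opaque th3 th2 Eul.

Lemma th3_prod_neg t : cabs t < 1 -> t != 0 -> E t ^+ 2 = E (t ^+ 2) * th3 (- t).
Proof.
move=> t1 t0; have := @th3_prod R (- t).
by rewrite opprK sqrrN cabsN oppr_eq0; apply.
Qed.

Lemma th3_mul t : cabs t < 1 -> t != 0 -> th3 t * th3 (- t) = th3 (- t ^+ 2) ^+ 2.
Proof.
move=> t1 t0; have t2 : cabs (t ^+ 2) < 1 := cabsX_lt1 1 t1.
have t4 : cabs (t ^+ 4) < 1 := cabsX_lt1 3 t1.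
have E2 := Eul_neq0 1 t2; have E4 := Eul_neq0 1 t4.
have t20 : t ^+ 2 != 0 by rewrite expf_neq0.
have h1 := th3_prod t1 t0; have h2 := th3_prod_neg t1 t0.
have h3 := th3_prod_neg t2 t20; rewrite -exprM in h3.
have h4 := Eul_quad t1.
apply: (mulfI (mulf_neq0 (mulf_neq0 E2 E2) (mulf_neq0 E4 E4))).
move: h1 h2 h3 h4; move: (E t) (E (- t)) (E (t ^+ 4)) (E (t ^+ 2)) (th3 t) (th3 (- t)) (th3 (- t ^+ 2)).
move=> a b c d x y u h1 h2 h3 h4.
have -> : d * d * (c * c) * (x * y) = (d * x) * (d * y) * c ^+ 2 by ring.
rewrite -h1 -h2; have -> : d * d * (c * c) * u ^+ 2 = d ^+ 2 * (c * u) ^+ 2 by ring.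
rewrite -h3; have -> : b ^+ 2 * a ^+ 2 * c ^+ 2 = (a * b * c) ^+ 2 by ring.
by rewrite h4; ring.
Qed.

Lemma th3_th2_mul t : cabs t < 1 -> t != 0 -> th3 (t ^+ 2) * th2 (t ^+ 2) = th2 t ^+ 2.
Proof.
move=> t1 t0; have t2 : cabs (t ^+ 2) < 1 := cabsX_lt1 1 t1.
have t4 : cabs (t ^+ 4) < 1 := cabsX_lt1 3 t1.
have E2 := Eul_neq0 1 t2; have E4 := Eul_neq0 1 t4.
have t20 : t ^+ 2 != 0 by rewrite expf_neq0.
have h1 := th3_prod t2 t20; have h2 := th2_prod t2 t20; have h3 := th2_prod t1 t0.
have h4 := Eul_quad t2; rewrite -!exprM /= in h1 h2 h4.
apply: (mulfI (mulf_neq0 (mulf_neq0 E2 E2) (mulf_neq0 E4 E4))).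
move: h1 h2 h3 h4; move: (E (t ^+ 2)) (E (- t ^+ 2)) (E (t ^+ 4)) (E (t ^+ (2 * 4))).
move: (th3 (t ^+ 2)) (th2 (t ^+ 2)) (th2 t) => x y u a b c d h1 h2 h3 h4.
have -> : a * a * (c * c) * (x * y) = a ^+ 2 * (c * x) * (c * y) by ring.
rewrite -h1 -h2; have -> : a * a * (c * c) * u ^+ 2 = c ^+ 2 * (a * u) ^+ 2 by ring.
rewrite -h3; have -> : a ^+ 2 * b ^+ 2 * d ^+ 2 = (a * b * d) ^+ 2 by ring.
by rewrite h4; ring.
Qed.

Lemma cabs_comb (A B D : C) (M : R) : cabs A <= M -> cabs B <= M -> cabs D <= M ->
  cabs (A + B - 2 * D) <= 4 * M.
Proof.
move=> hA hB hD; apply: le_trans (cabsD _ _) _; rewrite cabsN cabsM cabs_nat.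
have := cabsD A B; lra.
Qed.

(** The defect of the duplication formula for [theta_3^2], to be shown zero. *)
Definition Edef t : C := th3 t ^+ 2 + th3 (- t) ^+ 2 - 2 * th3 (t ^+ 2) ^+ 2.

(** The squares rearrange through [th3 t + th3 (- t) = 2 th3 (t^4)] and [th3_mul], reproducing the
    defect at [t^2]. *)
Lemma Edef_double t : cabs t < 1 -> t != 0 -> Edef t = - 2 * Edef (t ^+ 2).
Proof.
move=> t1 t0; rewrite /Edef.
have n1 : cabs (- t) < 1 by rewrite cabsN.
have h1 := th3_split t1; have h2 := th3_split n1.
have e4 : (- t) ^+ 4 = t ^+ 4 by ring.
rewrite e4 in h2; have h3 := th3_mul t1 t0.
rewrite -!exprM; have h4 : th3 t + th3 (- t) = 2 * th3 (t ^+ 4) by rewrite h1 h2; ring.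
move: h3 h4; move: (th3 t) (th3 (- t)) (th3 (- t ^+ 2)) (th3 (t ^+ 2)) (th3 (t ^+ 4)).
move=> a b c d x h3 h4.
have -> : a ^+ 2 + b ^+ 2 - 2 * d ^+ 2 = (a + b) ^+ 2 - 2 * (a * b) - 2 * d ^+ 2 by ring.
by rewrite h3 h4; ring.
Qed.

(** The defect at [x] is of order [x]. Iterating the doubling rule bounds the defect at [t] by a
    multiple of [2^k |t|^(2^k)], which tends to 0. *)
Lemma Edef0 t : cabs t < 1 -> t != 0 -> Edef t = 0.
Proof.
move=> t1 t0; set r := cabs t in t1; have r0 : 0 <= r := cabs_ge0 _.
have hr : 0 <= r < 1 by rewrite r0.
set K := 2 / (1 - r); have K0 : 0 <= K by rewrite divr_ge0 // subr_ge0 ltW.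
have small (x : C) : cabs x <= r -> cabs (Edef x) <= 4 * (2 * K + K ^+ 2) * cabs x.
  move=> xr; have x1 : cabs x <= 1 by rewrite (le_trans xr) // ltW.
  have x0 := cabs_ge0 x.
  have near (y : C) : cabs y <= cabs x -> cabs (th3 y ^+ 2 - 1) <= (2 * K + K ^+ 2) * cabs x.
    move=> yx; have h := th3_near1 hr (le_trans yx xr); rewrite -/K in h.
    have -> : th3 y ^+ 2 - 1 = 2 * (th3 y - 1) + (th3 y - 1) ^+ 2 by ring.
    apply: le_trans (cabsD _ _) _; rewrite cabsM cabs_nat cabsX.
    have h2 : cabs (th3 y - 1) <= K * cabs x by rewrite (le_trans h) // ler_wpM2l.
    have h3 : cabs (th3 y - 1) ^+ 2 <= (K * cabs x) ^+ 2.
      by rewrite lerXn2r ?nnegrE ?cabs_ge0 ?(mulr_ge0 K0 (cabs_ge0 x)).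
    have h4 : (K * cabs x) ^+ 2 <= K ^+ 2 * cabs x.
      by rewrite exprMn ler_wpM2l ?sqr_ge0 // expr2 ler_piMr.
    lra.
  have h1 := near x (lexx _); have h2 : cabs (- x) <= cabs x by rewrite cabsN.
  have {}h2 := near _ h2.
  have h3 : cabs (x ^+ 2) <= cabs x by rewrite cabsX expr2 ler_piMr.
  have {}h3 := near _ h3.
  have -> : Edef x = (th3 x ^+ 2 - 1) + (th3 (- x) ^+ 2 - 1) - 2 * (th3 (x ^+ 2) ^+ 2 - 1).
    by rewrite /Edef; move: (th3 x) (th3 (- x)) (th3 (x ^+ 2)) => a b c; ring.
  by rewrite -[leRHS]mulrA; exact: cabs_comb.
have iter k : Edef t = (- 2) ^+ k * Edef (t ^+ (2 ^ k)).
  elim: k => [|k IH]; first by rewrite expn0 expr1 mul1r.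
  rewrite IH Edef_double ?expf_neq0 //; last first.
    by case: (2 ^ k)%N (expn_gt0 2 k) => // m _; apply: cabsX_lt1.
  by rewrite -exprM expnS [(2 * _)%N]mulnC exprSr; ring.
have K2 : 0 <= 4 * (2 * K + K ^+ 2) by rewrite mulr_ge0 // addr_ge0 ?sqr_ge0 // mulr_ge0.
have lim : ccvg (fun=> Edef t) 0.
  apply: (@ccvg_squeeze _ _ _ (fun k => 4 * (2 * K + K ^+ 2) * ((2 ^ k)%N%:R * r ^+ (2 ^ k))) 0%N).
    move=> k _; rewrite subr0 (iter k) cabsM cabsX cabsN cabs_nat.
    apply: (@le_trans _ _ (2 ^+ k * (4 * (2 * K + K ^+ 2) * cabs (t ^+ (2 ^ k))))).
      rewrite ler_wpM2l ?exprn_ge0 // small // cabsX -/r -[leRHS]expr1.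
      by apply: expr_le_geom; rewrite ?expn_gt0.
    by rewrite cabsX -/r natrX le_eqVlt; apply/orP; left; apply/eqP; ring.
  rewrite -[X in _ --> X](mulr0 (4 * (2 * K + K ^+ 2))).
  apply: cvgM; first exact: cvg_cst.
  (* The sequence [2^k r^(2^k)] is read as a subsequence of [n r^n]. *)
  have h := bser_cvg0 (bser_natr_geom hr).
  apply: cvg_real_seq => e e0; move/cvgrPdist_lt: h => /(_ e e0) [N _ hN].
  exists N => k Nk; have := hN (2 ^ k).-1.
  rewrite /= prednK ?expn_gt0 // sub0r normrN subr0; apply.
  by have := ltn_expl k (isT : 1 < 2)%N; lia.
exact: ccvg_unique (ccvg_cst _) lim.
Qed.

(** The quartic identity [theta_3^4 = theta_4^4 + theta_2^4] is transported to Euler products by the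
    three product formulas. *)
Lemma jacobi_alg (S : comNzRingType) (t a b c d x y u : S) :
  b ^+ 2 = d * x -> a ^+ 2 = d * y -> c ^+ 2 = d * u ->
  x ^+ 4 - y ^+ 4 = 16 * t * u ^+ 4 -> b ^+ 8 = a ^+ 8 + 16 * t * c ^+ 8.
Proof.
move=> h1 h2 h3 h4.
have -> : b ^+ 8 = (b ^+ 2) ^+ 4 by ring.
have -> : a ^+ 8 = (a ^+ 2) ^+ 4 by ring.
have -> : c ^+ 8 = (c ^+ 2) ^+ 4 by ring.
rewrite h1 h2 h3.
have -> : (d * x) ^+ 4 = d ^+ 4 * (x ^+ 4 - y ^+ 4 + y ^+ 4) by ring.
by rewrite h4; ring.
Qed.

(** In the eighth powers [A] of [a] and [D] of [c] it is a polynomial identity: expanding the cube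
    of [A + 16 t D], the term [A^3] cancels, the term [D^3] cancels [2^11], and the middle terms
    factor with -24. *)
Lemma hecke_alg (F : numFieldType) (t a b c d : F) :
  a * b * c = d ^+ 3 -> b ^+ 8 = a ^+ 8 + 16 * t * c ^+ 8 ->
  2 ^+ 11 * (t ^+ 4 * c ^+ 24) + 2^-1 * (t * a ^+ 24 - t * b ^+ 24) = - 24 * (t ^+ 2 * d ^+ 24).
Proof.
move=> h1 h2.
have -> : d ^+ 24 = (d ^+ 3) ^+ 8 by ring.
rewrite -h1.
have -> : (a * b * c) ^+ 8 = a ^+ 8 * b ^+ 8 * c ^+ 8 by ring.
have -> : b ^+ 24 = (b ^+ 8) ^+ 3 by ring.
have -> : a ^+ 24 = (a ^+ 8) ^+ 3 by ring.
have -> : c ^+ 24 = (c ^+ 8) ^+ 3 by ring.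
by rewrite h2; move: (a ^+ 8) (c ^+ 8) => A D; field.
Qed.

Lemma jacobi_identity t : cabs t < 1 -> t != 0 ->
  E (- t) ^+ 8 = E t ^+ 8 + 16 * t * E (t ^+ 4) ^+ 8.
Proof.
move=> t1 t0; have n1 : cabs (- t) < 1 by rewrite cabsN.
have t2 : cabs (t ^+ 2) < 1 := cabsX_lt1 1 t1.
have t20 : t ^+ 2 != 0 by rewrite expf_neq0.
have h1 := th3_split t1; have h2 := th3_split n1.
have e4 : (- t) ^+ 4 = t ^+ 4 by ring.
rewrite e4 in h2.
have h3 := Edef0 t1 t0; rewrite /Edef in h3.
have h5 := th3_th2_mul t2 t20; rewrite -exprM /= in h5.
have h6 := th3_th2_mul t1 t0.
have k1 := th3_prod t1 t0; have k2 := th3_prod_neg t1 t0; have k3 := th2_prod t1 t0.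
have d1 : th3 t ^+ 2 - th3 (- t) ^+ 2 = 8 * t * th2 (t ^+ 2) ^+ 2.
  by rewrite -h5 h1 h2; move: (th3 (t ^+ 4)) (th2 (t ^+ 4)) => a b; ring.
have d2 : th3 t ^+ 4 - th3 (- t) ^+ 4 = 16 * t * th2 t ^+ 4.
  have -> : th3 t ^+ 4 - th3 (- t) ^+ 4 = (th3 t ^+ 2 - th3 (- t) ^+ 2) *
     ((th3 t ^+ 2 + th3 (- t) ^+ 2 - 2 * th3 (t ^+ 2) ^+ 2) + 2 * th3 (t ^+ 2) ^+ 2).
    by move: (th3 t) (th3 (- t)) (th3 (t ^+ 2)) => a b c; ring.
  rewrite d1 h3 add0r (_ : th2 t ^+ 4 = (th2 t ^+ 2) ^+ 2); last by rewrite -exprM.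
  by rewrite -h6; move: (th2 (t ^+ 2)) (th3 (t ^+ 2)) => a b; ring.
exact: jacobi_alg k1 k2 k3 d2.
Qed.

Lemma Eul_pow e q : cabs q < 1 -> Eul e q = E q ^+ e.
Proof.
move=> q1; apply: (ccvg_unique (Eul_cvg e q1)).
apply: (ccvg_eq (N0 := 0%N) _ (ccvgX e (poch_cvg q1))) => N _.
by rewrite /poch prodrXl.
Qed.

(** With [t = qe (z / 2)], the four values of [Delta] are the Euler products at [t], [- t], [t^2]
    and [t^4]. *)
Lemma hecke_two z : 0 < complex.Im z ->
  2 ^+ 11 * Del (2 * z) + 2^-1 * (Del (z / 2) + Del ((z + 1) / 2)) = - 24 * Del z.
Proof.
move=> z0.
have half (w : C) : complex.Im (w / 2) = complex.Im w / 2.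
  have -> : (2^-1 : C) = (2^-1 : R)%:C by rewrite fmorphV rmorph_nat.
  by rewrite ImM /= mulr0 add0r.
have i1 : 0 < complex.Im (2 * z) by rewrite ImZn mulr_gt0.
have i2 : 0 < complex.Im (z / 2) by rewrite half divr_gt0.
have i3 : 0 < complex.Im ((z + 1) / 2) by rewrite half divr_gt0 // ImD addr0.
have q1 := cabs_qe_lt1 i2; set t := qe (z / 2) in q1.
have t0 : t != 0 := qe_neq0 _.
have n1 : cabs (- t) < 1 by rewrite cabsN.
rewrite !DelE // qe_halve1 -/t.
have e1 : qe z = t ^+ 2 by rewrite qe_halve.
have e2 : qe (2 * z) = t ^+ 4 by rewrite qeMn e1 -exprM.
rewrite e1 e2 (Eul_pow 24 q1) (Eul_pow 24 n1) (Eul_pow 24 (cabsX_lt1 1 q1)).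
rewrite (Eul_pow 24 (cabsX_lt1 3 q1)).
have := jacobi_identity q1 t0; have := Eul_quad q1.
by rewrite [- t * _]mulNr; exact: hecke_alg.
Qed.

End JacobiHecke.

(** * Primitives of [Delta] times a polynomial, and limits at cusps *)

Section EichlerPrimitive.
Variable R : realType.
Notation C := (complex R).
Implicit Types (z w : C) (p : {poly C}) (a : nat -> C).
Local Notation tau := (@ctau R).

Lemma cderiv_horner p z : cderiv (fun x => p.[x]) z (p^`()).[z].
Proof.
elim/poly_ind: p => [|p c IH].
  rewrite deriv0 horner0; under eq_fun do rewrite horner0; exact: cderiv_cst.
under eq_fun do rewrite hornerMXaddC.
apply: cderiv_eq (cderivD (cderivM IH (cderiv_id z)) (cderiv_cst c z)).
by rewrite derivD derivM derivX derivC !addr0 mulr1 hornerD hornerM hornerX mulr1.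
Qed.

(** Coefficients of the primitive that vanishes at infinity. *)
Definition inta a (k : nat) : C := a k / (tau * k.+1%:R).

Lemma adm_inta a : adm a -> adm (inta a).
Proof.
apply: (@adm_le _ _ _ (cabs tau)^-1); first by rewrite invr_ge0 cabs_ge0.
move=> k; rewrite /inta cabsM cabsV cabsM cabs_nat mulrC invfM -mulrA ler_wpM2l ?invr_ge0 ?cabs_ge0 //.
by rewrite ler_piMl ?cabs_ge0 // invf_le1 ?ltr0n // ler1n.
Qed.

Lemma cderiv_inta a z : adm a -> 0 < complex.Im z -> cderiv (qser (inta a)) z (qser a z).
Proof.
move=> ha z0; apply: cderiv_eq (cderiv_qser (adm_inta ha) z0).
have h := csumZ tau (qserP (adm_natr (adm_inta ha)) z0).
apply: (csum_unique h); apply: csum_eq (qserP ha z0) => k.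
rewrite /inta; have t0 := ctau_neq0 R; have k0 : (k.+1%:R : C) != 0 by rewrite pnatr_eq0.
by move: k0; move: (k.+1%:R) (qe z ^+ _) (a k) => n q b n0; field; rewrite n0 t0.
Qed.

(* Repeated integration by parts. *)
Fixpoint Prim (n : nat) a p z : C :=
  if n is m.+1 then qser (inta a) z * p.[z] - Prim m (inta a) p^`() z else 0.

Lemma cderiv_Prim n a p z : adm a -> (size p <= n)%N -> 0 < complex.Im z ->
  cderiv (Prim n a p) z (qser a z * p.[z]).
Proof.
elim: n a p => [|n IH] a p ha sp z0.
  move: sp; rewrite leqn0 size_poly_eq0 => /eqP ->; rewrite horner0 mulr0 /=.
  exact: cderiv_cst.
have sp' : (size p^`() <= n)%N.
  by apply: leq_trans (size_poly _ _) _; move: sp; case: (size p).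
have := cderivB (cderivM (cderiv_inta ha z0) (cderiv_horner p z)) (IH _ _ (adm_inta ha) sp' z0).
by apply: cderiv_eq; rewrite addrK.
Qed.

Lemma Prim_linear n a (c : C) p q z :
  Prim n a (c *: p + q) z = c * Prim n a p z + Prim n a q z.
Proof.
elim: n a p q => [|n IH] a p q /=; first by rewrite mulr0 addr0.
by rewrite hornerD hornerZ derivD derivZ IH; ring.
Qed.

(** Nontangential approach to a cusp, with aperture [K]. Translations and inversion preserve these
    regions up to a change of aperture, and geodesics enter them. *)
Definition cusp_near (s : option rat) (K d : R) z : Prop :=
  if s is Some r then cabs (z - (ratr r)%:C) < d /\ cabs (z - (ratr r)%:C) <= K * complex.Im z
  else d^-1 < complex.Im z /\ cabs z <= K * complex.Im z.

Definition conelim (s : option rat) (f : C -> C) (l : C) :=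
  forall K e : R, 0 < K -> 0 < e -> exists2 d : R, 0 < d &
    forall z, 0 < complex.Im z -> cusp_near s K d z -> cabs (f z - l) < e.

Lemma cusp_near_le s K d d' z : 0 < d -> d <= d' -> cusp_near s K d z -> cusp_near s K d' z.
Proof.
move=> d0 dd; case: s => [r|] /= [h1 h2]; split=> //.
  exact: lt_le_trans h1 dd.
by apply: le_lt_trans h1; rewrite lef_pV2 ?posrE // (lt_le_trans d0).
Qed.

Lemma cusp_near_nonempty s d : 0 < d -> exists2 z, 0 < complex.Im z & cusp_near s 1 d z.
Proof.
move=> d0; case: s => [r|].
  exists (ratr r +i* (d / 2)) => /=; first by rewrite divr_gt0.
  have -> : (ratr r +i* (d / 2)) - (ratr r)%:C = 0 +i* (d / 2).
    by apply: complexP => /=; ring.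
  rewrite /cabs /= expr0n add0r sqrtr_sqr ger0_norm ?divr_ge0 ?(ltW d0) //.
  by split; lra.
exists (0 +i* (d^-1 + 1)) => /=; first by rewrite addr_gt0 // invr_gt0.
have h : 0 < d^-1 by rewrite invr_gt0.
rewrite /cabs /= expr0n add0r sqrtr_sqr ger0_norm; last by lra.
by split; lra.
Qed.

Lemma conelim_unique s f k l : conelim s f k -> conelim s f l -> k = l.
Proof.
move=> hk hl; apply/eqP; rewrite -subr_eq0 -cabs_eq0; apply/negPn/negP => h.
have h0 : 0 < cabs (k - l) / 2 by rewrite divr_gt0 // lt_neqAle eq_sym h cabs_ge0.
have [d1 d10 h1] := hk _ _ ltr01 h0; have [d2 d20 h2] := hl _ _ ltr01 h0.
have dm : 0 < Num.min d1 d2 by rewrite lt_min d10.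
have [z z0 hz] := cusp_near_nonempty s dm.
have m1 : Num.min d1 d2 <= d1 by rewrite ge_min lexx.
have m2 : Num.min d1 d2 <= d2 by rewrite ge_min lexx orbT.
have a1 := h1 z z0 (cusp_near_le dm m1 hz).
have a2 := h2 z z0 (cusp_near_le dm m2 hz).
have := cabsD (k - f z) (f z - l).
by rewrite addrA subrK (cabsB k); lra.
Qed.

Lemma conelim_eq s f g l : (forall z, 0 < complex.Im z -> f z = g z) ->
  conelim s f l -> conelim s g l.
Proof.
move=> fg h K e K0 e0; have [d d0 hd] := h K e K0 e0; exists d => // z z0 hz.
by rewrite -fg //; exact: hd.
Qed.

Lemma conelim_cst s (c : C) : conelim s (fun=> c) c.
Proof. by move=> K e K0 e0; exists 1 => // z _ _; rewrite subrr cabs0. Qed.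

Lemma conelimD s f g k l : conelim s f k -> conelim s g l ->
  conelim s (fun z => f z + g z) (k + l).
Proof.
move=> hf hg K e K0 e0; have e2 : 0 < e / 2 by rewrite divr_gt0.
have [d1 d10 h1] := hf K _ K0 e2; have [d2 d20 h2] := hg K _ K0 e2.
have dm : 0 < Num.min d1 d2 by rewrite lt_min d10.
exists (Num.min d1 d2) => // z z0 hz.
have m1 : Num.min d1 d2 <= d1 by rewrite ge_min lexx.
have m2 : Num.min d1 d2 <= d2 by rewrite ge_min lexx orbT.
have a1 := h1 z z0 (cusp_near_le dm m1 hz).
have a2 := h2 z z0 (cusp_near_le dm m2 hz).
have := cabsD (f z - k) (g z - l).
by rewrite addrACA -opprD; lra.
Qed.

Lemma conelimZ s (c : C) f l : conelim s f l -> conelim s (fun z => c * f z) (c * l).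
Proof.
move=> hf K e K0 e0; have c1 : 0 < cabs c + 1 by rewrite ltr_wpDl ?cabs_ge0.
have e2 : 0 < e / (cabs c + 1) by rewrite divr_gt0.
have [d d0 h] := hf K _ K0 e2; exists d => // z z0 /(h z z0).
rewrite ltr_pdivlMr // -mulrBr cabsM => hh.
have := cabs_ge0 (f z - l); nra.
Qed.

Definition cusp_shift (s : option rat) (c : rat) : option rat := omap (fun r => r + c) s.

Definition cusp_inv (s : option rat) : option rat :=
  if s is Some r then (if r == 0 then None else Some (- r^-1)) else Some 0.

Lemma conelim_shift s (c : rat) f l :
  conelim s (fun z => f (z + (ratr c)%:C)) l -> conelim (cusp_shift s c) f l.
Proof.
move=> h K e K0 e0; set x : C := (ratr c)%:C.
have Im_x : complex.Im x = 0 by [].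
case: s h => [r|] h /=.
  have [d d0 hd] := h K e K0 e0; exists d => // z z0 [a b].
  have := hd (z - x); rewrite subrK ImD ImN Im_x subr0; apply => //=.
  have E : z - x - (ratr r)%:C = z - (ratr (r + c))%:C.
    by rewrite [ratr (r + c)]rmorphD /= rmorphD /= -/x; ring.
  by rewrite ImD ImN Im_x subr0 E.
have K1 : 0 < K + cabs x by rewrite ltr_wpDr ?cabs_ge0.
have [d d0 hd] := h _ e K1 e0.
exists (Num.min d 1) => [|z z0 [a b]]; first by rewrite lt_min d0 ltr01.
have := hd (z - x); rewrite subrK ImD ImN Im_x subr0; apply => //=.
rewrite ImD ImN Im_x subr0.
have m0 : 0 < Num.min d 1 by rewrite lt_min d0 ltr01.
have m1 : d^-1 <= (Num.min d 1)^-1 by rewrite lef_pV2 ?posrE // ge_min lexx.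
have m2 : 1 <= (Num.min d 1)^-1.
  by rewrite -[leLHS]invr1 lef_pV2 ?posrE // ge_min lexx orbT.
split; first exact: le_lt_trans m1 a.
have := cabsD z (- x); rewrite cabsN.
have : cabs x <= cabs x * complex.Im z by rewrite ler_peMr ?cabs_ge0 //; lra.
lra.
Qed.

(** Infinity and 0 are exchanged with the same aperture. At any other cusp the inversion has bounded
    distortion nearby, and a doubled aperture absorbs it. *)
Lemma conelim_inv s f l :
  conelim s (fun z => f (- z^-1)) l -> conelim (cusp_inv s) f l.
Proof.
move=> h K e K0 e0.
have ImI w : complex.Im (- w^-1) = complex.Im w / cabs w ^+ 2.
  by rewrite ImN ImV mulNr opprK.
have inv2 w : - (- w^-1)^-1 = w by rewrite invrN opprK invrK.
have posI w : 0 < complex.Im w -> 0 < cabs w by move=> /Im_neq0; rewrite cabs_gt0.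
case: s h => [r|] h; last first.
  have [d d0 hd] := h K e K0 e0; exists (d / K) => [|w w0 /=]; first by rewrite divr_gt0.
  rewrite rmorph0 subr0 => -[a b]; have aw := posI w w0.
  have := hd (- w^-1) (Im_inv_opp w0); rewrite inv2; apply => /=.
  rewrite ImI cabsN cabsV; split.
    rewrite ltr_pdivlMr ?exprn_gt0 // mulrC ltr_pdivrMr //.
    move: a; rewrite ltr_pdivlMr // => a; rewrite expr2; nra.
  rewrite -[leLHS]mul1r ler_pdivrMr //.
  have -> : K * (complex.Im w / cabs w ^+ 2) * cabs w = K * complex.Im w / cabs w.
    by field; rewrite gt_eqF.
  by rewrite ler_pdivlMr // mul1r.
rewrite /=; have [r0|rn0] := eqVneq r 0.
  have [d d0 hd] := h K e K0 e0; exists d => // w w0 /= [a b].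
  have aw := posI w w0.
  have := hd (- w^-1) (Im_inv_opp w0); rewrite inv2; apply => /=.
  rewrite r0 rmorph0 subr0 ImI cabsN cabsV; split.
    rewrite -[ltRHS]invrK ltf_pV2 ?posrE ?invr_gt0 //.
    by apply: lt_le_trans a _; apply: le_trans (ler_norm _) (cabs_Im _).
  have -> : K * (complex.Im w / cabs w ^+ 2) = K * complex.Im w / cabs w / cabs w.
    by field; rewrite gt_eqF.
  by rewrite -[leLHS]mul1r ler_pM2r ?invr_gt0 // ler_pdivlMr // mul1r.
set sg : C := (ratr (- r^-1))%:C.
have rho0 : ((ratr r)%:C : C) != 0.
  by rewrite (inj_eq (@complexI R)) fmorph_eq0.
have sE : sg = - ((ratr r)%:C)^-1 by rewrite /sg rmorphN fmorphV rmorphN fmorphV.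
have s0 : sg != 0 by rewrite sE oppr_eq0 invr_eq0.
have as0 : 0 < cabs sg by rewrite cabs_gt0.
have K2 : 0 < 2 * K by rewrite mulr_gt0.
have [d d0 hd] := h _ e K2 e0.
(* The first bound keeps [|w|] between half and twice [|sg|]; the second controls the image distance
   [|w - sg| / |w sg|]. *)
exists (Num.min (cabs sg / 2) (d * cabs sg ^+ 2 / 2)) => [|w w0 /=].
  by rewrite lt_min !divr_gt0 // mulr_gt0 // exprn_gt0.
rewrite -/sg lt_min => -[/andP[a1 a2] b]; have aw := posI w w0; have wn := Im_neq0 w0.
have := hd (- w^-1) (Im_inv_opp w0); rewrite inv2; apply => /=.
have lw : cabs sg / 2 <= cabs w by have := cabsB_ge sg (sg - w); rewrite opprB addrCA subrr addr0 (cabsB sg); lra.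
have uw : cabs w <= 2 * cabs sg by have := cabsD (w - sg) sg; rewrite subrK; lra.
clearbody sg; have E : - w^-1 - (ratr r)%:C = (w - sg) / (w * sg).
  have -> : ((ratr r)%:C : C) = - sg^-1 by rewrite sE invrN invrK opprK.
  by field; rewrite s0 wn.
rewrite E ImI cabsM cabsV cabsM; split.
  rewrite ltr_pdivrMr ?mulr_gt0 //; apply: lt_le_trans a2 _.
  rewrite expr2 -!mulrA ler_wpM2l ?(ltW d0) //.
  by rewrite mulrCA mulrC ler_wpM2r ?(ltW as0) // mulrC.
rewrite ler_pdivrMr ?mulr_gt0 //; apply: le_trans b _.
have -> : 2 * K * (complex.Im w / cabs w ^+ 2) * (cabs w * cabs sg) =
   K * complex.Im w * (2 * cabs sg / cabs w) by field; rewrite gt_eqF.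
rewrite -[leLHS]mulr1 ler_wpM2l ?mulr_ge0 ?(ltW K0) ?(ltW w0) //.
by rewrite ler_pdivlMr // mul1r.
Qed.

Lemma qser_le a : adm a -> exists2 B : R, 0 <= B & forall z, 1 <= complex.Im z ->
  cabs (qser a z) <= B * expR (- (2 * pi * complex.Im z)).
Proof.
move=> ha; pose r : R := expR (- (2 * pi)).
have p0 : 0 < 2 * pi :> R by rewrite mulr_gt0 // pi_gt0.
have hr : 0 <= r < 1 by rewrite expR_ge0 -[X in _ < X]expR0 ltr_expR oppr_lt0.
have [b0 [B hB]] := adm_bser ha hr.
exists B => [|z z1]; first by apply: le_trans (hB 0%N); rewrite big_ord0.
have z0 : 0 < complex.Im z by apply: lt_le_trans z1.
have -> : B * expR (- (2 * pi * complex.Im z)) = expR (- (2 * pi * complex.Im z)) * B by rewrite mulrC.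
apply: (csum_cabs_le (b := fun k => expR (- (2 * pi * complex.Im z)) * (cabs (a k) * r ^+ k)) (qserP ha z0)).
  move=> k; rewrite cabsM cabsX cabs_qe exprS mulrCA ler_wpM2l ?expR_ge0 //.
  rewrite ler_wpM2l ?cabs_ge0 // lerXn2r ?nnegrE ?expR_ge0 // ler_expR lerN2.
  by rewrite ler_peMr // ltW.
by move=> n; rewrite -mulr_sumr ler_wpM2l ?expR_ge0.
Qed.

Lemma horner_growth p : exists2 M : R, 0 <= M & forall z, 1 <= cabs z ->
  cabs p.[z] <= M * cabs z ^+ size p.
Proof.
exists (\sum_(i < size p) cabs p`_i); first by rewrite sumr_ge0 // => i _; exact: cabs_ge0.
move=> z z1; rewrite horner_coef; apply: le_trans (cabs_sum _ _ _) _.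
rewrite mulr_suml; apply: ler_sum => i _; rewrite cabsM cabsX ler_wpM2l ?cabs_ge0 //.
by apply: ler_weXn2l => //; exact: ltnW.
Qed.

Lemma expR_neg_le (x : R) m : 0 < x -> expR (- x) <= m.+1`!%:R / x ^+ m.+1.
Proof.
move=> x0; have F : 0 < m.+1`!%:R :> R by rewrite ltr0n fact_gt0.
rewrite expRN -[leRHS]invrK lef_pV2 ?posrE ?expR_gt0 ?invr_gt0 ?divr_gt0 ?exprn_gt0 //.
by rewrite invf_div; apply: le_trans (expR_ge1Dxn m (ltW x0)); rewrite lerDr.
Qed.

(** In a region [|z| <= K Im z] the polynomial is bounded by a power of [Im z], and the exponential
    decay is compared with one power more, leaving order [1 / Im z]. *)
Lemma qser_decay a p : adm a -> conelim None (fun z => qser a z * p.[z]) 0.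
Proof.
move=> ha K e K0 e0; have [B B0 hB] := qser_le ha; have [M M0 hM] := horner_growth p.
set m := size p in hM.
pose Q := B * M * K ^+ m * m.+1`!%:R; have Q0 : 0 <= Q.
  have k0 : 0 <= K ^+ m by rewrite exprn_ge0 // ltW.
  by rewrite /Q mulr_ge0 // mulr_ge0 // mulr_ge0.
have Qe : 0 < Q / e + 1 by rewrite ltr_wpDl // divr_ge0 // ltW.
exists (Q / e + 1)^-1; first by rewrite invr_gt0.
move=> z z0 /= [a1 a2]; rewrite invrK in a1; set y := complex.Im z in z0 a1 a2 *.
have Qe0 : 0 <= Q / e by rewrite divr_ge0 // ltW.
have y1 : 1 <= y by lra.
have yz : y <= cabs z by apply: le_trans (ler_norm _) (cabs_Im _).
have h1 := hB z y1; have h2 := hM z (le_trans y1 yz).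
rewrite subr0 cabsM.
have s0 : 0 < 2 * pi * y by rewrite !mulr_gt0 // pi_gt0.
have h3 := expR_neg_le m s0.
have h4 : cabs z ^+ m <= (K * y) ^+ m by rewrite lerXn2r ?nnegrE ?cabs_ge0 ?mulr_ge0 // ltW.
have h5 : (2 * pi * y) ^- m.+1 <= y ^- m.+1.
  rewrite lef_pV2 ?posrE ?exprn_gt0 // lerXn2r ?nnegrE ?(ltW z0) ?(ltW s0) //.
  by rewrite ler_peMl ?(ltW z0) //; have := pi_ge2 R; lra.
apply: (@le_lt_trans _ _ (Q / y)); last first.
  rewrite ltr_pdivrMr // mulrC -ltr_pdivrMr //; lra.
apply: (@le_trans _ _ ((B * (m.+1`!%:R * y ^- m.+1)) * (M * (K * y) ^+ m))).
  apply: ler_pM; rewrite ?cabs_ge0 //.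
    apply: le_trans h1 _; rewrite ler_wpM2l //; apply: le_trans h3 _.
    by rewrite ler_wpM2l.
  by apply: le_trans h2 _; rewrite ler_wpM2l.
rewrite le_eqVlt; apply/orP; left; apply/eqP; rewrite /Q exprMn exprS.
have : y ^+ m != 0 by rewrite expf_neq0 // gt_eqF.
by move: (y ^+ m) (K ^+ m) (m.+1`!%:R) => u v n u0; field; rewrite u0 gt_eqF.
Qed.

Lemma Prim_decay n a p : adm a -> conelim None (Prim n a p) 0.
Proof.
elim: n a p => [|n IH] a p ha; first exact: conelim_cst.
have := conelimD (qser_decay p (adm_inta ha)) (conelimZ (-1) (IH _ p^`() (adm_inta ha))).
by rewrite mulr0 addr0; apply: conelim_eq => z _ /=; rewrite mulN1r.
Qed.

End EichlerPrimitive.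

(** * Cusp values of the primitives and their behaviour under the generators *)

Section PeriodFunctional.
Variable R : realType.
Notation C := (complex R).
Implicit Types (z w : C) (p q : {poly C}) (s : option rat).

(** Euclid's algorithm, by induction on a bound for the denominator: translation reduces the
    numerator modulo the denominator, and inversion then exchanges the two. *)
Lemma cusp_ind (P : option rat -> Prop) : P None ->
  (forall s, P s -> P (cusp_shift s 1)) -> (forall s, P s -> P (cusp_shift s (-1))) ->
  (forall s, P s -> P (cusp_inv s)) -> forall s, P s.
Proof.
move=> PN Pp Pm PI.
have Pshift (m : int) r : P (Some r) -> P (Some (r + m%:~R)).
  move=> Pr; case: m => k.
    rewrite -pmulrn; elim: k => [|k IH]; first by rewrite addr0.
    by have := Pp _ IH; rewrite /= -addrA natr1.
  rewrite NegzE mulrNz -pmulrn; elim: k.+1 => [|j IH]; first by rewrite subr0.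
  by have := Pm _ IH; rewrite /= -addrA -opprD natr1.
have main n : forall (a : int) (b : nat), (0 < b <= n)%N -> P (Some (a%:~R / b%:R)).
  elim: n => [|n IH] a b /andP[b0 bn]; first by case: b b0 bn.
  have bq : (b%:R : rat) != 0 by rewrite pnatr_eq0 -lt0n.
  have E := divz_eq a b%:Z; set q := (a %/ b)%Z in E; set r := (a %% b)%Z in E.
  have r0 : 0 <= r by apply: modz_ge0; rewrite eqz_nat -lt0n.
  have rb : r < b by apply: ltz_pmod; rewrite ltz_nat.
  have -> : a%:~R / b%:R = r%:~R / b%:R + q%:~R :> rat.
    by rewrite E intrD intrM -pmulrn; field.
  apply: Pshift; case: r r0 rb {E} => // k _ kb; rewrite -pmulrn.
  case: k kb => [|k] kb; first by rewrite mul0r; exact: (PI None PN).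
  have kq : (k.+1%:R : rat) != 0 by rewrite pnatr_eq0.
  have hk : (0 < k.+1 <= n)%N by rewrite /=; move: kb bn; rewrite ltz_nat; exact: leq_trans.
  (* [(k + 1) / b] is the image under [cusp_inv] of [- b / (k + 1)], whose denominator is
     smaller. *)
  have := PI _ (IH (- b%:Z) k.+1 hk); rewrite /= mulf_eq0 invr_eq0 (negPf kq) orbF.
  rewrite intrN oppr_eq0 -pmulrn (negPf bq) mulNr invrN opprK invf_div.
  exact.
case=> [r|] //; rewrite -[r]divq_num_den.
have d0 := denq_gt0 r; have -> : (denq r)%:~R = `|denq r|%N%:R :> rat.
  by rewrite pmulrn gez0_abs // ltW.
by apply: (main `|denq r|%N); rewrite leqnn andbT absz_gt0 gt_eqF.
Qed.

(** Eleven integrations by parts exhaust a polynomial of degree at most 10. *)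
Definition Delprim p z : C := Prim 11 (eulc R 24) p z.

Lemma cderiv_Delprim p z : (size p <= 11)%N -> 0 < complex.Im z -> cderiv (Delprim p) z (Del z * p.[z]).
Proof. by move=> sp z0; apply: cderiv_Prim => //; exact: adm_eulc. Qed.

Lemma Delprim_decay p : conelim None (Delprim p) 0.
Proof. by apply: Prim_decay; exact: adm_eulc. Qed.

Lemma Delprim_linear (c : C) p q z : Delprim (c *: p + q) z = c * Delprim p z + Delprim q z.
Proof. exact: Prim_linear. Qed.

Lemma Del_shift z (c : C) : qe c = 1 -> Del (z + c) = Del z.
Proof. by move=> c1; rewrite /Del /qser qeD c1 mulr1. Qed.

Local Opaque Delprim Del.

Lemma size_shift p (c : C) : size (p \Po ('X + c%:P)) = size p.
Proof. by rewrite size_comp_poly2 // size_XaddC. Qed.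

Lemma horner_shift p (c z : C) : (p \Po ('X + c%:P)).[z] = p.[z + c].
Proof. by rewrite horner_comp hornerD hornerX hornerC. Qed.

(** The polynomial [z^k p(- 1 / z)]: coefficients reversed, with signs. *)
Definition slash (k : nat) p : {poly C} := \poly_(i < k.+1) (p`_(k - i) * (-1) ^+ (k - i)).

Lemma size_slash k p : (size (slash k p) <= k.+1)%N.
Proof. exact: size_poly. Qed.

Lemma horner_slash k p z : (size p <= k.+1)%N -> z != 0 ->
  (slash k p).[z] = z ^+ k * p.[- z^-1].
Proof.
move=> sp z0; rewrite horner_poly (horner_coef_wide _ sp) mulr_sumr.
rewrite (reindex_inj rev_ord_inj) /=; apply: eq_bigr => i _.
have ik : (i <= k)%N by rewrite -ltnS.
rewrite subSS subKn // [(- z^-1) ^+ i]exprNn exprVn.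
have -> : z ^+ k = z ^+ (k - i) * z ^+ i by rewrite -exprD subnK.
have : z ^+ i != 0 by rewrite expf_neq0.
move: (z ^+ i) (z ^+ (k - i)) (p`_i) ((-1) ^+ i) => u v x y u0; by field.
Qed.

Lemma conelim_None_shift f (c : rat) l : conelim None (fun z : C => f z : C) l ->
  conelim None (fun z => f (z + (ratr c)%:C)) l.
Proof.
move=> h; apply: (@conelim_shift R None (- c)).
apply: conelim_eq h => z _ /=; congr f.
by rewrite rmorphN /= rmorphN /= subrK.
Qed.

Lemma cderiv_addr (f : C -> C) (c z l : C) : cderiv f (z + c) l ->
  cderiv (fun x => f (x + c)) z l.
Proof.
by move=> h e /h [d d0 hd]; exists d => // k /hd; rewrite [z + c + k]addrAC.
Qed.

Lemma const_eq (f : C -> C) l : (forall z, 0 < complex.Im z -> cderiv f z 0) ->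
  conelim None f l -> forall z, 0 < complex.Im z -> f z = l.
Proof.
move=> df lim z z0; have h := cderiv0_cst df; apply: (@conelim_unique R None (fun=> f z)).
  exact: conelim_cst.
by apply: conelim_eq lim => w w0; exact: h.
Qed.

(** Both sides are primitives of the same function and vanish at infinity. *)
Lemma Delprim_shift p (c : rat) z : (size p <= 11)%N -> qe ((ratr c)%:C : C) = 1 ->
  0 < complex.Im z -> Delprim p (z + (ratr c)%:C) = Delprim (p \Po ('X + (ratr c)%:C%:P)) z.
Proof.
move=> sp c1 z0; set x : C := (ratr c)%:C in c1 *.
have h := @const_eq (fun z => Delprim p (z + x) - Delprim (p \Po ('X + x%:P)) z) 0.
apply/eqP; rewrite -subr_eq0; apply/eqP; apply: h => // [w w0|].
  have wx : 0 < complex.Im (w + x) by rewrite ImD addr0.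
  have := cderivB (cderiv_addr (cderiv_Delprim sp wx)) (cderiv_Delprim (p := p \Po ('X + x%:P)) _ w0).
  rewrite size_shift horner_shift Del_shift // subrr; exact.
have := conelimD (conelim_None_shift c (Delprim_decay p)) (conelimZ (-1) (Delprim_decay (p \Po ('X + x%:P)))).
by rewrite mulr0 addr0; apply: conelim_eq => w _; rewrite mulN1r.
Qed.

(** The constant of integration for inversion, evaluated at the fixed point [i]; [cuspint_inv]
    identifies it with the value at the cusp 0. *)
Definition kap p : C := Delprim p (0 +i* 1) - Delprim (slash 10 p) (0 +i* 1).

(** The factor [z^12] from modularity and [z^-2] from the derivative of [- 1 / z] leave
    [z^10 p(- 1 / z)], so the two sides have equal derivatives. *)
Lemma Delprim_inv p z : (size p <= 11)%N -> 0 < complex.Im z ->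
  Delprim p (- z^-1) = Delprim (slash 10 p) z + kap p.
Proof.
move=> sp z0; pose f w := Delprim p (- w^-1) - Delprim (slash 10 p) w.
have df w : 0 < complex.Im w -> cderiv f w 0.
  move=> w0; have wn := Im_neq0 w0; have v0 := Im_inv_opp w0.
  have := cderivB (cderiv_comp (cderiv_opp_inv wn) (cderiv_Delprim sp v0))
    (cderiv_Delprim (size_slash 10 p) w0).
  apply: cderiv_eq; rewrite horner_slash // Del_inv //.
  have -> : w ^+ 12 = w ^+ 2 * w ^+ 10 by rewrite -exprD.
  have w2 : w ^+ 2 != 0 by rewrite expf_neq0.
  by move: w2; move: (w ^+ 2) (w ^+ 10) (Del w) (p.[_]) => a b c d a0; field.
have i0 : 0 < complex.Im (0 +i* 1 : C) by [].
have iV : - (0 +i* 1)^-1 = 0 +i* 1 :> C.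
  have iin := Im_neq0 i0; apply: (mulfI iin); rewrite mulrN divff //.
  by apply: complexP => /=; ring.
rewrite /kap; move: i0 iV; move: (0 +i* 1 : C) => ii i0 iV.
have e : Delprim p (- z^-1) - Delprim (slash 10 p) z = Delprim p (- ii^-1) - Delprim (slash 10 p) ii.
  exact: (cderiv0_cst df z0 i0).
have iV' : Delprim p (- ii^-1) = Delprim p ii by congr (Delprim p _).
have {iV'}e := etrans e (congr1 (fun x => x - Delprim (slash 10 p) ii) iV').
by apply/eqP; rewrite addrC -subr_eq; apply/eqP; exact: e.
Qed.

Lemma ratr1 : (ratr 1 : R) = 1. Proof. exact: rmorph1. Qed.

Lemma qe_shift1 : qe ((ratr 1)%:C : C) = 1.
Proof. by rewrite rmorph1 rmorph1 qe1. Qed.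

Lemma qe_shiftN1 : qe ((ratr (-1))%:C : C) = 1.
Proof. by rewrite rmorphN1 rmorphN rmorph1 qeN qe1 invr1. Qed.

Lemma conelim_Delprim_shift p s (c : rat) l : (size p <= 11)%N -> qe ((ratr c)%:C : C) = 1 ->
  conelim s (Delprim (p \Po ('X + (ratr c)%:C%:P))) l -> conelim (cusp_shift s c) (Delprim p) l.
Proof.
move=> sp c1 h; apply: conelim_shift; apply: conelim_eq h => z z0.
by rewrite Delprim_shift.
Qed.

Lemma conelim_Delprim_inv p s l : (size p <= 11)%N ->
  conelim s (Delprim (slash 10 p)) l -> conelim (cusp_inv s) (Delprim p) (l + kap p).
Proof.
move=> sp h; apply: conelim_inv; apply: conelim_eq (conelimD h (conelim_cst s (kap p))) => z z0.
by rewrite Delprim_inv.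
Qed.

Lemma Delprim_lim s p : (size p <= 11)%N -> exists l, conelim s (Delprim p) l.
Proof.
elim/cusp_ind: s p => [|s IH|s IH|s IH] p sp.
- by exists 0; exact: Delprim_decay.
- have [|l hl] := IH (p \Po ('X + (ratr 1)%:C%:P)); first by rewrite size_shift.
  by exists l; apply: conelim_Delprim_shift hl => //; exact: qe_shift1.
- have [|l hl] := IH (p \Po ('X + (ratr (-1))%:C%:P)); first by rewrite size_shift.
  by exists l; apply: conelim_Delprim_shift hl => //; exact: qe_shiftN1.
- have [l hl] := IH _ (size_slash 10 p).
  by exists (l + kap p); apply: conelim_Delprim_inv.
Qed.

(* The integral of [Del(z) p(z) dz] from [oo] to the cusp [s]. *)
Definition cuspint s p : C := xget 0 [set l | conelim s (Delprim p) l].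

Lemma cuspintP s p : (size p <= 11)%N -> conelim s (Delprim p) (cuspint s p).
Proof. by move=> /(Delprim_lim s) [l hl]; exact: (@xgetI _ 0 [set l | conelim s (Delprim p) l] l hl). Qed.

Lemma cuspintE s p l : (size p <= 11)%N -> conelim s (Delprim p) l -> cuspint s p = l.
Proof. by move=> sp h; exact: conelim_unique (cuspintP s sp) h. Qed.

Lemma cuspint_oo p : (size p <= 11)%N -> cuspint None p = 0.
Proof. by move=> sp; apply: cuspintE => //; exact: Delprim_decay. Qed.

Lemma cuspint_linear s (c : C) p q : (size p <= 11)%N -> (size q <= 11)%N ->
  cuspint s (c *: p + q) = c * cuspint s p + cuspint s q.
Proof.
move=> sp sq; apply: cuspintE.
  rewrite (leq_trans (size_polyD _ _)) // geq_max sq andbT.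
  by rewrite (leq_trans (size_scale_leq _ _)).
apply: conelim_eq (conelimD (conelimZ c (cuspintP s sp)) (cuspintP s sq)) => z z0.
by rewrite Delprim_linear.
Qed.

Lemma cuspint_shift s (c : rat) p : (size p <= 11)%N -> qe ((ratr c)%:C : C) = 1 ->
  cuspint (cusp_shift s c) p = cuspint s (p \Po ('X + (ratr c)%:C%:P)).
Proof.
move=> sp c1; apply: cuspintE => //; apply: conelim_Delprim_shift => //.
by apply: cuspintP; rewrite size_shift.
Qed.

(** The case [s = oo] shows that [kap p] is the value at 0, because the primitive vanishes at
    infinity. *)
Lemma cuspint_inv s p : (size p <= 11)%N ->
  cuspint (cusp_inv s) p = cuspint s (slash 10 p) + cuspint (Some 0) p.
Proof.
move=> sp; have k : cuspint (Some 0) p = kap p.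
  apply: cuspintE => //; rewrite -[kap p]add0r; apply: (@conelim_Delprim_inv p None) => //.
  exact: Delprim_decay.
by rewrite k; apply: cuspintE => //; apply: conelim_Delprim_inv => //; apply: cuspintP; exact: size_slash.
Qed.

(** The degree bound is 12 because inversion sends [Delta p] to [Delta] times the weight-12 [slash]
    of [p], which may have that degree. *)
Lemma Del_cusp_decay s p : (size p <= 13)%N -> conelim s (fun z => Del z * p.[z]) 0.
Proof.
elim/cusp_ind: s p => [|s IH|s IH|s IH] p sp.
- by apply: qser_decay; exact: adm_eulc.
- apply: conelim_shift; have := IH (p \Po ('X + (ratr 1)%:C%:P)).
  rewrite size_shift => /(_ sp); apply: conelim_eq => z z0.
  by rewrite horner_shift Del_shift // qe_shift1.
- apply: conelim_shift; have := IH (p \Po ('X + (ratr (-1))%:C%:P)).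
  rewrite size_shift => /(_ sp); apply: conelim_eq => z z0.
  by rewrite horner_shift Del_shift // qe_shiftN1.
- apply: conelim_inv; apply: conelim_eq (IH _ (size_slash 12 p)) => z z0.
  by rewrite horner_slash ?Im_neq0 // Del_inv // mulrCA mulrA.
Qed.

End PeriodFunctional.

(** * Fundamental theorem of calculus on open and unbounded intervals *)

Section ImproperFTC.
Variable R : realType.
Notation C := (complex R).
Local Notation mu := (@lebesgue_measure R).

(** The functions are replaced by their continuous extensions, [f1] with value 0 and [g1] with the
    limits [ga] and [gb] at the ends; the open interval does not see the change. *)
Lemma FTC_oo (g f : R -> R) (a b ga gb : R) : a < b ->
  (forall t : R, t \in `]a, b[ -> is_derive t 1 g (f t)) -> {in `]a, b[, continuous f} ->
  f t @[t --> a^'+] --> (0 : R) -> f t @[t --> b^'-] --> (0 : R) ->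
  g t @[t --> a^'+] --> ga -> g t @[t --> b^'-] --> gb ->
  Rintegral mu `]a, b[ f = gb - ga.
Proof.
move=> ab dg cf fa fb cga cgb.
pose f1 t := if t \in `]a, b[ then f t else 0.
pose g1 t := if t <= a then ga else if b <= t then gb else g t.
have nab t : t \in `]a, b[ -> \near t, f t = f1 t.
  move=> tab; have := near_in_itvoo tab; apply: filterS => x xab.
  by rewrite /f1 xab.
have nabg t : t \in `]a, b[ -> \near t, g t = g1 t.
  move=> tab; have := near_in_itvoo tab; apply: filterS => x.
  by rewrite in_itv /= /g1 => /andP[ax xb]; rewrite leNgt ax leNgt xb.
have near_a (h : R -> Prop) : (forall t, a < t < b -> h t) -> \forall t \near a^'+, h t.
  move=> hh; near=> t; apply: hh; apply/andP; split => //.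
have near_b (h : R -> Prop) : (forall t, a < t < b -> h t) -> \forall t \near b^'-, h t.
  move=> hh; near=> t; apply: hh; apply/andP; split => //.
have f1a : f1 t @[t --> a^'+] --> (0 : R).
  apply: cvg_trans fa; apply: near_eq_cvg; apply: near_a => t tab.
  by rewrite /f1 in_itv /= tab.
have f1b : f1 t @[t --> b^'-] --> (0 : R).
  apply: cvg_trans fb; apply: near_eq_cvg; apply: near_b => t tab.
  by rewrite /f1 in_itv /= tab.
have g1a : g1 t @[t --> a^'+] --> ga.
  apply: cvg_trans cga; apply: near_eq_cvg; apply: near_a => t /andP[h1 h2].
  by rewrite /g1 leNgt h1 leNgt h2.
have g1b : g1 t @[t --> b^'-] --> gb.
  apply: cvg_trans cgb; apply: near_eq_cvg; apply: near_b => t /andP[h1 h2].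
  by rewrite /g1 leNgt h1 leNgt h2.
have f1_a : f1 a = 0 by rewrite /f1 in_itv /= ltxx.
have f1_b : f1 b = 0 by rewrite /f1 in_itv /= ltxx andbF.
have g1_a : g1 a = ga by rewrite /g1 lexx.
have g1_b : g1 b = gb by rewrite /g1 leNgt ab lexx.
have dg1 (t : R) : t \in `]a, b[ -> is_derive t 1 g1 (f1 t).
  move=> tab; rewrite /f1 tab; apply: near_eq_is_derive (dg t tab); exact: nabg.
have cf1 : {within `[a, b], continuous f1}.
  apply/continuous_within_itvP => //; rewrite f1_a f1_b; split => // t tab.
  have h := cf t tab; apply: cvg_trans; last first.
    by rewrite /f1 tab; exact: h.
  by apply: near_eq_cvg; exact: nab.
have lr : derivable_oo_LRcontinuous g1 a b.
  split; rewrite ?g1_a ?g1_b // => t tab; exact: (@ex_derive _ _ _ _ _ _ _ (dg1 t tab)).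
have ftc := continuous_FTC2 ab cf1 lr.
have {}ftc := ftc (fun t tab => etrans (derive1E _ _) (@derive_val _ _ _ _ _ _ _ (dg1 t tab))).
have -> : Rintegral mu `]a, b[ f = Rintegral mu `]a, b[ f1.
  apply: eq_Rintegral => t; rewrite inE /= => tab; by rewrite /f1 tab.
have mf1 : measurable_fun `[a, b] f1.
  by apply: subspace_continuous_measurable_fun => //; exact: measurable_itv.
rewrite /Rintegral -(integral_itv_bndoo true false) ?ftc ?g1_a ?g1_b //.
apply/measurable_EFinP; apply: measurable_funS mf1; first exact: measurable_itv.
by apply: subset_itvW.
Unshelve. all: by end_near.
Qed.

Lemma expN_cvg_pinfty : (fun t : R => expR (- t)) @ +oo --> (0 : R).
Proof.
apply/cvgrPdist_lt => e e0; near=> t.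
have t0 : 0 < t by near: t; apply: nbhs_pinfty_gt; rewrite num_real.
have te : e^-1 < t by near: t; apply: nbhs_pinfty_gt; rewrite num_real.
rewrite sub0r normrN ger0_norm ?expR_ge0 // expRN -[e]invrK ltf_pV2 ?posrE ?expR_gt0 ?invr_gt0 //.
by have := expR_ge1Dx t; lra.
Unshelve. all: by end_near.
Qed.

(* Adding [B e^-t] makes the integrand nonnegative, so that monotone convergence applies. *)
Lemma FTC_0y (g f : R -> R) (B g0 gy : R) : 0 <= B ->
  (forall t : R, 0 < t -> is_derive t 1 g (f t)) -> (forall t : R, 0 < t -> {for t, continuous f}) ->
  f t @[t --> 0^'+] --> (0 : R) -> (forall t : R, 0 < t -> `|f t| <= B * expR (- t)) ->
  g t @[t --> 0^'+] --> g0 -> g t @[t --> +oo] --> gy ->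
  Rintegral mu `]0, +oo[ f = gy - g0.
Proof.
move=> B0 dg cf f0 fB cg0 cgy.
pose f1 (t : R) : R := if 0 < t then f t else 0.
pose g1 (t : R) : R := if 0 < t then g t else g0.
pose E t := B * expR (- t).
have near_0 (h : R -> Prop) : (forall t : R, 0 < t -> h t) -> \forall t \near 0^'+, h t.
  by move=> hh; near=> t; apply: hh.
have near_t (h : R -> Prop) (s : R) : 0 < s -> (forall t : R, 0 < t -> h t) -> \near s, h s.
  move=> s0 hh; have : \forall t \near s, 0 < t by exact: lt_nbhsr.
  by apply: filterS.
have f10 : f1 0 = 0 by rewrite /f1 ltxx.
have g10 : g1 0 = g0 by rewrite /g1 ltxx.
have dE (t : R) : is_derive t 1 (fun s => - E s) (E t).
  have h : is_derive t 1 (fun s : R => expR (- s)) (expR (- t) * -1).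
    by apply: (@is_derive1_comp _ (@expR R) (fun s => - s)).
  have -> : (fun s => - E s) = ((- B) \*: (fun s : R => expR (- s))) :> (R -> R).
    by apply/funext => s; exact: esym (mulNr _ _).
  apply: is_derive_eq; rewrite /E /GRing.scale /=; ring.
have dg1 (t : R) : 0 < t -> is_derive t 1 g1 (f1 t).
  move=> t0; rewrite /f1 t0; apply: near_eq_is_derive (dg t t0).
  by apply: near_t => // s s0; rewrite /g1 s0.
have cE : continuous E.
  move=> t; apply: cvgM; first exact: cvg_cst.
  apply: (@continuous_comp _ _ _ (fun s : R => - s) (@expR R)); [exact: opp_continuous | exact: continuous_expR].
have cf1 (t : R) : 0 < t -> {for t, continuous f1}.
  move=> t0; have h := cf t t0; apply: cvg_trans; last by rewrite /f1 t0; exact: h.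
  by apply: near_eq_cvg; apply: near_t => // s s0; rewrite /f1 s0.
have f1a : f1 t @[t --> 0^'+] --> (0 : R).
  by apply: cvg_trans f0; apply: near_eq_cvg; apply: near_0 => t t0; rewrite /f1 t0.
have g1a : g1 t @[t --> 0^'+] --> g0.
  by apply: cvg_trans cg0; apply: near_eq_cvg; apply: near_0 => t t0; rewrite /g1 t0.
have g1y : g1 t @[t --> +oo] --> gy.
  apply: cvg_trans cgy; apply: near_eq_cvg; near=> t.
  have t0 : 0 < t by near: t; apply: nbhs_pinfty_gt; rewrite num_real.
  by rewrite /g1 t0.
have Ea : E t @[t --> 0^'+] --> E 0 by apply: cvg_at_right_filter; exact: cE.
have Ey : (fun t => - E t) @ +oo --> (0 : R).
  have h1 : (fun _ : R => B) @ +oo --> B by exact: cvg_cst.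
  have := cvgN (cvgM h1 expN_cvg_pinfty).
  rewrite mulr0 oppr0; exact.
have E0 t : 0 <= E t by rewrite mulr_ge0 ?expR_ge0.
have H0 t : 0 <= t -> 0 <= f1 t + E t.
  move=> _; rewrite /f1; case: ifP => [t0|_]; last by rewrite add0r.
  by have := fB t t0; rewrite -/(E t) ler_norml => /andP[h _]; lra.
have dH (t : R) : 0 < t -> is_derive t 1 (fun s => g1 s + - E s) (f1 t + E t).
  by move=> t0; exact: (@is_deriveD _ _ _ g1 (fun s => - E s) _ _ _ _ (dg1 t t0) (dE t)).
have cH : {within `[0, +oo[, continuous (fun t => f1 t + E t)}.
  apply/continuous_within_itvcyP; split.
    by move=> t; rewrite in_itv /= andbT => t0; apply: cvgD; [exact: cf1 | exact: cE].
  by rewrite f10; apply: cvgD.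
have cE' : {within `[0, +oo[, continuous E} by apply: continuous_subspaceT.
have FH := @ge0_continuous_FTC2y R (fun t => f1 t + E t) (fun s => g1 s + - E s) 0 (gy + 0)
   H0 cH (cvgD g1y Ey) (fun t t0 => @ex_derive _ _ _ _ _ _ _ (dH t t0)).
rewrite g10 in FH.
have {}FH := FH _ (cvgD g1a (cvgN Ea)).
have {}FH : (\int[mu]_(x in `[0%R, +oo[) (f1 x + E x)%:E = (gy + 0)%:E - (g0 - E 0)%:E)%E.
  apply: FH => t; rewrite in_itv /= andbT => t0.
  by rewrite derive1E (@derive_val _ _ _ _ _ _ _ (dH t t0)).
have FE := @ge0_continuous_FTC2y R E (fun s => - E s) 0 0 (fun t _ => E0 t) cE' Ey
   (fun t _ => @ex_derive _ _ _ _ _ _ _ (dE t)) (cvgN Ea).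
have {}FE : (\int[mu]_(x in `[0%R, +oo[) (E x)%:E = 0%:E - (- E 0)%:E)%E.
  by apply: FE => t _; rewrite derive1E (@derive_val _ _ _ _ _ _ _ (dE t)).
have int_of (h : R -> R) (v : R) : {within `[0, +oo[, continuous h} -> (forall t : R, 0 <= t -> 0 <= h t) ->
    (\int[mu]_(x in `[0%R, +oo[) (h x)%:E = v%:E)%E -> mu.-integrable `[0, +oo[ (EFin \o h).
  move=> ch h0 hv; apply/integrableP; split.
    apply/measurable_EFinP; apply: subspace_continuous_measurable_fun => //; exact: measurable_itv.
  under eq_integral => t.
    rewrite inE /= in_itv /= andbT => t0; rewrite ger0_norm ?h0 //; over.
  by rewrite hv ltry.
have iH := int_of _ _ cH H0 FH.
have iE := int_of _ _ cE' (fun t _ => E0 t) FE.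
have m0 : @measurable _ (measurableTypeR R) `[0%R, +oo[%classic by exact: measurable_itv.
have RB := RintegralB (mu := mu) m0 iH iE.
have iF : mu.-integrable `[0, +oo[ (EFin \o f1).
  have := integrableB (mu := mu) m0 iH iE; apply: eq_integrable => // t _ /=.
  by rewrite -EFinB addrK.
have -> : Rintegral mu `]0, +oo[ f = Rintegral mu `]0, +oo[ f1.
  apply: eq_Rintegral => t; rewrite inE /= in_itv /= andbT => t0; by rewrite /f1 t0.
rewrite Rintegral_itv_obnd_cbnd; last first.
  by apply: (integrableS m0) iF; [exact: measurable_itv | move=> t /=; rewrite !in_itv /= !andbT; exact: ltW].
have -> : Rintegral mu `[0, +oo[ f1 = Rintegral mu `[0, +oo[ (fun t => (f1 t + E t) - E t).
  by apply: eq_Rintegral => t _; rewrite addrK.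
rewrite RB /Rintegral FH FE /= ; ring.
Unshelve. all: by end_near.
Qed.

End ImproperFTC.

(** * Complex-valued integrals along half circles and vertical lines *)

Section Geodesics.
Variable R : realType.
Notation C := (complex R).
Implicit Types (p : {poly C}).
Local Notation mu := (@lebesgue_measure R).

Lemma is_derive_cvg (g : R -> R) (t v : R) : is_derive t 1 g v -> {for t, continuous g}.
Proof.
move=> h; apply: differentiable_continuous; apply/derivable1_diffP.
exact: (@ex_derive _ _ _ _ _ _ _ h).
Qed.

(** Extended by 0 at the origin, [f] is continuous on [[0, 1]] and attains a maximal modulus there;
    multiplied by [expR 1], it extends the exponential bound to all [t > 0]. *)
Lemma FTC_0y_tail (g f : R -> R) (B g0 gy : R) : 0 <= B ->
  (forall t : R, 0 < t -> is_derive t 1 g (f t)) -> (forall t : R, 0 < t -> {for t, continuous f}) ->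
  f t @[t --> 0^'+] --> (0 : R) -> (forall t : R, 1 <= t -> `|f t| <= B * expR (- t)) ->
  g t @[t --> 0^'+] --> g0 -> g t @[t --> +oo] --> gy ->
  Rintegral mu `]0, +oo[ f = gy - g0.
Proof.
move=> B0 dg cf f0 fB cg0 cgy.
pose f1 (t : R) : R := if 0 < t then f t else 0.
have f10 : f1 0 = 0 by rewrite /f1 ltxx.
have cf1 (t : R) : 0 < t -> {for t, continuous f1}.
  move=> t0; have h := cf t t0; apply: cvg_trans; last by rewrite /f1 t0; exact: h.
  apply: near_eq_cvg; have : \forall s \near t, 0 < s by exact: lt_nbhsr.
  by apply: filterS => s s0; rewrite /f1 s0.
have f1a : f1 t @[t --> 0^'+] --> (0 : R).
  apply: cvg_trans f0; apply: near_eq_cvg; near=> t.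
  by rewrite /f1 (_ : 0 < t) //; near: t; exact: nbhs_right_gt.
have cN : {within `[0, 1], continuous (fun t => `|f1 t|)}.
  apply/continuous_within_itvP => //; split.
  - move=> t; rewrite in_itv /= => /andP[t0 _].
    by apply: cvg_norm; exact: cf1.
  - by rewrite f10; apply: cvg_norm.
  - by apply: cvg_norm; apply: cvg_at_left_filter; exact: cf1.
have [c _ hc] := EVT_max ler01 cN.
have M0 : 0 <= `|f1 c| by [].
apply: (@FTC_0y _ g f (B + `|f1 c| * expR 1)) => // [|t t0].
  by rewrite addr_ge0 // mulr_ge0 // expR_ge0.
have e0 := expR_ge0 (- t); rewrite mulrDl.
have E1 : 0 <= expR 1 :> R by exact: expR_ge0.
have [t1|t1] := leP 1 t.
  by apply: le_trans (fB t t1) _; rewrite lerDl !mulr_ge0.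
have := hc t; rewrite in_itv /= (ltW t0) (ltW t1) => /(_ isT).
rewrite /f1 t0 -/(f1 c) => h; apply: le_trans h _.
apply: (@le_trans _ _ (`|f1 c| * (expR 1 * expR (- t)))).
  rewrite -expRD ler_peMr // -[leLHS](@expR0 R) ler_expR; lra.
by rewrite mulrA lerDr mulr_ge0.
Unshelve. all: by end_near.
Qed.

Definition rlim (F : set_system R) (h : R -> C) (l : C) :=
  forall e : R, 0 < e -> \forall t \near F, cabs (h t - l) < e.

Lemma rlim_Re (F : set_system R) (fF : Filter F) h l : rlim F h l ->
  (fun t => complex.Re (h t)) @ F --> complex.Re l.
Proof.
move=> hl; apply/cvgrPdist_lt => e e0; have := hl e e0; apply: filterS => t.
by apply: le_lt_trans; rewrite distrC -ReN -ReD cabs_Re.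
Qed.

Lemma rlim_Im (F : set_system R) (fF : Filter F) h l : rlim F h l ->
  (fun t => complex.Im (h t)) @ F --> complex.Im l.
Proof.
move=> hl; apply/cvgrPdist_lt => e e0; have := hl e e0; apply: filterS => t.
by apply: le_lt_trans; rewrite distrC -ImN -ImD cabs_Im.
Qed.

Definition Cint (D : set R) (h : R -> C) : C :=
  (Rintegral mu D (fun t => complex.Re (h t))) +i* (Rintegral mu D (fun t => complex.Im (h t))).

Lemma Cint_eq (D : set R) (g h : R -> C) : (forall t, D t -> g t = h t) -> Cint D g = Cint D h.
Proof.
by move=> gh; congr (_ +i* _); apply: eq_Rintegral => t /[!inE] tD; rewrite gh.
Qed.

Lemma Cint_eq0 (D : set R) : Cint D (fun=> 0) = 0.
Proof. by apply: complexP => /=; rewrite /Rintegral /= integral0. Qed.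

Lemma cderiv_line (f : C -> C) (t : R) l : cderiv f t%:C l -> rderiv (fun s => f s%:C) t l.
Proof.
move=> h; have hl := @rderiv_line R 0 1 t.
have := @cderiv_rderiv R f (fun s => 0 + s%:C * 1) t l 1 hl.
rewrite add0r !mulr1 => /(_ h); under eq_fun do rewrite add0r mulr1.
exact.
Qed.

(** The integrand along a path is viewed as the restriction to the real axis of a function of a
    complex variable, so that [cderiv] delivers both the primitive and the continuity. *)
Lemma Cint_oo (G H : C -> C) (a b : R) (ga gb : C) : a < b ->
  (forall t : R, a < t < b -> cderiv G t%:C (H t%:C)) ->
  (forall t : R, a < t < b -> exists v, cderiv H t%:C v) ->
  rlim a^'+ (fun t => H t%:C) 0 -> rlim b^'- (fun t => H t%:C) 0 ->
  rlim a^'+ (fun t => G t%:C) ga -> rlim b^'- (fun t => G t%:C) gb ->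
  Cint `]a, b[ (fun t => H t%:C) = gb - ga.
Proof.
move=> ab dG dH Ha Hb Ga Gb; apply: complexP; rewrite ?ReD ?ReN ?ImD ?ImN /=.
  apply: (FTC_oo (g := fun t => complex.Re (G t%:C))) => //; first 2 last.
  - exact: rlim_Re Ha.
  - exact: rlim_Re Hb.
  - exact: rlim_Re Ga.
  - exact: rlim_Re Gb.
  - move=> t; rewrite in_itv /= => tab; exact: rderiv_Re (cderiv_line (dG t tab)).
  - move=> t; rewrite in_itv /= => tab; have [v hv] := dH t tab.
    exact: is_derive_cvg (rderiv_Re (cderiv_line hv)).
apply: (FTC_oo (g := fun t => complex.Im (G t%:C))) => //; first 2 last.
- exact: rlim_Im Ha.
- exact: rlim_Im Hb.
- exact: rlim_Im Ga.
- exact: rlim_Im Gb.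
- move=> t; rewrite in_itv /= => tab; exact: rderiv_Im (cderiv_line (dG t tab)).
- move=> t; rewrite in_itv /= => tab; have [v hv] := dH t tab.
  exact: is_derive_cvg (rderiv_Im (cderiv_line hv)).
Qed.

Lemma Cint_0y (G H : C -> C) (B : R) (g0 gy : C) : 0 <= B ->
  (forall t : R, 0 < t -> cderiv G t%:C (H t%:C)) ->
  (forall t : R, 0 < t -> exists v, cderiv H t%:C v) ->
  rlim 0^'+ (fun t => H t%:C) 0 -> (forall t : R, 1 <= t -> cabs (H t%:C) <= B * expR (- t)) ->
  rlim 0^'+ (fun t => G t%:C) g0 -> rlim +oo (fun t => G t%:C) gy ->
  Cint `]0, +oo[ (fun t => H t%:C) = gy - g0.
Proof.
move=> B0 dG dH H0 HB G0 Gy; apply: complexP; rewrite ?ReD ?ReN ?ImD ?ImN /=.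
  apply: (FTC_0y_tail (g := fun t => complex.Re (G t%:C)) B0) => //; first 2 last.
  - exact: rlim_Re H0.
  - by move=> t t1; apply: le_trans (cabs_Re _) (HB t t1).
  - exact: rlim_Re G0.
  - exact: rlim_Re Gy.
  - move=> t t0; exact: rderiv_Re (cderiv_line (dG t t0)).
  - move=> t t0; have [v hv] := dH t t0.
    exact: is_derive_cvg (rderiv_Re (cderiv_line hv)).
apply: (FTC_0y_tail (g := fun t => complex.Im (G t%:C)) B0) => //; first 2 last.
- exact: rlim_Im H0.
- by move=> t t1; apply: le_trans (cabs_Im _) (HB t t1).
- exact: rlim_Im G0.
- exact: rlim_Im Gy.
- move=> t t0; exact: rderiv_Im (cderiv_line (dG t t0)).
- move=> t t0; have [v hv] := dH t t0.
  exact: is_derive_cvg (rderiv_Im (cderiv_line hv)).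
Qed.

End Geodesics.

Section HalfCircle.
Variables (R : realType) (m rho : R).
Notation C := (complex R).
Local Notation k := (((2 * pi)^-1)%:C : C).
Local Notation al := (((rho + `|rho|) / 2)%:C : C).
Local Notation be := (((rho - `|rho|) / 2)%:C : C).

(** Since [qe (k t) = e^(i t)], this is [m + al e^(i t) + be e^(- i t)]. One of [al], [be] vanishes
    according to the sign of [rho], which keeps the path in the upper half-plane while [circ] is
    differentiable everywhere. *)
Let circ (z : C) : C := m%:C + (al * qe (k * z) + be * qe (- (k * z))).
Let circ' (z : C) : C := al * (@ctau R * qe (k * z) * k) + be * (@ctau R * qe (- (k * z)) * - k).

Let pi2_neq0 : 2 * pi != 0 :> R.
Proof. by rewrite mulf_neq0 // ?pnatr_eq0 // gt_eqF // pi_gt0. Qed.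

Lemma qe_arg (t : R) : qe (k * t%:C) = cos t +i* sin t.
Proof.
have h : 2 * pi * ((2 * pi)^-1 * t) = t by rewrite mulrA divff ?mul1r.
rewrite -rmorphM /= /qe /= mulr0 oppr0 expR0 !mul1r h //.
Qed.

Lemma qe_argN (t : R) : qe (- (k * t%:C)) = cos t +i* (- sin t).
Proof.
by rewrite -mulrN -rmorphN qe_arg cosN sinN.
Qed.

Lemma circE (t : R) : circ t%:C = (m + rho * cos t) +i* (`|rho| * sin t).
Proof.
rewrite /circ qe_arg qe_argN; move: (cos t) (sin t) `|rho| => c s a.
apply: complexP; rewrite ?ReD ?ReM ?ImD ?ImM /=; by field.
Qed.

Lemma circ'E (t : R) : circ' t%:C = (- (rho * sin t)) +i* (`|rho| * cos t).
Proof.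
rewrite /circ' qe_arg qe_argN.
have e (u : C) : @ctau R * u * k = 'i * u.
  rewrite mulrAC; congr (_ * _); apply: complexP; rewrite /ctau ?ReM ?ImM /=; first ring.
  by rewrite mul0r add0r divff.
rewrite mulrN !e; move: (cos t) (sin t) `|rho| => c s a.
apply: complexP; rewrite ?ReD ?ReM ?ImD ?ImM ?ReN ?ImN /=; by field.
Qed.

Let cderiv_kz (z : C) : cderiv (fun x : C => k * x) z k.
Proof. by have := cderivZ k (cderiv_id z); rewrite mulr1; apply. Qed.

Let cderiv_qekz (z : C) : cderiv (fun x : C => qe (k * x)) z (@ctau R * qe (k * z) * k).
Proof. exact: (@cderiv_comp R (@qe R) (fun x => k * x) z _ _ (cderiv_kz z) (@cderiv_qe R _)). Qed.

Let cderiv_qeNkz (z : C) : cderiv (fun x : C => qe (- (k * x))) z (@ctau R * qe (- (k * z)) * - k).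
Proof.
exact: (@cderiv_comp R (@qe R) (fun x => - (k * x)) z _ _ (cderivN (cderiv_kz z)) (@cderiv_qe R _)).
Qed.

Lemma cderiv_circ (z : C) : cderiv circ z (circ' z).
Proof.
have := cderivD (cderiv_cst (m%:C : C) z)
  (cderivD (cderivZ al (cderiv_qekz z)) (cderivZ be (cderiv_qeNkz z))).
by rewrite add0r.
Qed.

Lemma cderiv_circ' (z : C) : exists v, cderiv circ' z v.
Proof.
have h1 := cderivZ al (cderivM (cderivZ (@ctau R) (cderiv_qekz z)) (cderiv_cst k z)).
have h2 := cderivZ be (cderivM (cderivZ (@ctau R) (cderiv_qeNkz z)) (cderiv_cst (- k) z)).
have h3 := cderivD h1 h2.
by match type of h3 with cderiv _ _ ?l => exists l end.
Qed.

Hypothesis rho0 : rho != 0.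

Lemma Im_circ_gt0 (t : R) : 0 < t < pi -> 0 < complex.Im (circ t%:C).
Proof.
by move=> /andP[t0 tp]; rewrite circE /= mulr_gt0 ?normr_gt0 // sin_gt0_pi // t0.
Qed.

Lemma cabs_circ' (t : R) : cabs (circ' t%:C) <= 2 * `|rho|.
Proof.
apply: le_trans (cabs_le_ReIm _) _; rewrite circ'E /= normrN !normrM normr_id mulrDl mul1r.
by apply: lerD; rewrite ler_piMr //; [exact: sin_max | exact: cos_max].
Qed.

Lemma oneB_cos_le (c s : R) : 0 <= c -> 0 <= s -> c ^+ 2 + s ^+ 2 = 1 -> `|c - 1| <= s.
Proof. by move=> c0 s0 h; rewrite ler_norml; nra. Qed.

(** The half circle meets the real axis at a right angle: near the end [u] the horizontal
    displacement is at most the height, because [c + s >= 1] on a quarter circle. The values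
    [c = cos t] and [c = - cos t] serve the two ends. *)
Lemma circ_near (u t c s d : R) : 0 <= c -> 0 < s -> c ^+ 2 + s ^+ 2 = 1 -> s < d / (2 * `|rho|) ->
  `|u - m| = `|rho| -> circ t%:C = (u + (u - m) * (c - 1)) +i* (`|rho| * s) ->
  cabs (circ t%:C - u%:C) < d /\ cabs (circ t%:C - u%:C) <= 2 * complex.Im (circ t%:C).
Proof.
move=> c0 s0 cs sd um ->; have r0 : 0 < `|rho| by rewrite normr_gt0.
have h : cabs (((u + (u - m) * (c - 1)) +i* (`|rho| * s)) - u%:C) <= 2 * (`|rho| * s).
  apply: le_trans (cabs_le_ReIm _) _; rewrite ReD ImD ReN ImN /= subr0 addrAC subrr add0r.
  rewrite !normrM um normr_id (ger0_norm (ltW s0)) -mulrDr mulrCA ler_pM2l //.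
  by have := oneB_cos_le c0 (ltW s0) cs; lra.
split=> //; apply: le_lt_trans h _.
by move: sd; rewrite ltr_pdivlMr ?mulr_gt0 // mulrA mulrC.
Qed.

Let sin_near0 (e : R) : 0 < e -> \forall t \near 0^'+, 0 < t < pi /\ [/\ 0 <= cos t, 0 < sin t & sin t < e].
Proof.
move=> e0; have : sin t @[t --> 0^'+] --> (sin 0 : R).
  by apply: cvg_at_right_filter; exact: continuous_sin.
rewrite sin0 => /cvgrPdist_lt /(_ e e0) h; near=> t.
have t0 : 0 < t by near: t; exact: nbhs_right_gt.
have tp : t < pi / 2 by near: t; apply: nbhs_right_lt; rewrite divr_gt0 // pi_gt0.
have p0 : 0 < pi :> R by exact: pi_gt0.
have s0 : 0 < sin t by apply: sin_gt0_pi; lra.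
split; first by lra.
split=> //.
  by apply: cos_ge0_pihalf; apply/andP; split; lra.
have : `|0 - sin t| < e by near: t; exact: h.
by rewrite sub0r normrN (gtr0_norm s0).
Unshelve. all: by end_near.
Qed.

Let sin_nearpi (e : R) : 0 < e -> \forall t \near pi^'-, 0 < t < pi /\ [/\ 0 <= - cos t, 0 < sin t & sin t < e].
Proof.
move=> e0; have p0 : 0 < pi :> R by exact: pi_gt0.
have h2 : pi / 2 < pi :> R by lra.
have : sin t @[t --> pi^'-] --> (sin pi : R).
  by apply: cvg_at_left_filter; exact: continuous_sin.
rewrite sinpi => /cvgrPdist_lt /(_ e e0) h; near=> t.
have t0 : t < pi by near: t; exact: nbhs_left_lt.
have tp : pi / 2 < t by near: t; exact: nbhs_left_gt.
have s0 : 0 < sin t by apply: sin_gt0_pi; lra.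
split; first by lra.
split=> //.
  rewrite -{1}(subrK pi t) cosDpi opprK.
  by apply: cos_ge0_pihalf; apply/andP; split; lra.
have : `|0 - sin t| < e by near: t; exact: h.
by rewrite sub0r normrN (gtr0_norm s0).
Unshelve. all: by end_near.
Qed.

Let circ_near0 (s : rat) (d : R) : ratr s = m + rho -> 0 < d ->
  \forall t \near 0^'+, 0 < complex.Im (circ t%:C) /\ cusp_near (Some s) 2 d (circ t%:C).
Proof.
move=> hs d0; have e0 : 0 < d / (2 * `|rho|) by rewrite divr_gt0 // mulr_gt0 // normr_gt0.
have := sin_near0 e0; apply: filterS => t [tp [c0 s0 sd]]; split; first exact: Im_circ_gt0.
apply: (@circ_near _ _ (cos t) (sin t)) => //; first exact: cos2Dsin2.
  by rewrite hs addrAC subrr add0r.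
by rewrite circE hs; congr (_ +i* _); ring.
Qed.

Let circ_nearpi (r : rat) (d : R) : ratr r = m - rho -> 0 < d ->
  \forall t \near pi^'-, 0 < complex.Im (circ t%:C) /\ cusp_near (Some r) 2 d (circ t%:C).
Proof.
move=> hs d0; have e0 : 0 < d / (2 * `|rho|) by rewrite divr_gt0 // mulr_gt0 // normr_gt0.
have := sin_nearpi e0; apply: filterS => t [tp [c0 s0 sd]]; split; first exact: Im_circ_gt0.
apply: (@circ_near _ _ (- cos t) (sin t)) => //; first by rewrite sqrrN; exact: cos2Dsin2.
  by rewrite hs addrAC subrr add0r normrN.
by rewrite circE hs; congr (_ +i* _); ring.
Qed.

Let rlim_circ (f : C -> C) (l : C) (F : set_system R) (x : option rat) : Filter F ->
  (forall d : R, 0 < d -> \forall t \near F, 0 < complex.Im (circ t%:C) /\ cusp_near x 2 d (circ t%:C)) ->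
  conelim x f l -> rlim F (fun t => f (circ t%:C)) l.
Proof.
move=> fF hF hf e e0; have [d d0 hd] := hf 2 e (ltr0Sn _ 1) e0.
by have := hF d d0; apply: filterS => t [t0 tn]; exact: hd.
Qed.

Lemma Cint_circ (r s : rat) (p : {poly C}) : (size p <= 11)%N ->
  ratr s = m + rho -> ratr r = m - rho ->
  Cint `]0, pi[ (fun t : R => Del (circ t%:C) * p.[circ t%:C] * circ' t%:C) =
  cuspint (Some r) p - cuspint (Some s) p.
Proof.
move=> sp hs hr; have p0 : 0 < pi :> R by exact: pi_gt0.
have rp : 0 < 2 * `|rho| by rewrite mulr_gt0 // normr_gt0.
have Hlim (F : set_system R) (x : option rat) : Filter F ->
    (forall d : R, 0 < d -> \forall t \near F, 0 < complex.Im (circ t%:C) /\ cusp_near x 2 d (circ t%:C)) ->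
    rlim F (fun t => Del (circ t%:C) * p.[circ t%:C] * circ' t%:C) 0.
  move=> fF hF e e0.
  have sp13 : (size p <= 13)%N by exact: leq_trans sp _.
  have := rlim_circ fF hF (Del_cusp_decay x sp13) (divr_gt0 e0 rp).
  apply: filterS => t; rewrite !subr0 ltr_pdivlMr // => h; rewrite cabsM.
  by apply: le_lt_trans h; rewrite ler_wpM2l ?cabs_ge0 // cabs_circ'.
apply: (@Cint_oo R (fun z => Delprim p (circ z)) (fun z => Del (circ z) * p.[circ z] * circ' z)) => //.
- move=> t tp; apply: (@cderiv_comp R (Delprim p) circ) => //; first exact: cderiv_circ.
  by apply: cderiv_Delprim => //; exact: Im_circ_gt0.
- move=> t tp; have [v hv] := cderiv_circ' t%:C; have hc := cderiv_circ t%:C.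
  have h1 := @cderiv_comp R (@Del R) circ _ _ _ hc (cderiv_Del (Im_circ_gt0 tp)).
  have h2 := @cderiv_comp R (fun z => p.[z]) circ _ _ _ hc (cderiv_horner p _).
  have h3 := cderivM (cderivM h1 h2) hv.
  by match type of h3 with cderiv _ _ ?l => exists l end.
- by apply: (Hlim _ (Some s)) => d d0; exact: circ_near0.
- by apply: (Hlim _ (Some r)) => d d0; exact: circ_nearpi.
- by apply: (rlim_circ _ _ (cuspintP (Some s) sp)) => d d0; exact: circ_near0.
- by apply: (rlim_circ _ _ (cuspintP (Some r) sp)) => d d0; exact: circ_nearpi.
Qed.

End HalfCircle.

Section VerticalLine.
Variable R : realType.
Notation C := (complex R).

Lemma pi_ge2_real : 2 <= pi :> R. Proof. exact: pi_ge2. Qed.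

Lemma exprn_le_expR n (t : R) : 0 <= t -> t ^+ n <= n`!%:R * expR t.
Proof.
case: n => [|n] t0; first by rewrite expr0 fact0 mul1r -[leLHS](@expR0 R) ler_expR.
have F : 0 < n.+1`!%:R :> R by rewrite ltr0n fact_gt0.
rewrite mulrC -ler_pdivrMr //; apply: le_trans (expR_ge1Dxn n t0).
by rewrite lerDr.
Qed.

Variables (s : rat) (p : {poly C}).
Hypothesis sp : (size p <= 11)%N.
Let x : R := ratr s.
Let vert (z : C) : C := x%:C + z * 'i.

Lemma vertE (t : R) : vert t%:C = x +i* t.
Proof. by apply: complexP; rewrite /vert ?ReD ?ReM ?ImD ?ImM /=; ring. Qed.

Let cderiv_vert (z : C) : cderiv vert z 'i.
Proof.
have := cderivD (cderiv_cst x%:C z) (cderivM (cderiv_id z) (cderiv_cst 'i z)).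
by rewrite /= add0r mulr0 addr0 mul1r.
Qed.

Let vert_near0 (d : R) : 0 < d ->
  \forall t \near 0^'+, 0 < complex.Im (vert t%:C) /\ cusp_near (Some s) 1 d (vert t%:C).
Proof.
move=> d0; near=> t; have t0 : 0 < t by near: t; exact: nbhs_right_gt.
have td : t < d by near: t; exact: nbhs_right_lt.
have e : cabs (vert t%:C - x%:C) = t.
  rewrite vertE (_ : _ - _ = t%:C * 'i); last by apply: complexP; rewrite ?ReD ?ReN ?ReM ?ImD ?ImN ?ImM /=; ring.
  by rewrite cabsM cabs_real gtr0_norm // /cabs /= expr0n add0r expr1n sqrtr1 mulr1.
have I1 : complex.Im (vert t%:C) = t by rewrite vertE.
by rewrite /cusp_near -/x e I1 mul1r.
Unshelve. all: by end_near.
Qed.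

Let vert_le (t : R) : 1 <= t -> cabs (vert t%:C) <= (`|x| + 1) * t.
Proof.
move=> t1; rewrite vertE; apply: le_trans (cabs_le_ReIm _) _ => /=.
rewrite (@ger0_norm _ t); last lra.
by have := normr_ge0 x; nra.
Qed.

Let vert_nearoo (d : R) : 0 < d -> \forall t \near +oo,
  0 < complex.Im (vert t%:C) /\ cusp_near None (`|x| + 1) d (vert t%:C).
Proof.
move=> d0; near=> t; have t0 : 1 < t by near: t; apply: nbhs_pinfty_gt; rewrite num_real.
have td : d^-1 < t by near: t; apply: nbhs_pinfty_gt; rewrite num_real.
have h := vert_le (ltW t0).
have I1 : complex.Im (vert t%:C) = t by rewrite vertE.
by rewrite /cusp_near I1; split; [lra | split].
Unshelve. all: by end_near.
Qed.

Let bound : exists2 B : R, 0 <= B & forall t : R, 1 <= t ->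
  cabs (Del (vert t%:C) * p.[vert t%:C] * 'i) <= B * expR (- t).
Proof.
have [B B0 hB] := qser_le (@adm_eulc R 24); have [M M0 hM] := horner_growth p.
pose n := size p; have x1 : 0 <= `|x| + 1 by rewrite addr_ge0.
exists (B * (M * (`|x| + 1) ^+ n * n`!%:R)).
  by rewrite !mulr_ge0 ?exprn_ge0.
move=> t t1; have I1 : complex.Im (vert t%:C) = t by rewrite vertE.
have w1 : 1 <= cabs (vert t%:C).
  by have := cabs_Im (vert t%:C); have := ler_norm (complex.Im (vert t%:C)); rewrite I1; lra.
have t0 : 0 <= t by lra.
have h1 := hB (vert t%:C); rewrite I1 in h1; have {}h1 := h1 t1.
have h2 : cabs p.[vert t%:C] <= M * ((`|x| + 1) ^+ n * (n`!%:R * expR t)).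
  apply: le_trans (hM _ w1) _; rewrite ler_wpM2l //.
  apply: (@le_trans _ _ (((`|x| + 1) * t) ^+ n)); first by rewrite lerXn2r ?nnegrE ?cabs_ge0 ?mulr_ge0 ?vert_le.
  by rewrite exprMn ler_wpM2l ?exprn_ge0 // exprn_le_expR.
have ci : cabs 'i = 1 :> R by rewrite /cabs /= expr0n add0r expr1n sqrtr1.
rewrite !cabsM ci mulr1.
(* The power of [t] has been bounded by [expR t]; the decay [exp(- 2 pi t)] absorbs it and leaves
   [expR (- t)]. *)
have e1 : expR (- (2 * pi * t)) * expR t <= expR (- t).
  by rewrite -expRD ler_expR; have := pi_ge2_real; nra.
have := ler_pM (cabs_ge0 _) (cabs_ge0 _) h1 h2 => /le_trans; apply.
set N : R := n`!%:R; set Y := (`|x| + 1) ^+ n.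
have c0 : 0 <= B * (M * Y * N) by rewrite !mulr_ge0 ?exprn_ge0.
rewrite [leLHS](_ : _ = B * (M * Y * N) * (expR (- (2 * pi * t)) * expR t)); last first.
  by move: (expR _) (expR _) => a b; ring.
exact: ler_wpM2l.
Qed.

Lemma Cint_vert : Cint `]0, +oo[ (fun t : R => Del (x +i* t) * p.[x +i* t] * 'i) =
  - cuspint (Some s) p.
Proof.
have Im_gt0 (t : R) : 0 < t -> 0 < complex.Im (vert t%:C) by move=> t0; rewrite vertE.
rewrite -sub0r; have [B B0 hB] := bound.
rewrite -(Cint_eq (g := fun t => Del (vert t%:C) * p.[vert t%:C] * 'i)); last first.
  by move=> t _; rewrite vertE.
apply: (@Cint_0y R (fun z => Delprim p (vert z)) (fun z => Del (vert z) * p.[vert z] * 'i) B) => //.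
- move=> t t0; have hc := cderiv_vert t%:C.
  exact: (@cderiv_comp R (Delprim p) vert _ _ _ hc (cderiv_Delprim sp (Im_gt0 t t0))).
- move=> t t0; have hc := cderiv_vert t%:C.
  have h1 := @cderiv_comp R (@Del R) vert _ _ _ hc (cderiv_Del (Im_gt0 t t0)).
  have h2 := @cderiv_comp R (fun z => p.[z]) vert _ _ _ hc (cderiv_horner p _).
  have h3 := cderivM (cderivM h1 h2) (cderiv_cst 'i t%:C).
  by match type of h3 with cderiv _ _ ?l => exists l end.
- move=> e e0; have sp13 : (size p <= 13)%N by exact: leq_trans sp _.
  have [d d0 hd] := @Del_cusp_decay R (Some s) p sp13 1 e ltr01 e0.
  have := vert_near0 d0; apply: filterS => t [t0 tn]; have := hd _ t0 tn.
  have ci : cabs 'i = 1 :> R by rewrite /cabs /= expr0n add0r expr1n sqrtr1.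
  by rewrite !subr0 [cabs (_ * 'i)]cabsM ci mulr1.
- move=> e e0; have [d d0 hd] := cuspintP (Some s) sp ltr01 e0.
  by have := vert_near0 d0; apply: filterS => t [t0 tn]; exact: hd.
- move=> e e0; have x1 : 0 < `|x| + 1 by rewrite ltr_wpDl.
  have [d d0 hd] := Delprim_decay p x1 e0.
  by have := vert_nearoo d0; apply: filterS => t [t0 tn]; exact: hd.
Qed.

End VerticalLine.

Section GeodesicIntegral.
Variable R : realType.
Notation C := (complex R).

(** The same formula as [geod_integral], over an arbitrary [realType]. *)
Definition geod (f : C -> C) (s r : option rat) : C :=
  match s, r with
  | Some s, Some r =>
    let m : R := (ratr r + ratr s) / 2 in
    let rho : R := (ratr s - ratr r) / 2 in
    Cint [set th | 0 < th < pi]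
      (fun th => f ((m + rho * cos th) +i* (`|rho| * sin th)) *
                 ((- (rho * sin th)) +i* (`|rho| * cos th)))
  | Some s, None => Cint [set t | 0 < t] (fun t => f (ratr s +i* t) * 'i)
  | None, Some r => - Cint [set t | 0 < t] (fun t => f (ratr r +i* t) * 'i)
  | None, None => 0
  end.

Lemma geodE (f : C -> C) (p : {poly C}) s r : (size p <= 11)%N ->
  (forall z, 0 < complex.Im z -> f z = Del z * p.[z]) -> geod f s r = cuspint r p - cuspint s p.
Proof.
move=> sp fE.
have vert (x : rat) : Cint [set t | 0 < t] (fun t => f (ratr x +i* t) * 'i) = - cuspint (Some x) p.
  rewrite -Cint_vert //.
  have -> : [set t : R | 0 < t] = `]0, +oo[%classic.
    by apply/seteqP; split=> t /=; rewrite in_itv /= andbT.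
  apply: Cint_eq => t /=; rewrite in_itv /= andbT => t0.
  by rewrite fE.
case: s r => [s|] [r|] /=; rewrite ?vert ?cuspint_oo ?subrr ?sub0r ?subr0 ?opprK //.
set m := (_ + _) / 2; set rho := (_ - _) / 2.
have hs : ratr s = m + rho by rewrite /m /rho; field.
have hr : ratr r = m - rho by rewrite /m /rho; field.
(* For equal end points the path is constant and the integrand is 0. *)
have [r0|r0] := eqVneq rho 0.
  rewrite r0 normr0 (Cint_eq (h := fun=> 0)); last by move=> t _; rewrite !mul0r oppr0; exact: mulr0.
  have e : ratr r = ratr s :> R by rewrite hs hr r0 addr0 subr0.
  have -> : r = s by exact: fmorph_inj e.
  by rewrite subrr Cint_eq0.
rewrite -(Cint_circ r0 sp hs hr).
have -> : [set th : R | 0 < th < pi] = `]0, pi[%classic.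
  by apply/seteqP; split=> t /=; rewrite in_itv.
apply: Cint_eq => t /=; rewrite in_itv /= => tp.
by rewrite -circ'E -circE fE ?Im_circ_gt0.
Qed.

End GeodesicIntegral.

(** * Moments of the plus symbol and the linear rules *)

Section Periods.
Variable R : realType.
Notation C := (complex R).
Implicit Types (s : option rat) (p : {poly C}).
Local Opaque cuspint Delprim Del.
Local Notation XX j := ('X^j : {poly C}).

Lemma qe_int (c : int) : qe (c%:~R : C) = 1.
Proof.
by case: c => n; rewrite ?NegzE ?mulrNz -?pmulrn ?qeN qe_nat ?invr1.
Qed.

Lemma ratr_intC (c : int) : (ratr (c%:~R) : R)%:C = c%:~R :> C.
Proof. by rewrite ratr_int rmorph_int. Qed.

Lemma cuspint_coef s p : (size p <= 11)%N -> cuspint s p = \sum_(i < 11) p`_i * cuspint s (XX i).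
Proof.
have L0 : cuspint s (0 : {poly C}) = 0.
  have := @cuspint_linear R s (-1) 0 0; rewrite size_poly0 scaler0 addr0 mulN1r addNr.
  exact.
have main n : (n <= 11)%N -> cuspint s (\sum_(i < n) p`_i *: 'X^i) = \sum_(i < n) p`_i * cuspint s (XX i).
  elim: n => [|n IH] hn; first by rewrite !big_ord0.
  rewrite !big_ord_recr /= addrC cuspint_linear ?size_polyXn // ?IH ?(ltnW hn) 1?addrC //.
  apply: leq_trans (size_sum _ _ _) _; apply/bigmax_leqP => i _.
  by apply: leq_trans (size_scale_leq _ _) _; rewrite size_polyXn (leq_trans (ltn_ord i)) // ltnW.
move=> sp; apply: etrans (main 11%N (leqnn _)); congr (cuspint s _).
transitivity (\poly_(i < 11) p`_i); last exact: poly_def.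
apply/polyP => i; rewrite coef_poly; case: ltnP => // hi.
by rewrite nth_default // (leq_trans sp).
Qed.

Lemma coef_XaddC_exp (c : C) j i : (('X + c%:P) ^+ j)`_i = 'C(j, i)%:R * c ^+ (j - i).
Proof.
rewrite addrC exprDn.
have -> : \sum_(k < j.+1) (c%:P ^+ (j - k) * 'X^k) *+ 'C(j, k) =
          \poly_(k < j.+1) (c ^+ (j - k) *+ 'C(j, k)).
  rewrite poly_def; apply: eq_bigr => k _.
  by rewrite -rmorphXn /= mul_polyC scalerMnl.
rewrite coef_poly ltnS mulr_natl; case: leqP => // ji.
by rewrite bin_small.
Qed.

Lemma cuspint_shiftX s (c : int) j : (j <= 10)%N ->
  cuspint (cusp_shift s c%:~R) (XX j) = \sum_(i < 11) 'C(j, i)%:R * c%:~R ^+ (j - i) * cuspint s (XX i).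
Proof.
move=> j10; have sX : (size ('X^j : {poly C}) <= 11)%N by rewrite size_polyXn.
rewrite cuspint_shift ?ratr_intC ?qe_int // cuspint_coef ?size_shift //.
by apply: eq_bigr => i _; rewrite comp_Xn_poly coef_XaddC_exp.
Qed.

Lemma slashX j : (j <= 10)%N -> slash 10 ('X^j : {poly C}) = (-1) ^+ j *: 'X^(10 - j).
Proof.
move=> j10; apply/polyP => i; rewrite coef_poly coefZ !coefXn.
case: ltnP => hi.
  have -> : (10 - i == j)%N = (i == 10 - j)%N by apply/eqP/eqP => [<-|->]; rewrite subKn.
  by case: eqP => [->|]; rewrite ?mul0r ?mulr0 // mul1r mulr1 subKn.
by case: eqP => [ij|]; rewrite ?mulr0 //; move: hi; rewrite ij ltnNge leq_subr.
Qed.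

Lemma cuspint_invX s j : (j <= 10)%N ->
  cuspint (cusp_inv s) (XX j) = (-1) ^+ j * cuspint s (XX (10 - j)) + cuspint (Some 0) ('X^j : {poly C}).
Proof.
move=> j10; rewrite cuspint_inv ?size_polyXn // slashX //; congr (_ + _).
have := @cuspint_linear R s ((-1) ^+ j) 'X^(10 - j) 0; rewrite size_polyXn size_poly0 addr0 => -> //; last first.
  by rewrite ltnS leq_subr.
by rewrite (@cuspint_coef s 0) ?size_poly0 // big1 ?addr0 // => i _; rewrite coef0 mul0r.
Qed.

Definition cusp_neg s : option rat := omap (fun r => - r) s.

Definition Lplus s j : C := (cuspint s (XX j) + (-1) ^+ j * cuspint (cusp_neg s) (XX j)) / 2.

Lemma Lplus_oo j : (j <= 10)%N -> Lplus None j = 0.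
Proof. by move=> j10; rewrite /Lplus /= cuspint_oo ?size_polyXn // mulr0 addr0 mul0r. Qed.

Lemma cusp_neg_shift s (c : rat) : cusp_neg (cusp_shift s c) = cusp_shift (cusp_neg s) (- c).
Proof. by case: s => //= r; rewrite opprD. Qed.

Lemma cusp_neg_inv s : cusp_neg (cusp_inv s) = cusp_inv (cusp_neg s).
Proof. by case: s => /= [r|]; rewrite ?oppr0 // oppr_eq0 invrN; case: ifP. Qed.

(** The reflection turns translation by [c] into translation by [- c]; the resulting sign
    [(-1)^(j - i)] is exactly what changes the sign of the plus part from [j] to [i]. *)
Lemma Lplus_shift s (c : int) j : (j <= 10)%N ->
  Lplus (cusp_shift s c%:~R) j = \sum_(i < 11) 'C(j, i)%:R * c%:~R ^+ (j - i) * Lplus s i.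
Proof.
move=> j10; rewrite /Lplus cusp_neg_shift -mulrNz !cuspint_shiftX // mulr_sumr -big_split mulr_suml.
apply: eq_bigr => i _ /=; have [ij|ji] := leqP i j; last by rewrite bin_small // !mul0r mulr0 addr0 mul0r.
rewrite mulrNz [(- c%:~R) ^+ _]exprNn; have -> : ((-1) ^+ j : C) = (-1) ^+ (j - i) * (-1) ^+ i by rewrite -exprD subnK.
have : (-1) ^+ (j - i) * (-1) ^+ (j - i) = 1 :> C by rewrite -expr2 sqrr_sign.
move: ((-1) ^+ (j - i)) ((-1) ^+ i) (c%:~R ^+ (j - i)) (cuspint s (XX i)) (cuspint (cusp_neg s) (XX i)) => e e' d a b ee.
have -> : e * e' * ('C(j, i)%:R * (e * d) * b) = (e * e) * (e' * 'C(j, i)%:R * d * b) by ring.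
by rewrite ee; field.
Qed.

Lemma Lplus_inv s j : (j <= 10)%N ->
  Lplus (cusp_inv s) j = (-1) ^+ j * Lplus s (10 - j) + Lplus (Some 0) j.
Proof.
move=> j10; rewrite /Lplus cusp_neg_inv !cuspint_invX //= oppr0.
have e : (-1) ^+ (10 - j) = (-1) ^+ j :> C.
  rewrite -[LHS]signr_odd -[RHS]signr_odd oddB //.
rewrite e; move: ((-1) ^+ j) (cuspint s (XX (10 - j))) (cuspint (cusp_neg s) (XX (10 - j))) (cuspint (Some 0) (XX j)) => u a b c; by field.
Qed.

Local Notation x := (Lplus (Some 0)).

Lemma Lplus0_odd j : odd j -> x j = 0.
Proof. by move=> jo; rewrite /Lplus /= oppr0 -signr_odd jo expr1 mulN1r subrr mul0r. Qed.

Lemma Lplus0_even j : ~~ odd j -> x j = cuspint (Some 0) (XX j).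
Proof.
move=> /negPf je; rewrite /Lplus /= oppr0 -signr_odd je expr0 mul1r.
by move: (cuspint _ _) => a; field.
Qed.

(** Inversion sends 0 to infinity, where all moments vanish. *)
Lemma Lplus0_sym j : (j <= 10)%N -> ~~ odd j -> x (10 - j) = - x j.
Proof.
move=> j10 /negPf je; have := Lplus_inv (Some 0) j10; rewrite /= Lplus_oo //.
by rewrite -signr_odd je expr0 mul1r => /eqP; rewrite eq_sym addr_eq0 => /eqP.
Qed.

Lemma sum11_sym (F X : nat -> C) : X 1 = 0 -> X 3 = 0 -> X 5 = 0 -> X 7 = 0 -> X 9 = 0 ->
  X 10 = - X 0 -> X 8 = - X 2 -> X 6 = - X 4 ->
  \sum_(i < 11) F i * X i = (F 0 - F 10) * X 0 + (F 2 - F 8) * X 2 + (F 4 - F 6) * X 4.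
Proof.
move=> h1 h3 h5 h7 h9 h10 h8 h6.
rewrite !big_ord_recr big_ord0 /= h1 h3 h5 h7 h9 h10 h8 h6.
move: (X 0) (X 2) (X 4) => a b c; ring.
Qed.

Lemma Lplus0_sum (c : int) j (F : nat -> C) : (j <= 10)%N ->
  (forall i, (i <= 10)%N -> F i = 'C(j, i)%:R * c%:~R ^+ (j - i)) ->
  Lplus (Some c%:~R) j = (F 0 - F 10) * x 0 + (F 2 - F 8) * x 2 + (F 4 - F 6) * x 4.
Proof.
move=> j10 hF; have := Lplus_shift (Some 0) c j10; rewrite /= add0r => ->.
rewrite -(@sum11_sym F x (@Lplus0_odd 1 isT) (@Lplus0_odd 3 isT) (@Lplus0_odd 5 isT)
  (@Lplus0_odd 7 isT) (@Lplus0_odd 9 isT) (@Lplus0_sym 0 isT isT) (@Lplus0_sym 2 isT isT)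
  (@Lplus0_sym 4 isT isT)).
by apply: eq_bigr => i _; rewrite hF // -ltnS.
Qed.

(** The cusps 1 and -1 are related by inversion, and both are integral translates of 0. Comparing
    the second moments gives this relation among the three free moments. *)
Lemma Lplus0_24 : 27 * x 2 + 42 * x 4 = 0.
Proof.
have h := @Lplus_inv (Some 1) 2 isT.
have i1 : cusp_inv (Some 1) = Some (-1)%:~R by apply/eqP.
have {}h := etrans (congr1 (fun s => Lplus s 2) (esym i1)) h.
have e1 : Lplus (Some (-1)%:~R) 2 = (1 - 0) * x 0 + (1 - 0) * x 2 + (0 - 0) * x 4.
  apply: (@Lplus0_sum _ _ (fun i => if i == 0%N then 1 else if i == 1%N then -2 else if i == 2 then 1 else 0)) => //.
  by move=> [|[|[|i]]] _ /=; rewrite ?bin0 ?bin1 ?binn ?bin_small ?mul0r // ?subn0 ?subnn ?expr0 ?mulr1 //= ?sqrrN ?expr1n ?mulr1 // mulrN1.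
have e8 : Lplus (Some 1) 8 = (1 - 0) * x 0 + (28 - 1) * x 2 + (70 - 28) * x 4.
  apply: (@Lplus0_sum 1 8 (fun i => 'C(8, i)%:R)) => // i _.
  by rewrite expr1n mulr1.
have := etrans (esym e1) (etrans h (congr1 (fun y => (-1) ^+ 2 * y + x 2) e8)).
move: (x 0) (x 2) (x 4) => a b c /eqP; rewrite -subr_eq0 => /eqP k.
rewrite -[RHS]oppr0 -k; ring.
Qed.

End Periods.

(** * The Hecke relation on moments determines them up to a scalar *)

Section HeckeTwo.
Variable R : realType.
Notation C := (complex R).
Local Notation XX j := ('X^j : {poly C}).
Local Opaque cuspint Delprim Del.

Lemma conelim_None_scale (c : R) (f : C -> C) l : 0 < c ->
  conelim None f l -> conelim None (fun z => f (c%:C * z)) l.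
Proof.
move=> c0 h K e K0 e0; have [d d0 hd] := h K e K0 e0.
exists (d * c); first exact: mulr_gt0.
have I (z : C) : complex.Im (c%:C * z) = c * complex.Im z by rewrite ImM /= mul0r addr0.
move=> z z0 [h1 h2]; apply: hd; first by rewrite I mulr_gt0.
split; first by move: h1; rewrite I invfM ltr_pdivrMr // mulrC.
by rewrite cabsM cabs_real gtr0_norm // I mulrCA ler_wpM2l // ltW.
Qed.

Lemma conelim_0_scale (c : R) (f : C -> C) l : 0 < c ->
  conelim (Some 0) f l -> conelim (Some 0) (fun z => f (c%:C * z)) l.
Proof.
move=> c0 h K e K0 e0; have [d d0 hd] := h K e K0 e0.
exists (d / c); first exact: divr_gt0.
have I (z : C) : complex.Im (c%:C * z) = c * complex.Im z by rewrite ImM /= mul0r addr0.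
have r0 : (ratr 0 : R)%:C = 0 :> C by rewrite !rmorph0.
move=> z z0; rewrite /cusp_near r0 !subr0 => -[h1 h2]; apply: hd; first by rewrite I mulr_gt0.
rewrite /cusp_near r0 !subr0 cabsM cabs_real gtr0_norm // I; split.
  by rewrite mulrC -ltr_pdivlMr.
by rewrite mulrCA ler_wpM2l // ltW.
Qed.

Let F : C -> C := Delprim (1 : {poly C}).
Let s1 : (size (1%R : {poly C}) <= 11)%N. Proof. by rewrite size_poly1. Qed.

Let dF (z : C) : 0 < complex.Im z -> cderiv F z (Del z).
Proof. by move=> z0; have := cderiv_Delprim s1 z0; rewrite hornerC mulr1. Qed.

Let cderiv_scale (a b z l : C) (f : C -> C) : cderiv f (a * z + b) l ->
  cderiv (fun x => f (a * x + b)) z (l * a).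
Proof.
move=> h; have ha : cderiv (fun x => a * x + b) z a.
  by have := cderivD (cderivZ a (cderiv_id z)) (cderiv_cst b z); rewrite mulr1 addr0.
exact: (@cderiv_comp R f (fun x => a * x + b) z _ _ ha h).
Qed.

Let cderiv_scale0 (a z l : C) (f : C -> C) : cderiv f (a * z) l ->
  cderiv (fun x => f (a * x)) z (l * a).
Proof.
move=> h; have ha : cderiv (fun x => a * x) z a.
  by have := cderivZ a (cderiv_id z); rewrite mulr1.
exact: (@cderiv_comp R f (fun x => a * x) z _ _ ha h).
Qed.

Let two : C := (2 : R)%:C.
Let half : C := (2^-1 : R)%:C.

(** The relation [hecke_two] integrated: the inner derivatives turn [2^11] into [2^10] and remove
    the factor 1/2. Every term vanishes at infinity, so the constant is 0. *)
Let hecke_Delprim (z : C) : 0 < complex.Im z ->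
  2 ^+ 10 * F (two * z) + (F (half * z) + F (half * z + half)) + 24 * F z = 0.
Proof.
have I2 (w : C) : complex.Im (two * w) = 2 * complex.Im w by rewrite ImM /= mul0r addr0.
have Ih (w : C) : complex.Im (half * w) = complex.Im w / 2 by rewrite ImM /= mul0r addr0 mulrC.
have Ihh (w : C) : complex.Im (half * w + half) = complex.Im w / 2 by rewrite ImD Ih /= addr0.
move: z; apply: (@const_eq R (fun z => 2 ^+ 10 * F (two * z) + (F (half * z) + F (half * z + half)) + 24 * F z) 0) => [w w0|].
  have w2 : 0 < complex.Im (two * w) by rewrite I2 mulr_gt0.
  have wh : 0 < complex.Im (half * w) by rewrite Ih divr_gt0.
  have whh : 0 < complex.Im (half * w + half) by rewrite Ihh divr_gt0.
  have h2 := cderiv_scale0 (dF w2).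
  have hh := cderiv_scale0 (dF wh).
  have hhh := cderiv_scale (dF whh).
  have := cderivD (cderivD (cderivZ (2 ^+ 10) h2) (cderivD hh hhh)) (cderivZ 24 (dF w0)).
  apply: cderiv_eq.
  have E2 : two = 2 by rewrite /two rmorph_nat.
  have Eh : half = 2^-1 by rewrite /half fmorphV rmorph_nat.
  have := hecke_two w0; rewrite E2 Eh.
  have -> : 2^-1 * w + 2^-1 = (w + 1) / 2 by field.
  have -> : 2^-1 * w = w / 2 by rewrite mulrC.
  move: (Del _) (Del _) (Del _) (Del _) => a b c d h.
  have -> : 24 * a = - (- 24 * a) by ring.
  by rewrite -h; field.
have c0 := Delprim_decay (1 : {poly C}).
have ch : 0 < 2^-1 :> R by rewrite invr_gt0.
have l2 := conelimZ (2 ^+ 10) (conelim_None_scale (ltr0Sn R 1) c0).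
have lh := conelim_None_scale ch c0.
have lhh := conelim_None_shift 1 lh.
have r1 : (ratr 1 : R)%:C = 1 :> C by rewrite ratr1.
have := conelimD (conelimD l2 (conelimD lh lhh)) (conelimZ 24 c0).
rewrite !mulr0 !addr0; apply: conelim_eq => w _.
by rewrite r1 [half * (_ + _)]mulrDr mulr1.
Qed.

(** At the cusp 0 the integrated relation reads [(2^10 + 1 + 24) L(0) + L(1/2) = 0]. *)
Lemma cuspint_half : cuspint (Some 2^-1) (1 : {poly C}) = - 1049 * cuspint (Some 0) (1 : {poly C}).
Proof.
have ch : 0 < 2^-1 :> R by rewrite invr_gt0.
have c0 := cuspintP (Some 0) s1; have chalf := cuspintP (Some 2^-1) s1.
have l2 := conelimZ (2 ^+ 10) (conelim_0_scale (ltr0Sn R 1) c0).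
have lh := conelim_0_scale ch c0.
have e : cusp_shift (Some (2^-1)) (- 2^-1) = Some 0 by rewrite /= subrr.
have q : (ratr 2^-1 : R) = 2^-1 by rewrite fmorphV rmorph_nat.
have lhh : conelim (Some 0) (fun z => F (half * z + half)) (cuspint (Some 2^-1) (1 : {poly C})).
  apply: (@conelim_0_scale 2^-1 (fun z => F (z + half)) _ ch).
  rewrite -e; apply: conelim_shift; apply: conelim_eq chalf => z _.
  by rewrite rmorphN rmorphN /= q subrK.
have h := conelimD (conelimD l2 (conelimD lh lhh)) (conelimZ 24 c0).
have h0 : conelim (Some 0) (fun _ : C => 0 : C) 0 by exact: conelim_cst.
have := conelim_unique h (conelim_eq (fun z z0 => esym (hecke_Delprim z0)) h0).
move: (cuspint _ _) (cuspint _ _) => a b k.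
apply/eqP; rewrite -subr_eq0 -[X in _ == X]k; apply/eqP; ring.
Qed.

Local Notation LP := (@Lplus R).
Local Notation x := (LP (Some 0)).

Lemma Lplus_half : LP (Some 2^-1) 0 = - 1049 * x 0.
Proof.
have n1 : (-1)%:~R = -1 :> rat by rewrite mulrNz.
have e : cusp_neg (Some 2^-1) = cusp_shift (Some 2^-1) (-1)%:~R by apply/eqP.
have h := @cuspint_shiftX R (Some 2^-1) (-1) 0 isT.
rewrite Lplus0_even // /Lplus e h.
rewrite big_ord_recl big1 ?addr0; last by move=> i _; rewrite bin_small ?mul0r.
rewrite subnn !expr0 bin0 !mul1r cuspint_half.
by move: (cuspint _ _) => a; field.
Qed.

(** The cusp 1/2 is the inverse of -2, a translate of 0, so its moment of order 0 has a second
    expression through the tenth moment at -2. *)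
Lemma Lplus0_02 : 2073 * x 0 + 11340 * x 2 + 10080 * x 4 = 0.
Proof.
have h := @Lplus_inv R (Some (-2)%:~R) 0 isT.
have i1 : cusp_inv (Some (-2)%:~R) = Some 2^-1 by apply/eqP.
have {}h := etrans (etrans (esym Lplus_half) (congr1 (fun s => LP s 0) (esym i1))) h.
pose F0 i : C := if i == 0%N then 1024 else if i == 2%N then 45 * 256 else if i == 4%N then 210 * 64
   else if i == 6%N then 210 * 16 else if i == 8%N then 45 * 4 else if i == 10 then 1 else
   'C(10, i)%:R * (-2)%:~R ^+ (10 - i).
have e : LP (Some (-2)%:~R) 10 = (F0 0 - F0 10) * x 0 + (F0 2 - F0 8) * x 2 + (F0 4 - F0 6) * x 4.
  apply: (@Lplus0_sum R (-2) 10 F0 isT); move=> i i10 {h i1}.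
  have c2 : (-2)%:~R = - 2 :> C by rewrite mulrNz.
  rewrite /F0 c2.
  case: eqP => [->|_]; first by rewrite (_ : 'C(10, 0) = 1%N) // [(10 - 0)%N]/=; ring.
  case: eqP => [->|_]; first by rewrite (_ : 'C(10, 2) = 45%N) // [(10 - 2)%N]/=; ring.
  case: eqP => [->|_]; first by rewrite (_ : 'C(10, 4) = 210%N) // [(10 - 4)%N]/=; ring.
  case: eqP => [->|_]; first by rewrite (_ : 'C(10, 6) = 210%N) // [(10 - 6)%N]/=; ring.
  case: eqP => [->|_]; first by rewrite (_ : 'C(10, 8) = 45%N) // [(10 - 8)%N]/=; ring.
  case: eqP => [->|_]; first by rewrite (_ : 'C(10, 10) = 1%N) // [(10 - 10)%N]/=; ring.
  by [].
have := etrans h (congr1 (fun y => (-1) ^+ 0 * y + x 0) e); rewrite /F0 /=.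
move: (x 0) (x 2) (x 4) => a b c /eqP; rewrite -subr_eq0 => /eqP k.
rewrite -[RHS]oppr0 -k; ring.
Qed.

Lemma Lplus0_2 : 45 * x 2 = - 691 * (x 0 / 36).
Proof.
have := Lplus0_02; have := Lplus0_24 R.
move: (x 0) (x 2) (x 4) => a b c h1 h2.
(* The multiplier 240 eliminates [c], as [240 * 42 = 10080]. *)
have : 4860 * b + 2073 * a = (2073 * a + 11340 * b + 10080 * c) - 240 * (27 * b + 42 * c) by ring.
rewrite [X in _ = X - _]h2 [X in _ = _ - _ * X]h1 mulr0 subr0.
move=> h3; have -> : b = (4860 * b + 2073 * a) / 4860 - 2073 / 4860 * a by field.
by rewrite h3; field.
Qed.

Lemma Lplus0_4 : 210 * x 4 = 2073 * (x 0 / 36).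
Proof.
have := Lplus0_2; have := Lplus0_24 R.
move: (x 0) (x 2) (x 4) => a b c h1 h2.
have -> : 210 * c = 5 * (27 * b + 42 * c) - 3 * (45 * b) by ring.
by rewrite h1 h2; field.
Qed.

End HeckeTwo.

(** * The scalar is not zero *)

Section PeriodNonzero.
Variable R : realType.
Notation C := (complex R).

Lemma Eul_real_gt0 e (r : R) : 0 < r < 1 ->
  complex.Im (Eul e r%:C) = 0 /\ 0 < complex.Re (Eul e r%:C).
Proof.
move=> /andP[r0 r1].
have q1 : cabs (r%:C : C) < 1 by rewrite cabs_real gtr0_norm.
have [hR hI] := ccvg_ReIm (Eul_cvg e q1).
have uE (n : nat) : \prod_(k < n) (1 - (r%:C : C) ^+ k.+1) ^+ e =
    (\prod_(k < n) (1 - r ^+ k.+1) ^+ e)%:C.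
  by rewrite rmorph_prod; apply: eq_bigr => k _; rewrite rmorphXn rmorphB rmorph1 rmorphXn.
have I0 : complex.Im (Eul e (r%:C : C)) = 0.
  apply/eqP; rewrite eq_le; apply/andP; split.
    by apply: cvgr_to_le hI _; apply: nearW => n; rewrite uE.
  by apply: cvgr_to_ge hI _; apply: nearW => n; rewrite uE.
split => //; rewrite lt_def; apply/andP; split; last first.
  apply: cvgr_to_ge hR _; apply: nearW => n; rewrite uE /=; apply: prodr_ge0 => k _.
  by rewrite exprn_ge0 // subr_ge0 exprn_ile1 // ltW.
apply/eqP => R0; have := Eul_neq0 e q1; rewrite (_ : Eul e r%:C = 0) ?eqxx //.
exact: complexP.
Qed.

Lemma Del_imaginary_gt0 (t : R) : 0 < t -> 0 < complex.Re (Del ((0 : R) +i* t)).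
Proof.
move=> t0; set r : R := expR (- (2 * pi * t)).
have hr : 0 < r < 1.
  by rewrite expR_gt0 -[X in _ < X]expR0 ltr_expR oppr_lt0 !mulr_gt0 // pi_gt0.
have q : qe ((0 : R) +i* t) = r%:C.
  by rewrite /qe /= mulr0 cos0 sin0 mulr1 mulr0.
have [I0 R0] := Eul_real_gt0 24 hr.
by rewrite DelE // q ReM I0 mulr0 subr0 mulr_gt0 //; case/andP: hr.
Qed.

Local Opaque cuspint Delprim Del.

(** On the imaginary axis [Delta] is positive, so the imaginary part of the primitive strictly
    increases with height. It tends to 0 at infinity, hence cannot also tend to 0 at the cusp 0. *)
Lemma cuspint0_neq0 : cuspint (Some 0) (1 : {poly C}) != 0.
Proof.
have s1 : (size (1%R : {poly C}) <= 11)%N by rewrite size_poly1.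
pose G (z : C) : C := Delprim (1 : {poly C}) (z * 'i).
pose g (t : R) : R := complex.Im (G t%:C).
have iE (t : R) : t%:C * 'i = (0 : R) +i* t by apply: complexP; rewrite ?ReM ?ImM /=; ring.
have dg (t : R) : 0 < t -> is_derive t 1 g (complex.Re (Del ((0 : R) +i* t))).
  move=> t0; have hi : cderiv (fun z : C => z * 'i) t%:C 'i.
    by have := cderivM (cderiv_id t%:C) (cderiv_cst 'i t%:C); rewrite mulr0 addr0 mul1r.
  have I0 : 0 < complex.Im (t%:C * 'i : C) by rewrite iE.
  have h := @cderiv_comp R (Delprim 1) (fun z => z * 'i) _ _ _ hi (cderiv_Delprim s1 I0).
  have := rderiv_Im (cderiv_line h).
  by rewrite iE hornerC mulr1 ImM /= mulr1 mulr0 addr0.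
have mono (a b : R) : 0 < a -> a < b -> g a < g b.
  move=> a0 ab; have [| |c] := @MVT R g (fun t => complex.Re (Del ((0 : R) +i* t))) a b ab.
  - by move=> t; rewrite in_itv /= => /andP[ta _]; apply: dg; exact: lt_trans ta.
  - apply: derivable_within_continuous => t; rewrite in_itv /= => /andP[ta _].
    exact: (@ex_derive _ _ _ _ _ _ _ (dg t (lt_le_trans a0 ta))).
  rewrite in_itv /= => /andP[ac cb] e; rewrite -subr_gt0 e mulr_gt0 ?subr_gt0 //.
  by apply: Del_imaginary_gt0; exact: lt_trans ac.
have ai (t : R) : 0 < t -> cabs ((0 : R) +i* t) = t.
  by move=> t0; rewrite /cabs /= expr0n add0r sqrtr_sqr gtr0_norm.
have main (x1 x2 x3 x4 a b u : R) : x3 <= a -> - b <= x4 -> a < u -> b < u -> x2 < x3 -> x4 < x1 ->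
  u + u = x2 - x1 -> False by lra.
(* Twice [e] is the increase of [g] between 1 and 2, yet [|g| < e] both near 0 and far up. *)
apply/eqP => L0; pose e := (g 2 - g 1) / 2.
have e0 : 0 < e by rewrite divr_gt0 // subr_gt0 mono // ltr1n.
have [d d0 hd] := Delprim_decay (1 : {poly C}) ltr01 e0.
have [d' d0' hd'] := cuspintP (Some 0) s1 ltr01 e0.
have [t [t2 td]] : exists t : R, 2 < t /\ d^-1 < t.
  by exists (d^-1 + 2); rewrite ltrDr invr_gt0 d0 ltrDl.
have m0 : 0 < Num.min 1 d' by rewrite lt_min ltr01.
have [m1 m2] : Num.min 1 d' <= 1 /\ Num.min 1 d' <= d' by rewrite !ge_min !lexx orbT.
have [t' [t0' t1' td']] : exists t' : R, [/\ 0 < t', t' < 1 & t' < d'].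
  by exists (Num.min 1 d' / 2); split; lra.
have tt : 0 < t by lra.
have h1 : cabs (Delprim 1 ((0 : R) +i* t) - 0) < e.
  apply: hd => //=.
  by rewrite /cusp_near ai //= mul1r.
have h2 : cabs (Delprim 1 ((0 : R) +i* t') - cuspint (Some 0) (1 : {poly C})) < e.
  apply: hd' => //=; rewrite (_ : (ratr 0 : R)%:C = 0) ?rmorph0 // subr0 ai // mul1r.
  by [].
have gE (u : R) : g u = complex.Im (Delprim 1 ((0 : R) +i* u)) by rewrite /g /G iE.
have := cabs_Im (Delprim 1 ((0 : R) +i* t)); rewrite -(gE t) ler_norml => /andP[_ k2].
have := cabs_Im (Delprim 1 ((0 : R) +i* t')); rewrite -(gE t') ler_norml => /andP[k1 _].
rewrite subr0 in h1; rewrite L0 subr0 in h2.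
have t0 : 0 < 2 :> R by [].
have g2 := mono _ _ t0 t2; have g1 : g t' < g 1 by exact: mono.
have e2 : e + e = g 2 - g 1 by rewrite /e; move: (g 2 - g 1) => u; field.
exact: (main _ _ _ _ _ _ _ k2 k1 h1 h2 g2 g1 e2).
Qed.

End PeriodNonzero.

(** * Binary forms over a finite field and the Eisenstein boundary symbol *)

Definition wt (j : nat) : int := nth 0 [:: 36; 0; -691; 0; 2073; 0; -2073; 0; 691; 0; -36] j.

(** Infinity is read as [1 / 0], so that numerator and denominator always form a coprime pair. *)
Definition cnum (s : option rat) : int := if s is Some r then numq r else 1.
Definition cden (s : option rat) : int := if s is Some r then denq r else 0.

Section EisensteinSymbol.
Variable F : finFieldType.
Implicit Types (a b x y l : F) (n : nat -> int).

(* For [(x, y) <> 0] the sum has at most one term; [(a, b)] stands for the cusp [a / b]. *)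
Definition eisen a b x y : F := \sum_(l | (a == l * y) && (b == - (l * x))) (- 36 * l ^+ 2).

(** Replacing [l] by [- l] shows that the sign ambiguity of the pair [(a, b)] is harmless. *)
Lemma eisenN a b x y : eisen (- a) (- b) x y = eisen a b x y.
Proof.
rewrite /eisen (reindex_inj oppr_inj) /=; apply: eq_big => [l|l _]; last by rewrite sqrrN.
by rewrite !mulNr !eqr_opp.
Qed.

Lemma eisen_frac (m d : int) x y : coprime `|m| `|d| -> d != 0 ->
  eisen (numq (m%:~R / d%:~R))%:~R (denq (m%:~R / d%:~R))%:~R x y = eisen m%:~R d%:~R x y.
Proof.
move=> cmd d0; rewrite coprimeq_num // coprimeq_den // (negPf d0).
case: (ltgtP d 0) d0 => // h _; last by rewrite gtr0_sg // mul1r gtr0_norm.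
by rewrite ltr0_sg // mulN1r ltr0_norm // !rmorphN /= eisenN.
Qed.

Definition eis s x y : F := eisen (cnum s)%:~R (cden s)%:~R x y.

Lemma eis_shift s (c : int) x y : eis (cusp_shift s c%:~R) x y = eis s x (y + c%:~R * x).
Proof.
have E a b : eisen (a + c%:~R * b) b x y = eisen a b x (y + c%:~R * x).
  apply: eq_bigl => l; case: (b =P - (l * x)) => [->|_]; rewrite ?andbF // !andbT.
  by rewrite mulrN subr_eq mulrDr [c%:~R * (_ * _)]mulrCA.
case: s => [r|]; rewrite /eis /=; last by rewrite -E mulr0 addr0.
have d0 := denq_neq0 r; rewrite -E.
have -> : r + c%:~R = (numq r + c * denq r)%:~R / (denq r)%:~R.
  by rewrite rmorphD rmorphM /= mulrDl mulfK ?intr_eq0 // divq_num_den.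
rewrite eisen_frac ?rmorphD ?rmorphM //.
by rewrite -coprimezE /coprimez gcdzC addrC gcdzMDl gcdzC -/(coprimez _ _) coprimezE coprime_num_den.
Qed.

Lemma eis_inv s x y : eis (cusp_inv s) x y = eis s y (- x).
Proof.
have E a b : eisen (- b) a x y = eisen a b y (- x).
  by apply: eq_bigl => l; rewrite andbC mulrN [- b == _]eqr_oppLR.
rewrite /eis -E; case: s => [r|] /=; last by rewrite oppr0.
have [->|r0] := eqVneq r 0; first by rewrite /= -[RHS]eisenN opprK oppr0.
have n0 : numq r != 0 by rewrite numq_eq0.
have -> : - r^-1 = (- denq r)%:~R / (numq r)%:~R.
  by rewrite -{1}(divq_num_den r) invf_div rmorphN mulNr.
by rewrite eisen_frac ?rmorphN // abszN coprime_sym coprime_num_den.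
Qed.

(** It moves the binomial weight of the target coefficient to the source coefficient, which makes
    translation act on the weighted moments with integral coefficients. *)
Lemma bin_swap : forall j i, (j <= 10)%N -> (i <= 10)%N ->
  ('C(10, j) * 'C(j, i) = 'C(10, i) * 'C(10 - i, 10 - j))%N.
Proof.
have h : all (fun j => all (fun i => 'C(10, j) * 'C(j, i) == 'C(10, i) * 'C(10 - i, 10 - j))%N (iota 0 11)) (iota 0 11).
  by vm_compute.
move=> j i hj hi; have /allP h1 := h.
have mem k : (k <= 10)%N -> k \in iota 0 11 by rewrite mem_iota.
by have /allP h2 := h1 j (mem j hj); exact: (eqP (h2 i (mem i hi))).
Qed.

(** Coefficients of the form [n(x, y + c x)]; for [i > j] the binomial vanishes, so the truncated
    exponent is harmless. *)
Definition shift_coef (c : int) n j : int := \sum_(i < 11) ('C(10 - i, 10 - j)%:R * c ^+ (j - i) * n i).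
Definition inv_coef n j : int := (-1) ^+ j * n (10 - j)%N + wt j.
Definition binform n x y : F := \sum_(j < 11) (n j)%:~R * x ^+ j * y ^+ (10 - j).

Lemma binform_shift c n x y : binform (shift_coef c n) x y = binform n x (y + c%:~R * x).
Proof.
rewrite /binform; under eq_bigr => j _.
  rewrite rmorph_sum /= mulr_suml mulr_suml; over.
rewrite exchange_big; apply: eq_bigr => i _ /=.
have hi : (i <= 10)%N by rewrite -ltnS.
rewrite addrC exprDn mulr_sumr (big_ord_widen_cond 11 predT (fun k => (n i)%:~R * x ^+ i *
   ((c%:~R * x) ^+ (10 - i - k) * y ^+ k *+ 'C(10 - i, k)))) ?ltnS ?leq_subr //.
rewrite [RHS]big_mkcond [RHS](reindex_inj rev_ord_inj) /=; apply: eq_bigr => j _.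
have hj : (j <= 10)%N by rewrite -ltnS.
rewrite !subSS ltnS; case: ifP => [h|/negbT]; last first.
  by rewrite -ltnNge => h; rewrite bin_small // !mul0r.
have ij : (i <= j)%N by move: h hi hj; clear; lia.
have -> : (10 - i - (10 - j) = j - i)%N by move: ij hj; clear; lia.
rewrite !rmorphM rmorphXn /= rmorph_nat exprMn [RHS]mulrnAr -[RHS]mulr_natl.
have -> : x ^+ j = x ^+ i * x ^+ (j - i) by rewrite -exprD subnKC.
ring.
Qed.

Lemma binform_inv n x y : binform (inv_coef n) x y = binform n y (- x) + binform wt x y.
Proof.
rewrite /binform [X in _ = X + _](reindex_inj rev_ord_inj) /= -big_split /=; apply: eq_bigr => j _.
have hj : (j <= 10)%N by rewrite -ltnS.
rewrite !subSS subKn // /inv_coef rmorphD rmorphM rmorphXn /= rmorphN1 [(- x) ^+ j]exprNn.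
ring.
Qed.

End EisensteinSymbol.

(** * Reduction of the period polynomial modulo 5 and 7 *)

Section PeriodPolynomial.
Variable p : nat.
Hypothesis p57 : p = 5%N \/ p = 7%N.

Lemma prime57 : prime p. Proof. by case: p57 => ->. Qed.

Lemma dvdz_Fp (z : int) : (z%:~R == 0 :> 'F_p) = (p%:Z %| z)%Z.
Proof. by rewrite (dvdz_pcharf (pchar_Fp prime57)). Qed.

Lemma dvdn_Fp (n : nat) : (n%:R == 0 :> 'F_p) = (p %| n)%N.
Proof. by rewrite (dvdn_pcharf (pchar_Fp prime57)). Qed.

Lemma Fp_expf (x : 'F_p) : x != 0 -> x ^+ p.-1 = 1.
Proof.
move=> x0; have := expf_card x; rewrite card_Fp ?prime57 //.
by move=> h; apply: (mulIf x0); rewrite mul1r -exprSr prednK // prime_gt0 // prime57.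
Qed.

(** 12 is a multiple of both 4 and 6, the orders of the unit groups. *)
Lemma Fp_exp12 (x : 'F_p) : x != 0 -> x ^+ 12 = 1.
Proof.
move=> /Fp_expf h; case: p57 => e.
  have e1 : p.-1 = 4%N by rewrite e.
  by rewrite (exprM _ 4 3) -{1}e1 h expr1n.
have e1 : p.-1 = 6%N by rewrite e.
by rewrite (exprM _ 6 2) -{1}e1 h expr1n.
Qed.

Lemma binform_wt (x y : 'F_p) : binform wt x y =
  36 * (y ^+ 10 - x ^+ 10) - 691 * (x ^+ 2 * y ^+ 8 - 3 * x ^+ 4 * y ^+ 6 + 3 * x ^+ 6 * y ^+ 4 - x ^+ 8 * y ^+ 2).
Proof.
rewrite /binform !big_ord_recr big_ord0 /= /wt /=.
rewrite !rmorphN /= ?rmorph0; ring.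
Qed.

(** With exponents reduced modulo [p - 1], the form becomes [2800 (y^2 - x^2)] for 5 and
    [- 2037 (y^4 - x^4)] for 7. *)
Lemma binform_wt0 (x y : 'F_p) : x != 0 -> y != 0 -> binform wt x y = 0.
Proof.
move=> /Fp_expf hx /Fp_expf hy; rewrite binform_wt; case: p57 => e.
  have e1 : p.-1 = 4%N by rewrite e.
  rewrite e1 in hx hy.
  have -> : y ^+ 10 = y ^+ 2 * (y ^+ 4) ^+ 2 by ring.
  have -> : x ^+ 10 = x ^+ 2 * (x ^+ 4) ^+ 2 by ring.
  have -> : y ^+ 8 = (y ^+ 4) ^+ 2 by ring.
  have -> : x ^+ 8 = (x ^+ 4) ^+ 2 by ring.
  have -> : y ^+ 6 = y ^+ 2 * y ^+ 4 by ring.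
  have -> : x ^+ 6 = x ^+ 2 * x ^+ 4 by ring.
  rewrite hx hy !expr1n !mulr1 !mul1r.
  have h : 2800%:R = 0 :> 'F_p by apply/eqP; rewrite dvdn_Fp e.
  transitivity (2800%:R * (y ^+ 2 - x ^+ 2)); [ring | by rewrite h mul0r].
have e1 : p.-1 = 6%N by rewrite e.
rewrite e1 in hx hy.
have -> : y ^+ 10 = y ^+ 4 * y ^+ 6 by ring.
have -> : x ^+ 10 = x ^+ 4 * x ^+ 6 by ring.
have -> : y ^+ 8 = y ^+ 2 * y ^+ 6 by ring.
have -> : x ^+ 8 = x ^+ 2 * x ^+ 6 by ring.
rewrite hx hy !mulr1.
have h : 2037%:R = 0 :> 'F_p by apply/eqP; rewrite dvdn_Fp e.
transitivity (- 2037%:R * (y ^+ 4 - x ^+ 4)); [ring | by rewrite h oppr0 mul0r].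
Qed.

Lemma eis0E (x y : 'F_p) : eis (Some 0) x y = if (y == 0) && (x != 0) then - 36 * x ^- 2 else 0.
Proof.
rewrite /eis /= /eisen.
case: eqP => [->|/eqP y0] /=; last first.
  rewrite big1 // => l /andP[/eqP]; rewrite mulr0z => /esym/eqP; rewrite mulf_eq0 (negPf y0) orbF.
  by move=> /eqP ->; rewrite mul0r oppr0 oner_eq0.
case: eqP => [->|/eqP x0] /=.
  by rewrite big_pred0 // => l; rewrite !mulr0 oppr0 oner_eq0 andbF.
rewrite (big_pred1 (- x^-1)) => [|l]; first by rewrite sqrrN exprVn.
rewrite mulr0 eqxx /=; apply/eqP/eqP => [e|->]; last by rewrite mulNr mulVf // opprK.
by apply: (mulIf x0); rewrite mulNr mulVf // -[LHS]opprK -e.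
Qed.

Lemma eisooE (x y : 'F_p) : eis None x y = if (x == 0) && (y != 0) then - 36 * y ^- 2 else 0.
Proof.
have -> : eis None x y = eis (Some 0) y (- x) by rewrite -eis_inv.
by rewrite eis0E oppr_eq0.
Qed.

(** Off the axes both sides vanish. On an axis only the term with coefficient 36 or -36 survives,
    and [z^10 = z^-2]. *)
Lemma binform_wt_eis (x y : 'F_p) : binform wt x y = eis (Some 0) x y - eis None x y.
Proof.
have inv (z : 'F_p) : z != 0 -> z ^- 2 = z ^+ 10.
  move=> z0; apply: (@mulIf _ (z ^+ 2)); first by rewrite expf_neq0.
  by rewrite mulVf ?expf_neq0 // -exprD Fp_exp12.
rewrite eis0E eisooE; have [->|x0] := eqVneq x 0; have [->|y0] := eqVneq y 0 => /=.
- by rewrite binform_wt; ring.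
- by rewrite binform_wt inv //; ring.
- by rewrite binform_wt inv //; ring.
- by rewrite binform_wt0 // subrr.
Qed.

Lemma eis01 s : eis s (0 : 'F_p) 1 = if (p%:Z %| cden s)%Z then - 36 * (cnum s)%:~R ^+ 2 else 0.
Proof.
rewrite -dvdz_Fp /eis /eisen; case: eqP => [->|h].
  rewrite (big_pred1 ((cnum s)%:~R : 'F_p)) // => l.
  by rewrite mulr0 oppr0 mulr1 eqxx andbT eq_sym.
by rewrite big_pred0 // => l; rewrite mulr0 oppr0; move/eqP/negPf: h => ->; rewrite andbF.
Qed.

Lemma binform01 n : binform n (0 : 'F_p) 1 = (n 0%N)%:~R.
Proof.
rewrite /binform big_ord_recl big1 => [|i _]; first by rewrite addr0 expr0 expr1n !mulr1.
by rewrite expr0n /= mulr0 mul0r.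
Qed.

Variable R : realType.
Notation C := (complex R).
Local Notation LP := (@Lplus R).
Local Notation k' := (LP (Some 0) 0 / 36).

Lemma wt_odd j : (j <= 10)%N -> odd j -> wt j = 0.
Proof. by do 11 (case: j => [|j] //). Qed.

Lemma even_le10 j : (j <= 10)%N -> ~~ odd j -> j \in [:: 0; 2; 4; 6; 8; 10]%N.
Proof. by do 11 (case: j => [|j] //). Qed.

Lemma Lplus0_wt j : (j <= 10)%N -> 'C(10, j)%:R * LP (Some 0) j = k' * (wt j)%:~R.
Proof.
move=> j10; have [oj|ej] := boolP (odd j).
  by rewrite (wt_odd j10 oj) (Lplus0_odd R oj) !mulr0.
have b2 : 'C(10, 2) = 45%N by []. have b4 : 'C(10, 4) = 210%N by [].
have b6 : 'C(10, 6) = 210%N by []. have b8 : 'C(10, 8) = 45%N by [].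
have := even_le10 j10 ej; rewrite !inE.
have n691 : (-691)%:~R = - 691 :> C := mulrNz _ _.
have n2073 : (-2073)%:~R = - 2073 :> C := mulrNz _ _.
have n36 : (-36)%:~R = - 36 :> C := mulrNz _ _.
have e2 := Lplus0_2 R; have e4 := Lplus0_4 R.
have s0 : LP (Some 0) 10 = - LP (Some 0) 0 := @Lplus0_sym R 0 isT isT.
have s2 : LP (Some 0) 8 = - LP (Some 0) 2 := @Lplus0_sym R 2 isT isT.
have s4 : LP (Some 0) 6 = - LP (Some 0) 4 := @Lplus0_sym R 4 isT isT.
case/orP=> [/eqP ->|/orP[/eqP ->|/orP[/eqP ->|/orP[/eqP ->|/orP[/eqP ->|/eqP ->]]]]].
- by rewrite bin0 mul1r; move: (LP _ _) => a; rewrite /wt [nth _ _ _]/=; field.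
- rewrite b2 e2 [wt 2]/= n691; exact: mulrC.
- rewrite b4 e4 [wt 4]/=; exact: mulrC.
- rewrite s4 b6 mulrN e4 [wt 6]/= n2073 mulrN; congr (- _); exact: mulrC.
- rewrite s2 b8 mulrN e2 [wt 8]/= mulNr opprK; exact: mulrC.
- by rewrite s0 binn mul1r [wt 10]/= n36 mulrN; move: (LP _ _) => a; field.
Qed.

(** One integral vector [n] must serve both properties, so they are proved together along
    [cusp_ind]: moments and boundary symbol obey the same rules under translation and inversion, the
    cocycle term being [wt] on one side and the difference at 0 and infinity on the other. *)
Lemma Lplus_binform s : exists n : nat -> int,
  (forall j, (j <= 10)%N -> 'C(10, j)%:R * LP s j = k' * (n j)%:~R) /\
  (forall x y : 'F_p, binform n x y = eis s x y - eis None x y).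
Proof.
pose P t := exists n : nat -> int,
  (forall j, (j <= 10)%N -> 'C(10, j)%:R * LP t j = k' * (n j)%:~R) /\
  (forall x y : 'F_p, binform n x y = eis t x y - eis None x y).
have Pshift t (c : int) : P t -> P (cusp_shift t c%:~R).
  move=> [n [h1 h2]]; exists (shift_coef c n); split=> [j hj|x y]; last first.
    by rewrite binform_shift h2 eis_shift -(eis_shift None c).
  rewrite Lplus_shift // mulr_sumr rmorph_sum mulr_sumr /=; apply: eq_bigr => i _.
  have hi : (i <= 10)%N by rewrite -ltnS.
  rewrite !rmorphM rmorphXn /= rmorph_nat.
  have : 'C(10, j)%:R * 'C(j, i)%:R = 'C(10, i)%:R * 'C(10 - i, 10 - j)%:R :> C.
    by rewrite -!natrM bin_swap.
  have := h1 i hi; move: (c%:~R ^+ (j - i)) ('C(10, j)%:R) ('C(10, i)%:R) ('C(j, i)%:R) (LP t i) => d u w v L e f.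
  have -> : u * (v * d * L) = (u * v) * d * L by ring.
  rewrite f; have -> : w * 'C(10 - i, 10 - j)%:R * d * L = (w * L) * 'C(10 - i, 10 - j)%:R * d by ring.
  by rewrite e; ring.
rewrite -/(P s); elim/cusp_ind: s => [|s|s|s].
- exists (fun=> 0); split=> [j hj|x y]; first by rewrite Lplus_oo // !mulr0.
  by rewrite subrr /binform big1 // => i _; rewrite !mul0r.
- exact: (@Pshift s 1).
- exact: (@Pshift s (-1)).
move=> [n [h1 h2]]; exists (inv_coef n); split=> [j hj|x y]; last first.
  rewrite binform_inv h2 binform_wt_eis eis_inv -(eis_inv None x y) /=.
  by move: (eis _ _ _) (eis _ _ _) (eis _ _ _) => a b c; ring.
rewrite Lplus_inv // mulrDr Lplus0_wt // /inv_coef rmorphD rmorphM rmorphXn /= rmorphN1 mulrDr.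
congr (_ + _); have := h1 (10 - j)%N (leq_subr _ _); rewrite bin_sub // => e.
by rewrite mulrCA e mulrCA.
Qed.

Lemma Lplus_const s : exists n : nat -> int,
  (forall j, (j <= 10)%N -> 'C(10, j)%:R * LP s j = k' * (n j)%:~R) /\
  (n 0%N)%:~R = 36 - (if (p%:Z %| cden s)%Z then 36 * (cnum s)%:~R ^+ 2 else 0) :> 'F_p.
Proof.
have [n [h1 h2]] := Lplus_binform s; exists n; split=> //.
rewrite -binform01 h2 !eis01 dvdz0 (_ : (cnum None)%:~R = 1) //.
by case: ifP => _; ring.
Qed.

End PeriodPolynomial.

(** * Cusps as coprime pairs up to sign, and their orbits under Gamma_1(p) *)

Lemma cusp_coprime (x : option rat) : coprimez (cnum x) (cden x).
Proof. by case: x => [x|] //=; rewrite coprimezE coprime_num_den. Qed.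

Definition cusp_of (m n : int) : option rat := if n == 0 then None else Some (m%:~R / n%:~R).

Lemma cusp_of_num_den (m n : int) : coprimez m n ->
  exists2 e : int, e = 1 \/ e = -1 & m = e * cnum (cusp_of m n) /\ n = e * cden (cusp_of m n).
Proof.
rewrite coprimezE => h; rewrite /cusp_of; have [n0|n0] := eqVneq n 0.
  move: h; rewrite n0 /= /coprime gcdn0 => /eqP h.
  by exists m; rewrite ?mulr1 ?mulr0 //; lia.
exists (Num.sg n); first by case: sgrP n0 => //; [left | right].
rewrite /= coprimeq_num // coprimeq_den // (negPf n0) mulrA -expr2 sqr_sg n0 mul1r.
by rewrite -numEsg.
Qed.

Lemma cusp_ofK (x : option rat) : cusp_of (cnum x) (cden x) = x.
Proof. by case: x => [x|] //; rewrite /cusp_of /= (negPf (denq_neq0 x)) divq_num_den. Qed.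

Lemma cusp_ofN (m n : int) : cusp_of (- m) (- n) = cusp_of m n.
Proof. by rewrite /cusp_of oppr_eq0 !rmorphN /= invrN mulrNN. Qed.

(** Homogeneous coordinates absorb the case distinctions at infinity. *)
Lemma mobiusE (a b c d : int) x :
  mobius a b c d x = cusp_of (a * cnum x + b * cden x) (c * cnum x + d * cden x).
Proof.
case: x => [x|] /=; last by rewrite !mulr1 !mulr0 !addr0.
rewrite /cusp_of; have d0 : (denq x)%:~R != 0 :> rat by rewrite intr_eq0.
have E (u v : int) : u%:~R * x + v%:~R = (u * numq x + v * denq x)%:~R / (denq x)%:~R.
  by rewrite rmorphD !rmorphM /= mulrDl mulfK // -mulrA divq_num_den.
rewrite !E mulf_eq0 invr_eq0 (negPf d0) orbF intr_eq0; case: ifP => // _.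
by rewrite invf_div mulrA divfK.
Qed.

Section Orbits.
Variable p : nat.
Hypothesis p57 : p = 5%N \/ p = 7%N.

Lemma eqz_Fp (m n : int) : (m == n %[mod p])%Z = (m%:~R == n%:~R :> 'F_p).
Proof. by rewrite eqz_mod_dvd -(dvdz_Fp p57) rmorphB subr_eq0. Qed.

(** Modulo [p] a matrix of Gamma_1(p) is unipotent upper triangular, so it fixes [(m, 0)]; the sign
    comes from the pair being defined up to sign only. *)
Lemma Gamma1_orbitP (x y : option rat) : (p%:Z %| cden x)%Z ->
  Gamma1_orbit p x y <-> (p%:Z %| cden y)%Z /\
   ((cnum y)%:~R = (cnum x)%:~R :> 'F_p \/ (cnum y)%:~R = - (cnum x)%:~R :> 'F_p).
Proof.
move=> px; have px0 : (cden x)%:~R = 0 :> 'F_p by apply/eqP; rewrite (dvdz_Fp p57).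
have ones (e : int) : e = 1 \/ e = -1 -> e * e = 1 by case=> ->.
have [[u v] /= uv] := coprimezP _ _ (cusp_coprime x).
split.
  move=> [a [b [c [d [/and4P[/eqP det a1 d1 pc] ->]]]]].
  rewrite mobiusE; set A := a * _ + _; set C := c * _ + _.
  have cAC : coprimez A C.
    apply/coprimezP; exists (u * d - v * c, v * a - u * b) => /=; rewrite -[RHS]uv -[LHS]mul1r /A /C.
    have -> : u * cnum x + v * cden x = (a * d - b * c) * (u * cnum x + v * cden x) by rewrite det mul1r.
    ring.
  have [e he [hA hC]] := cusp_of_num_den cAC.
  have hn : cnum (cusp_of A C) = e * A by rewrite {2}hA mulrA ones // mul1r.
  have hd : cden (cusp_of A C) = e * C by rewrite {2}hC mulrA ones // mul1r.
  rewrite hn hd -!(dvdz_Fp p57) !rmorphM /= /A /C !rmorphD !rmorphM /= px0 !mulr0 !addr0.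
  move: a1 pc; rewrite eqz_Fp -(dvdz_Fp p57) => /eqP -> /eqP ->; rewrite mul0r mulr0 eqxx; split=> //.
  by case: he => ->; [left | right]; rewrite ?rmorphN /= ?mulN1r !mul1r.
move=> [py hy].
have [e he hye] : exists2 e : int, e = 1 \/ e = -1 & (e * cnum y)%:~R = (cnum x)%:~R :> 'F_p.
  case: hy => h; [exists 1 | exists (-1)]; rewrite ?mul1r ?mulN1r ?rmorphN /= ?h ?opprK //; by [left | right].
have py0 : (cden y)%:~R = 0 :> 'F_p by apply/eqP; rewrite (dvdz_Fp p57).
have [[u' v'] /= uv'] := coprimezP _ _ (cusp_coprime y).
pose m := cnum x; pose n := cden x; pose m' := e * cnum y; pose n' := e * cden y.
pose s := e * u'; pose t := - (e * v').
have det' : m' * s - t * n' = 1.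
  by rewrite -uv' /m' /n' /s /t; have := ones e he; move: (cnum y) (cden y) => a b ee;
     rewrite -[RHS]mul1r -ee; ring.
have det : m * u + v * n = 1 by rewrite -uv /m /n; ring.
(* The product of the matrix with columns [(m', n')], [(t, s)] and the inverse of the one with
   columns [(m, n)], [(- v, u)]; both have determinant 1. *)
exists (m' * u - t * n), (m' * v + t * m), (n' * u - s * n), (n' * v + s * m).
have eF (z w : int) : z = w -> z%:~R = w%:~R :> 'F_p by move=> ->.
have n0 : n%:~R = 0 :> 'F_p by [].
have n'0 : n'%:~R = 0 :> 'F_p by rewrite /n' rmorphM /= py0 mulr0.
have mm : m'%:~R = m%:~R :> 'F_p by [].
have yE : cusp_of m' n' = y.
  by rewrite /m' /n'; case: he => ->; rewrite ?mul1r ?mulN1r ?cusp_ofN cusp_ofK.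
rewrite mobiusE -/m -/n; clearbody m n m' n' s t.
have d1 := eF _ _ det; have d2 := eF _ _ det'.
rewrite rmorphD !rmorphM /= n0 mulr0 addr0 in d1.
rewrite rmorphB !rmorphM /= n'0 mulr0 subr0 mm in d2.
split; last first.
  rewrite -{1}yE; congr cusp_of; rewrite -[LHS]mul1r -det; ring.
apply/and4P; split.
- apply/eqP; rewrite -[RHS]det -[RHS]mul1r -det'; ring.
- by rewrite eqz_Fp rmorphB !rmorphM /= n0 mm mulr0 subr0 d1.
- by rewrite eqz_Fp rmorphD !rmorphM /= n'0 mul0r add0r mulrC d2.
- by rewrite -(dvdz_Fp p57) rmorphB !rmorphM /= n'0 n0 mul0r mulr0 subr0.
Qed.

Lemma cnum_Fp_neq0 x : (p%:Z %| cden x)%Z -> (cnum x)%:~R != 0 :> 'F_p.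
Proof.
move=> px; have [[u v] /= uv] := coprimezP _ _ (cusp_coprime x).
have : (u * cnum x + v * cden x)%:~R = 1 :> 'F_p by rewrite uv.
have -> : (u * cnum x + v * cden x)%:~R = u%:~R * (cnum x)%:~R + v%:~R * (cden x)%:~R :> 'F_p.
  by rewrite rmorphD !rmorphM.
have -> : (cden x)%:~R = 0 :> 'F_p by apply/eqP; rewrite (dvdz_Fp p57).
rewrite mulr0 addr0 => h; apply/eqP => h0; move: h; rewrite h0 mulr0 => /eqP.
by rewrite eq_sym oner_eq0.
Qed.

(** Equality up to sign is equality of squares, which hides the sign and matches the quadratic shape
    of the boundary symbol. *)
Lemma Gamma1_orbit_base (x0 x : option rat) (m : nat) : cnum x0 = m -> (p%:Z %| cden x0)%Z ->
  Gamma1_orbit p x0 x <-> (p%:Z %| cden x)%Z /\ ((cnum x)%:~R ^+ 2 = m%:R ^+ 2 :> 'F_p).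
Proof.
move=> hm px0; rewrite (Gamma1_orbitP x px0) hm -pmulrn; split=> -[h1 h2]; split=> //.
  by case: h2 => ->; rewrite ?sqrrN.
have : ((cnum x)%:~R - m%:R) * ((cnum x)%:~R + m%:R) = 0 :> 'F_p by rewrite -subr_sqr h2 subrr.
move/eqP; rewrite mulf_eq0 subr_eq0 addr_eq0 => /orP[/eqP|/eqP]; by [left | right].
Qed.

End Orbits.

Lemma F5_sqr (t : 'F_5) : t ^+ 4 = 1 -> t ^+ 2 = 1%:R ^+ 2 \/ t ^+ 2 = 2%:R ^+ 2.
Proof.
move=> t4; have : (t ^+ 2 - 1%:R ^+ 2) * (t ^+ 2 - 2%:R ^+ 2) = 0.
  have -> : (t ^+ 2 - 1%:R ^+ 2) * (t ^+ 2 - 2%:R ^+ 2) = t ^+ 4 - 1 - 5%:R * (t ^+ 2 - 1) by ring.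
  have -> : 5%:R = 0 :> 'F_5 by apply/eqP.
  by rewrite t4 subrr mul0r subr0.
by move/eqP; rewrite mulf_eq0 !subr_eq0 => /orP[/eqP e|/eqP e]; [left | right].
Qed.

Lemma F7_sqr (t : 'F_7) : t ^+ 6 = 1 ->
  [\/ t ^+ 2 = 1%:R ^+ 2, t ^+ 2 = 2%:R ^+ 2 | t ^+ 2 = 3%:R ^+ 2].
Proof.
move=> t6; have : (t ^+ 2 - 1%:R ^+ 2) * (t ^+ 2 - 2%:R ^+ 2) * (t ^+ 2 - 3%:R ^+ 2) = 0.
  (* The product is [u^3 - 14 u^2 + 49 u - 36] at [u = t^2], which is [u^3 - 1] modulo 7. *)
  have -> : (t ^+ 2 - 1%:R ^+ 2) * (t ^+ 2 - 2%:R ^+ 2) * (t ^+ 2 - 3%:R ^+ 2) =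
     t ^+ 6 - 1 - 7%:R * (2 * t ^+ 4 - 7 * t ^+ 2 + 5) by ring.
  have -> : 7%:R = 0 :> 'F_7 by apply/eqP.
  by rewrite t6 subrr mul0r subr0.
move/eqP; rewrite !mulf_eq0 !subr_eq0 -orbA => /or3P[/eqP e|/eqP e|/eqP e].
- exact: Or31.
- exact: Or32.
- exact: Or33.
Qed.

(** The table is [2 a^2] on representatives: 2 for [a = 1], and [8 = 3] for [a = 2]. *)
Lemma phi5E x : phi 5 x = if (5%:Z %| cden x)%Z then 2 * (cnum x)%:~R ^+ 2 else 0.
Proof.
have p57 : 5%N = 5%N \/ 5%N = 7%N by left.
have n2 : cnum (pt 2 5) = 2%N by apply/eqP.
have d2 : (5%:Z %| cden (pt 2 5))%Z by [].
have o1 := @Gamma1_orbit_base 5 p57 P1oo x 1 erefl isT.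
have o2 := @Gamma1_orbit_base 5 p57 (pt 2 5) x 2 n2 d2.
rewrite /phi /=.
case: asboolP => [/o1[-> ->]|h1]; first by rewrite expr1n mulr1.
case: asboolP => [/o2[-> ->]|h2]; first by apply/eqP.
case: (boolP (5%:Z %| cden x)%Z) => // px.
have [e|e] := F5_sqr (@Fp_expf 5 p57 _ (@cnum_Fp_neq0 5 p57 x px)).
  by case: (h1 (o1.2 (conj px e))).
by case: (h2 (o2.2 (conj px e))).
Qed.

(** Again [2 a^2] on representatives: 2, then [8 = 1], then [18 = 4]. *)
Lemma phi7E x : phi 7 x = if (7%:Z %| cden x)%Z then 2 * (cnum x)%:~R ^+ 2 else 0.
Proof.
have p57 : 7%N = 5%N \/ 7%N = 7%N by right.
have n2 : cnum (pt 2 7) = 2%N by apply/eqP.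
have d2 : (7%:Z %| cden (pt 2 7))%Z by [].
have n3 : cnum (pt 3 7) = 3%N by apply/eqP.
have d3 : (7%:Z %| cden (pt 3 7))%Z by [].
have o1 := @Gamma1_orbit_base 7 p57 P1oo x 1 erefl isT.
have o2 := @Gamma1_orbit_base 7 p57 (pt 2 7) x 2 n2 d2.
have o3 := @Gamma1_orbit_base 7 p57 (pt 3 7) x 3 n3 d3.
rewrite /phi /=.
case: asboolP => [/o1[-> ->]|h1]; first by rewrite expr1n mulr1.
case: asboolP => [/o2[-> ->]|h2]; first by apply/eqP.
case: asboolP => [/o3[-> ->]|h3]; first by apply/eqP.
case: (boolP (7%:Z %| cden x)%Z) => // px.
have [e|e|e] := F7_sqr (@Fp_expf 7 p57 _ (@cnum_Fp_neq0 7 p57 x px)).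
- by case: (h1 (o1.2 (conj px e))).
- by case: (h2 (o2.2 (conj px e))).
- by case: (h3 (o3.2 (conj px e))).
Qed.

Lemma phiE p x : p = 5%N \/ p = 7%N ->
  phi p x = if (p%:Z %| cden x)%Z then 2 * (cnum x)%:~R ^+ 2 else 0.
Proof. by case=> ->; [exact: phi5E | exact: phi7E]. Qed.

(* Integrality of the plus symbol and comparison of periods *)
From mathcomp Require Import Rstruct Rstruct_topology.

Section Reduction.
Variable p : nat.
Hypothesis p57 : p = 5%N \/ p = 7%N.

(** Cross-multiplication gives [numq q * b = a * denq q]. If [p] divided [denq q] it would divide
    [numq q] too, against coprimality; hence the reduction can be read on any fraction whose
    denominator is prime to [p]. *)
Lemma redp_frac (a b : int) (q : rat) : ~~ (p%:Z %| b)%Z -> q = a%:~R / b%:~R ->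
  [/\ ~~ (p%:Z %| denq q)%Z, redp p q = a%:~R / b%:~R & (p%:Z %| numq q)%Z = (p%:Z %| a)%Z].
Proof.
rewrite -!(dvdz_Fp p57) => b0 qE.
have bq : b%:~R != 0 :> rat by rewrite intr_eq0; apply: contraNneq b0 => ->.
have dq : (denq q)%:~R != 0 :> rat by rewrite intr_eq0 denq_neq0.
have E : numq q * b = a * denq q.
  apply/eqP; rewrite -(inj_eq (@intr_inj rat)) !rmorphM /=; apply/eqP.
  by rewrite numqE qE mulrAC divfK.
have EF : (numq q)%:~R * b%:~R = a%:~R * (denq q)%:~R :> 'F_p.
  by have := congr1 (fun z : int => z%:~R : 'F_p) E; rewrite !rmorphM.
have d0 : (denq q)%:~R != 0 :> 'F_p.
  apply/negP => /eqP d0; move: EF; rewrite d0 mulr0 => /eqP; rewrite mulf_eq0 (negPf b0) orbF.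
  have /= := @cnum_Fp_neq0 p p57 (Some q); rewrite -(dvdz_Fp p57) d0 eqxx => /(_ isT) /negPf ->.
  by [].
split=> //; first by rewrite /redp; apply: (canRL (mulfK b0)); rewrite mulrAC EF mulfK.
apply/eqP/eqP => h; apply/eqP.
  by have := EF; rewrite h mul0r => /esym/eqP; rewrite mulf_eq0 (negPf d0) orbF.
by have := EF; rewrite h mul0r => /eqP; rewrite mulf_eq0 (negPf b0) orbF.
Qed.

End Reduction.

Lemma Delta_Del (z : CC) : 0 < complex.Im z -> Delta z = Del z.
Proof.
move=> z0; apply: climP; rewrite DelE //.
apply: ccvgZ; have := Eul_cvg 24 (cabs_qe_lt1 z0); apply: (ccvg_eq (N0 := 0)) => n _.
by rewrite big_add1 big_mkord.
Qed.

(** The canonical period: relative to it the value at 0 minus infinity is the integral vector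
    [wt]. *)
Local Notation Om0 := (@ctau RR * (@Lplus RR (Some 0) 0 / 36)).

Lemma modsym_coefE (j : 'I_11) (r s : P1Q) :
  modsym_coef j r s = 'C(10, j)%:R * (@ctau RR * (@cuspint RR r 'X^j - cuspint s 'X^j)).
Proof.
rewrite /modsym_coef; congr (_ * (_ * _)).
have sX : (size ('X^j : {poly CC}) <= 11)%N by rewrite size_polyXn.
apply: etrans (@geodE RR (fun z => Delta z * z ^+ j) 'X^j s r sX _); first by [].
by move=> z z0; rewrite hornerXn Delta_Del.
Qed.

Lemma modsym_plus_coefE (j : 'I_11) (r s : P1Q) :
  modsym_plus_coef j r s = @ctau RR * ('C(10, j)%:R * @Lplus RR r j - 'C(10, j)%:R * @Lplus RR s j).
Proof.
rewrite /modsym_plus_coef !modsym_coefE /Lplus.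
rewrite -[P1neg r]/(cusp_neg r) -[P1neg s]/(cusp_neg s).
move: (cuspint r _) (cuspint s _) (cuspint (cusp_neg r) _) (cuspint (cusp_neg s) _) => a b c d.
move: ('C(10, j)%:R) ((-1) ^+ j) (@ctau RR) => u v w.
by field.
Qed.

Lemma Om0_neq0 : Om0 != 0.
Proof.
have t0 : @ctau RR != 0 by rewrite -cabs_gt0 cabs_ctau mulr_gt0 // pi_gt0.
have n36 : (36 : CC) != 0 by rewrite pnatr_eq0.
by rewrite mulf_neq0 // mulf_neq0 ?invr_eq0 // Lplus0_even // cuspint0_neq0.
Qed.

(** The constant terms are [36 - 36 a^2] or 36, and [36 a^2 = 18 * (2 a^2)] explains the factor
    -18. *)
Lemma modsym_plus_int p (p57 : p = 5%N \/ p = 7%N) (r s : P1Q) : exists d : nat -> int,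
  (forall j : 'I_11, modsym_plus_coef j r s = Om0 * (d j)%:~R) /\
  (d 0%N)%:~R = - 18 * (phi p r - phi p s) :> 'F_p.
Proof.
have [nr [hr1 hr2]] := Lplus_const p57 RR r; have [ns [hs1 hs2]] := Lplus_const p57 RR s.
exists (fun j => nr j - ns j); split=> [j|].
  have j10 : (j <= 10)%N by rewrite -ltnS.
  rewrite modsym_plus_coefE hr1 // hs1 // rmorphB /=.
  by ring.
rewrite rmorphB /= hr2 hs2 !phiE //.
by case: ifP => _; case: ifP => _; ring.
Qed.

Theorem theorem3p5 (p : nat) (hp : p = 5%N \/ p = 7%N) :
  (exists Om : CC, is_cohom_period p Om) /\
  forall Om : CC, is_cohom_period p Om ->
  exists c : 'F_p, c != 0 /\
    forall r s : P1Q, exists q : rat,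
      is_Zploc p (modsym_plus_coef ord0 r s / Om) q /\
      redp p q = c * (phi p r - phi p s).
Proof.
(* The value at 0 minus infinity has constant coefficient 36 modulo [p], a unit: it witnesses that
   [Om0] is normalised and serves to compare it with any other period. *)
have [d0 [hd0 hd00]] := modsym_plus_int hp (Some 0) None.
have d0E : (d0 0%N)%:~R = 36 :> 'F_p.
  rewrite hd00 !phiE //= dvdz0 (_ : (p%:Z %| 1)%Z = false); last by case: hp => ->.
  by rewrite (_ : 1%:~R = 1) //; ring.
have p_d0 : ~~ (p%:Z %| d0 0%N)%Z.
  rewrite -(dvdz_Fp hp) d0E (dvdn_Fp hp 36).
  by case: hp => ->.
have pden (z : int) : ~~ (p%:Z %| denq z%:~R)%Z by rewrite denq_int; case: hp => ->.
split.
  exists Om0; split; first exact: Om0_neq0.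
  split=> [j r s|].
    have [d [hd _]] := modsym_plus_int hp r s; exists (d j)%:~R.
    by split=> //; rewrite hd mulrAC divff ?Om0_neq0 // mul1r ratr_int.
  exists ord0, (Some 0), None, (d0 0%N)%:~R; split; last by rewrite numq_int.
  by split=> //; rewrite hd0 mulrAC divff ?Om0_neq0 // mul1r ratr_int.
move=> Om [Om_neq0 [hZ [j1 [r1 [s1 [q1 [[q1E q1d] q1n]]]]]]].
have [q0 [q0E q0d]] := hZ ord0 (Some 0) None.
have d00 : (d0 0%N)%:~R != 0 :> rat by rewrite intr_eq0; apply: contraNneq p_d0 => ->.
(* The ratio [Om0 / Om] is rational. It is [p]-integral because [q0] is and [d0 0] is prime to [p];
   its numerator is prime to [p] because otherwise all values divided by [Om] would be divisible by
   [p]. *)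
pose u : rat := q0 / (d0 0%N)%:~R.
have uE : Om0 / Om = ratr u.
  rewrite /u fmorph_div /= -q0E ratr_int hd0 [X in _ = X / _]mulrAC mulfK //.
  by rewrite -(ratr_int _ (d0 0%N)) fmorph_eq0.
have sym_u (d : int) : Om0 * d%:~R / Om = ratr (u * d%:~R).
  have ratrM (v : rat) : ratr (v * d%:~R) = ratr v * d%:~R :> CC by rewrite rmorphM /= ratr_int.
  by rewrite mulrAC uE ratrM.
have [uden ured unum] : [/\ ~~ (p%:Z %| denq u)%Z, redp p u = (numq u)%:~R / (denq u)%:~R &
    (p%:Z %| numq u)%Z = (p%:Z %| numq q0)%Z].
  have b0 : ~~ (p%:Z %| denq q0 * d0 0%N)%Z.
    by rewrite -(dvdz_Fp hp) rmorphM mulf_eq0 !(dvdz_Fp hp) negb_or q0d.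
  have uq : u = (numq q0)%:~R / (denq q0 * d0 0%N)%:~R.
    by rewrite /u rmorphM /= invfM mulrA divq_num_den.
  by have [h1 _ h3] := redp_frac hp b0 uq.
clearbody u.
have mulu (d : int) : [/\ ~~ (p%:Z %| denq (u * d%:~R))%Z, redp p (u * d%:~R) = redp p u * d%:~R &
    (p%:Z %| numq (u * d%:~R))%Z = (p%:Z %| numq u * d)%Z].
  have e : u * d%:~R = (numq u * d)%:~R / (denq u)%:~R.
    by rewrite rmorphM /= mulrAC divq_num_den.
  have [h1 h2 h3] := redp_frac hp uden e; split=> //.
  by rewrite h2 ured rmorphM /= mulrAC.
have unum0 : ~~ (p%:Z %| numq u)%Z.
  have [d [hd _]] := modsym_plus_int hp r1 s1.
  have e1 : ratr q1 = ratr (u * (d j1)%:~R) :> CC by rewrite -q1E hd sym_u.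
  have q1u : q1 = u * (d j1)%:~R by exact: fmorph_inj e1.
  have [_ _ h] := mulu (d j1); move: q1n; rewrite q1u h; apply: contra => pu.
  exact: dvdz_mulr.
(* The constant is the one attached to [Om0], rescaled by the reduction of the unit [u]. *)
exists (- 18 * redp p u); split.
  rewrite mulf_neq0 // ?oppr_eq0 ?(dvdn_Fp hp 18); first by case: hp => ->.
  by rewrite ured mulf_neq0 ?invr_eq0 ?(dvdz_Fp hp).
move=> r s; have [d [hd h0]] := modsym_plus_int hp r s.
exists (u * (d 0%N)%:~R); have [m1 m2 _] := mulu (d 0%N); split.
  by split=> //; rewrite hd sym_u.
by rewrite m2 h0; ring.
Qed.
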